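(* Let $Y$ be a real random variable (the response) and $\mathbf{X}=(X_1,\dots,X_p)$ a vector of real predictors. Let $\delta$ be the largest number such that for any insufficient subset $S\subseteq\{1,\dots,p\}$ there is some $j\notin S$ with $Q(S\cup\{j\})\ge Q(S)+\delta$. Suppose that $\delta>0$ and that the following two assumptions hold. (A1$'$) There are nonnegative real numbers $\beta$ and $C$ such that for any set $S\subseteq\{1,\ldots,p\}$ of size $\le 1/\delta+2$, any $\mathbf{x},\mathbf{x}'\in\mathbb{R}^S$ and any $t\in\mathbb{R}$, $$|\mathbb{P}(Y\ge t|\mathbf{X}_S=\mathbf{x})-\mathbb{P}(Y\ge t|\mathbf{X}_S=\mathbf{x}')|\le C(1+\|\mathbf{x}\|^\beta+\|\mathbf{x}'\|^\beta)\|\mathbf{x}-\mathbf{x}'\|.$$ (A2$'$) There are positive numbers $C_1$ and $C_2$ such that for any $S$ of size $\le1/\delta+2$ and any $t>0$, $\mathbb{P}(\|\mathbf{X}_S\|\ge t)\le C_1e^{-C_2t}$. Let $\hat S$ be the subset selected by the FOCI algorithm (described in the context) with a sample of size $n$. Then there are positive real numbers $L_1,L_2,L_3$ depending only on $C,\beta,C_1,C_2$ and $\delta$ such that $$\mathbb{P}(\hat S\text{ is sufficient})\ge 1-L_1p^{L_2}e^{-L_3n}.$$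
   Context: For $S\subseteq\{1,\dots,p\}$, $\mathbf{X}_S:=(X_j)_{j\in S}$ and $S^c:=\{1,\dots,p\}\setminus S$. $S$ is *sufficient* if $Y$ and $\mathbf{X}_{S^c}$ are conditionally independent given $\mathbf{X}_S$ (for $S=\emptyset$ this means that $Y$ and $\mathbf{X}$ are independent), and *insufficient* otherwise. With $\mu$ the law of $Y$, $Q(\emptyset):=0$ and, for nonempty $S$, $$Q(S):=\int\mathrm{Var}(\mathbb{P}(Y\ge t|\mathbf{X}_S))\,d\mu(t).$$ $\|\cdot\|$ is the Euclidean norm. **Estimators.** The data are $n\ge2$ i.i.d. copies $(Y_1,\mathbf{X}_1),\dots,(Y_n,\mathbf{X}_n)$ of $(Y,\mathbf{X})$. $R_i$ is the number of $j$ with $Y_j\le Y_i$; $L_i$ is the number of $j$ with $Y_j\ge Y_i$. For nonempty $S$, $N_S(i)$ is the index $j\ne i$ such that the vector of $S$-coordinates of $\mathbf{X}_j$ is the Euclidean nearest neighbor of the vector of $S$-coordinates of $\mathbf{X}_i$, with ties broken uniformly at random. Unconditionally, $$T_n(Y,X_j):=\frac{\sum_{i=1}^n(n\min\{R_i,R_{N_{\{j\}}(i)}\}-L_i^2)}{\sum_{i=1}^nL_i(n-L_i)},$$ and for nonempty $S$ and $j\notin S$, $$T_n(Y,X_j|\mathbf{X}_S):=\frac{\sum_{i=1}^n(\min\{R_i,R_{N_{S\cup\{j\}}(i)}\}-\min\{R_i,R_{N_S(i)}\})}{\sum_{i=1}^n(R_i-\min\{R_i,R_{N_S(i)}\})}.$$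 In both cases, $T_n$ is undefined if the denominator is zero. **FOCI.** First, choose $j_1$ to be the index $j$ that maximizes $T_n(Y,X_j)$. Having obtained $j_1,\dots,j_k$, choose $j_{k+1}$ to be the index $j\notin\{j_1,\dots,j_k\}$ that maximizes $T_n(Y,X_j|X_{j_1},\dots,X_{j_k})$. Continue like this until arriving at the first $k$ such that $T_n(Y,X_{j_{k+1}}|X_{j_1},\dots,X_{j_k})\le0$, and then set $\hat S:=\{j_1,\dots,j_k\}$. If there is no such $k$, $\hat S$ is defined to be the whole set $\{1,\dots,p\}$. If $T_n(Y,X_{j_1})\le0$, $\hat S$ is defined to be empty. *)

(* Defs.v *)
From HB Require Import structures.
From mathcomp Require Import all_boot all_order all_algebra.
From mathcomp Require Import all_classical all_reals all_analysis.
From mathcomp Require Import measurable_realfun.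
Import Order.TTheory GRing.Theory Num.Theory.
Import numFieldNormedType.Exports.
Set Implicit Arguments.
Unset Strict Implicit.
Unset Printing Implicit Defensive.
Local Open Scope classical_set_scope.
Local Open Scope ring_scope.

(* An element of R^S is a #|S|.-tuple; its coordinates are listed in the order
   of [enum S]. *)
Definition subvec (R : realType) (p : nat) (S : {set 'I_p}) (x : p.-tuple R) :
    #|S|.-tuple R :=
  [tuple tnth x (enum_val i) | i < #|S|].

Definition norm2 (R : realType) (m : nat) (x : m.-tuple R) : R :=
  Num.sqrt (\sum_(i < m) tnth x i ^+ 2).

Definition dist2 (R : realType) (m : nat) (x y : m.-tuple R) : R :=
  norm2 [tuple tnth x i - tnth y i | i < m].

(* [g] is a version of x |-> P(E | W = x); equivalently g \o W is a version of
   P(E | sigma(W)). *)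
Definition is_cond_prob d d' (T : measurableType d) (T' : measurableType d')
    (R : realType) (P : probability T R) (W : T -> T') (E : set T)
    (g : T' -> R) : Prop :=
  [/\ measurable_fun setT g,
      P.-integrable setT (EFin \o g \o W) &
      forall B, measurable B ->
        (\int[P]_(w in W @^-1` B) (g (W w))%:E = P (E `&` W @^-1` B))%E].

Section existence.
Context d d' (T : measurableType d) (T' : measurableType d') (R : realType).
Context (P : probability T R) (W : {mfun T >-> T'}) (E : set T).
Context (mE : measurable E).

Let mW B : measurable B -> measurable (W @^-1` B).
Proof.
by move=> mB; rewrite -[X in measurable X]setTI; exact: measurable_funP.
Qed.

Definition cond_prob_numerator (B : set T') : \bar R := P (E `&` W @^-1` B).
Local Notation nu := cond_prob_numerator.

Let nu0 : nu set0 = 0%E.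
Proof. by rewrite /nu preimage_set0 setI0 measure0. Qed.

Let nu_ge0 B : (0 <= nu B)%E.
Proof. exact: measure_ge0. Qed.

Let nu_sigma_additive : semi_sigma_additive nu.
Proof.
move=> F mF tF mUF; rewrite /nu preimage_bigcup setI_bigcupr.
apply: measure_semi_sigma_additive.
- by move=> n; apply: measurableI => //; exact: mW.
- apply/trivIsetP => /= i j _ _ ij.
  rewrite setIACA -preimage_setI.
  by move/trivIsetP : tF => /(_ _ _ I I ij) ->; rewrite preimage_set0 setI0.
- by apply: bigcup_measurable => n _; apply: measurableI => //; exact: mW.
Qed.

HB.instance Definition _ :=
  isMeasure.Build _ _ _ nu nu0 nu_ge0 nu_sigma_additive.

Let nu_fin : fin_num_fun nu.
Proof.
move=> B mB; apply: fin_num_measure; apply: measurableI => //; exact: mW.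
Qed.

HB.instance Definition _ := Measure_isFinite.Build _ _ _ nu nu_fin.

Lemma is_cond_prob_exists : exists g : T' -> R, is_cond_prob P W E g.
Proof.
have mWf : measurable_fun setT W by exact: measurable_funP.
have numu : nu `<< (distribution P W : probability T' R).
  apply/null_content_dominatesP => A mA PA0; apply/eqP.
  rewrite eq_le measure_ge0 andbT -PA0; apply: le_measure; rewrite ?inE.
  - by apply: measurableI => //; exact: mW.
  - exact: mW.
  - exact: subIsetr.
have [f [f0 ffin fint fE]] := radon_nikodym_sigma_finite numu.
have mf : measurable_fun setT f by exact: measurable_int fint.
have fc x : (fine (f x))%:E = f x by rewrite fineK.
have ifW : P.-integrable setT (f \o W).
  apply/integrableP; split; first exact: measurableT_comp.
  have /integrableP[_] := fint; apply: le_lt_trans.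
  rewrite /distribution ge0_integral_pushforward//; exact: measurableT_comp.
exists (fine \o f); split.
- exact: measurableT_comp.
- by apply: eq_integrable ifW => // x _ /=; rewrite fc.
- move=> B mB; have := fE B mB.
  rewrite /distribution integral_pushforward//; last first.
    by apply: integrableS ifW => //; exact: mW.
  rewrite /= /cond_prob_numerator => ->.
  by apply: eq_integral => x _ /=; rewrite fc.
Qed.

End existence.

(* The random variable P(E | W), for an arbitrarily chosen version.  A version
   exists as soon as E and W are measurable, see [is_cond_prob_exists]. *)
Definition cond_prob d d' (T : measurableType d) (T' : measurableType d')
    (R : realType) (P : probability T R) (W : T -> T') (E : set T) : T -> R :=
  xget (cst 0) [set g | is_cond_prob P W E g] \o W.

Definition indep d d1 d2 (T : measurableType d) (T1 : measurableType d1)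
    (T2 : measurableType d2) (R : realType) (P : probability T R)
    (U : T -> T1) (V : T -> T2) : Prop :=
  forall A B, measurable A -> measurable B ->
    (P (U @^-1` A `&` V @^-1` B) = P (U @^-1` A) * P (V @^-1` B))%E.

Definition cond_indep d d1 d2 d3 (T : measurableType d)
    (T1 : measurableType d1) (T2 : measurableType d2) (T3 : measurableType d3)
    (R : realType) (P : probability T R)
    (U : T -> T1) (V : T -> T2) (W : T -> T3) : Prop :=
  forall A B, measurable A -> measurable B ->
    {ae P, forall w, cond_prob P W (U @^-1` A `&` V @^-1` B) w =
                     cond_prob P W (U @^-1` A) w * cond_prob P W (V @^-1` B) w}.

Section population.
Context d (T : measurableType d) (R : realType) (P : probability T R).
Context (p : nat) (Y : {RV P >-> R}) (X : {RV P >-> p.-tuple R}).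
Implicit Types S : {set 'I_p}.

Definition sufficient S : Prop :=
  if S == finset.set0 then indep P Y X
  else cond_indep P Y (subvec (~: S) \o X) (subvec S \o X).

Definition Qpop S : \bar R :=
  if S == finset.set0 then 0%E
  else (\int[distribution P Y]_t
          'V_P[cond_prob P (subvec S \o X) [set w | (t <= Y w)%R]])%E.

Definition has_gap (delta : \bar R) : Prop :=
  forall S, ~ sufficient S ->
    exists2 j, j \notin S & (Qpop S + delta <= Qpop (j |: S)%SET)%E.

(* The maximum is taken in the extended reals: it is +oo exactly when every S is
   sufficient. *)
Definition largest_gap (delta : \bar R) : Prop :=
  has_gap delta /\ forall delta', has_gap delta' -> (delta' <= delta)%E.

Definition small_set (delta : \bar R) S : Prop :=
  ((#|S|%:R)%:E <= delta^-1 + 2%:E)%E.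

(* As P(Y >= t | X_S = x) is only defined up to a null set of x, the condition
   is on some version of it. *)
Definition assumption_A1 (delta : \bar R) (beta C : R) : Prop :=
  forall S, small_set delta S -> forall t : R,
    exists g : #|S|.-tuple R -> R,
      is_cond_prob P (subvec S \o X) [set w | t <= Y w] g /\
      forall x x' : #|S|.-tuple R,
        `|g x - g x'| <=
        C * (1 + norm2 x `^ beta + norm2 x' `^ beta) * dist2 x x'.

Definition assumption_A2 (delta : \bar R) (C1 C2 : R) : Prop :=
  forall S, small_set delta S -> forall t : R, 0 < t ->
    (P [set w | (t <= norm2 (subvec S (X w)))%R] <= (C1 * expR (- C2 * t))%:E)%E.

End population.

Section sample.
Context (R : realType) (n p : nat).
Context (y : 'I_n -> R) (x : 'I_n -> p.-tuple R).
Implicit Types S : {set 'I_p}.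

Definition rank (i : 'I_n) : nat := #|[set j | y j <= y i]%SET|.
Definition corank (i : 'I_n) : nat := #|[set j | y i <= y j]%SET|.

Definition nearest S (i : 'I_n) : {set 'I_n} :=
  [set j | (j != i) &&
     [forall k, (k != i) ==> (dist2 (subvec S (x i)) (subvec S (x j)) <=
                              dist2 (subvec S (x i)) (subvec S (x k)))]]%SET.

(* [N S i] is the nearest neighbor selected after tie breaking. *)
Context (N : {set 'I_p} -> 'I_n -> 'I_n).

Definition minrank S (i : 'I_n) : nat := minn (rank i) (rank (N S i)).

Definition Tn_num S (j : 'I_p) : R :=
  if S == finset.set0 then
    \sum_(i < n) (n%:R * (minrank [set j]%SET i)%:R - (corank i)%:R ^+ 2)
  else
    \sum_(i < n) ((minrank (j |: S)%SET i)%:R - (minrank S i)%:R).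

Definition Tn_den S : R :=
  if S == finset.set0 then
    \sum_(i < n) (corank i)%:R * (n%:R - (corank i)%:R)
  else
    \sum_(i < n) ((rank i)%:R - (minrank S i)%:R).

(* T_n(Y, X_j | X_S), and T_n(Y, X_j) when S is empty; None when undefined. *)
Definition Tn S (j : 'I_p) : option R :=
  if Tn_den S == 0 then None else Some (Tn_num S j / Tn_den S).

End sample.

Section foci.
Context (R : realType) (p : nat).
Context (tn : {set 'I_p} -> 'I_p -> option R).
Implicit Types S Shat : {set 'I_p}.

Definition maximizes S (j : 'I_p) (t : R) : Prop :=
  [/\ j \notin S, tn S j = Some t &
      forall k, k \notin S -> exists2 u, tn S k = Some u & u <= t].

(* [foci S Shat]: having selected S so far, the algorithm may output Shat.  It
   is a relation because the maximizer need not be unique.  If T_n is undefined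
   at S, then no rule applies, and every output that retains the current
   selection S is allowed. *)
Inductive foci : {set 'I_p} -> {set 'I_p} -> Prop :=
| foci_whole : foci finset.setT finset.setT
| foci_stop S j t : maximizes S j t -> t <= 0 -> foci S S
| foci_step S j t Shat : maximizes S j t -> 0 < t ->
    foci (j |: S)%SET Shat -> foci S Shat
| foci_undef S Shat : (exists2 j, j \notin S & tn S j = None) ->
    S \subset Shat -> foci S Shat.

End foci.

Section random_sample.
Context d d' (T : measurableType d) (T' : measurableType d') (R : realType).
Context (P : probability T R) (P' : probability T' R) (n p : nat).
Context (Y : {RV P >-> R}) (X : {RV P >-> p.-tuple R}).
Context (Ys : 'I_n -> {RV P' >-> R}) (Xs : 'I_n -> {RV P' >-> p.-tuple R}).

Definition iid_copies : Prop :=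
  (forall i (B : set (R * p.-tuple R)), measurable B ->
     P' ((fun w => (Ys i w, Xs i w)) @^-1` B) =
     P ((fun w => (Y w, X w)) @^-1` B)) /\
  (forall B : 'I_n -> set (R * p.-tuple R), (forall i, measurable (B i)) ->
     P' [set w | forall i, B i (Ys i w, Xs i w)] =
     (\prod_(i < n) P' ((fun w => (Ys i w, Xs i w)) @^-1` (B i)))%E).

Definition data (w : T') : n.-tuple (R * p.-tuple R)%type :=
  [tuple (Ys i w, Xs i w) | i < n].

Context (N : {set 'I_p} -> 'I_n -> T' -> 'I_n).

(* Conditionally on the data, the N S i (S nonempty) are independent and each
   N S i is uniform on [nearest]: the integrand is the conditional probability
   that N S i = g S i for all nonempty S and all i. *)
Definition uniform_tie_breaking : Prop :=
  (forall S i j, measurable [set w | N S i w = j]) /\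
  (forall (B : set (n.-tuple (R * p.-tuple R)%type))
      (g : {set 'I_p} -> 'I_n -> 'I_n), measurable B ->
    P' (data @^-1` B `&`
        [set w | forall S i, S != finset.set0 -> N S i w = g S i]) =
    (\int[P']_(w in data @^-1` B)
      (\prod_(S : {set 'I_p} | S != finset.set0) \prod_(i < n)
        (if g S i \in nearest (Xs ^~ w) S i
         then (#|nearest (Xs ^~ w) S i|%:R)^-1 else 0))%:E)%E).

(* Shat is a random subset, output by FOCI on every realization of the sample,
   with an arbitrary (measurable) choice among the maximizers. *)
Definition foci_output (Shat : T' -> {set 'I_p}) : Prop :=
  (forall A, measurable [set w | Shat w = A]) /\
  (forall w, foci (Tn (Ys ^~ w) (fun S i => N S i w)) finset.set0 (Shat w)).

End random_sample.

(* Main.v *)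
Require Import Defs.
From HB Require Import structures.
From mathcomp Require Import all_boot all_order all_algebra.
From mathcomp Require Import all_classical all_reals all_analysis.
From mathcomp Require Import measurable_realfun.
From mathcomp Require Import ring lra.
Import Order.TTheory GRing.Theory Num.Theory.
Import numFieldNormedType.Exports.
Set Implicit Arguments.
Unset Strict Implicit.
Unset Printing Implicit Defensive.
Local Open Scope classical_set_scope.
Local Open Scope ring_scope.

(** The limit of the numerators of T_n is the increment of Q, and everything
    reduces to an exponential bound for the deviation from this limit.

    Population side. Let G_S(t) = P(Y >= t | X_S). Then Q(S) is the average over
    t of E[G_S(t)^2] - P(Y >= t)^2, hence at most 1/4. On the event that the
    numerators are within delta / 4 of the increments of Q, up to scale, each
    index selected at an insufficient set raises Q by at least delta / 2. This
    can happen at most 1 / (2 delta) times, so only sets of bounded size matter,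
    and there are at most p ^ K of them. A nonpositive or undefined T_n at an
    insufficient set would contradict the estimate for the index given by the
    gap, and supersets of sufficient sets are sufficient [sufficientS]; so the
    output is sufficient [foci_sufficient].

    Sample side. Counting pairs, the sum of the minima of ranks is n times the
    sum over k of A(Y_k), where A(t) is the proportion of the i such that Y_i
    and Y_N(i) are both at least t [sum_minrank]. Both A and its limit
    a(t) = E[G_S(t)^2] are nonincreasing, so their averages are trapped between
    step functions on the grid of the quantiles of Y, and it is enough to
    control A at finitely many thresholds, together with the frequencies of
    half-lines [average_close].

    Fixed threshold [threshold_concentration]. Given the predictors, the pairs
    (1{Y_i >= t}, N(i)) are independent over i, with explicit finite laws:
    G_S(t)(X_i) for the first component and the uniform law on the nearest
    neighbors for the second one [pr_outcomes]. The sum of the products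
    1{Y_i >= t} 1{Y_N(i) >= t} is not a function with bounded differences of
    these pairs, since a point may be the neighbor of many others, but it
    becomes one after truncation of the in-degrees at a constant D, and the
    truncation error, the total excess of the in-degrees over D, also has
    bounded differences. Its mean is small because the expected in-degrees are
    bounded: the points that share a location share their neighbors evenly, and
    for the other points the kissing number of the space enters
    [near_weight_in]. McDiarmid's inequality then applies twice
    [edge_sum_concentration]. The conditional mean of the sum is close to the
    sum of the G_S(t)(X_i)^2, because G_S(t) is Lipschitz on balls, the tail
    bound puts most points in a ball, and all points of the ball but one per
    cell of a fixed finite partition have their nearest neighbors nearby
    [edge_mean_close]. *)

(** * Bounded differences under finite product weights *)

Section finite_product.
Context (R : realType) (I A : finType) (q : I -> A -> R).
Hypothesis q_ge0 : forall i a, 0 <= q i a.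
Hypothesis q_sum1 : forall i, \sum_a q i a = 1.
Implicit Types (f g : {ffun I -> A} -> R) (w : {ffun I -> A}).

Definition Ex f : R := \sum_(w : {ffun I -> A}) (\prod_i q i (w i)) * f w.

Lemma Ex_weight_ge0 w : 0 <= \prod_i q i (w i).
Proof. by apply: prodr_ge0. Qed.

Lemma Ex_prod (F : I -> A -> R) :
  Ex (fun w => \prod_i F i (w i)) = \prod_i \sum_a q i a * F i a.
Proof.
rewrite bigA_distr_bigA /=; apply: eq_bigr => w _.
by rewrite -big_split.
Qed.

Lemma Ex_cst c : Ex (fun=> c) = c.
Proof.
rewrite /Ex -mulr_suml -bigA_distr_bigA /= big1 ?mul1r//.
Qed.

Lemma ExD f g : Ex (fun w => f w + g w) = Ex f + Ex g.
Proof. by rewrite /Ex -big_split /=; apply: eq_bigr => w _; rewrite mulrDr. Qed.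

Lemma ExZ c f : Ex (fun w => c * f w) = c * Ex f.
Proof. by rewrite /Ex mulr_sumr; apply: eq_bigr => w _; rewrite mulrCA. Qed.

Lemma ExN f : Ex (fun w => - f w) = - Ex f.
Proof. by rewrite /Ex -sumrN; apply: eq_bigr => w _; rewrite mulrN. Qed.

Lemma Ex_sum (J : finType) (D : pred J) (F : J -> {ffun I -> A} -> R) :
  Ex (fun w => \sum_(j | D j) F j w) = \sum_(j | D j) Ex (F j).
Proof.
rewrite /Ex exchange_big /=; apply: eq_bigr => w _; by rewrite mulr_sumr.
Qed.

Lemma eq_Ex f g : f =1 g -> Ex f = Ex g.
Proof. by move=> fg; apply: eq_bigr => w _; rewrite fg. Qed.

Lemma le_Ex f g : (forall w, f w <= g w) -> Ex f <= Ex g.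
Proof.
by move=> fg; apply: ler_sum => w _; rewrite ler_wpM2l ?Ex_weight_ge0.
Qed.

Lemma Ex1 (i : I) (F : A -> R) : Ex (fun w => F (w i)) = \sum_a q i a * F a.
Proof.
have -> : Ex (fun w => F (w i)) =
    Ex (fun w => \prod_k (if k == i then F (w k) else 1)).
  by apply: eq_Ex => w; rewrite -big_mkcond big_pred1_eq.
rewrite (Ex_prod (fun k a => if k == i then F a else 1)) (bigD1 i)//= eqxx.
rewrite [X in _ * X]big1 ?mulr1// => k /negbTE ->.
by under eq_bigr do rewrite mulr1.
Qed.

Lemma Ex2 (i j : I) (F G : A -> R) : i != j ->
  Ex (fun w => F (w i) * G (w j)) =
  (\sum_a q i a * F a) * (\sum_a q j a * G a).
Proof.
move=> ij.
have -> : Ex (fun w => F (w i) * G (w j)) =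
    Ex (fun w => \prod_k (if k == i then F (w k)
                          else if k == j then G (w k) else 1)).
  apply: eq_Ex => w; rewrite (bigD1 i)//= eqxx (bigD1 j)//=; last first.
    by rewrite eq_sym.
  rewrite eq_sym (negbTE ij) eqxx big1 ?mulr1// => k /andP[/negbTE -> /negbTE ->].
  by [].
rewrite (Ex_prod (fun k a => if k == i then F a
                             else if k == j then G a else 1)).
rewrite (bigD1 i)//= eqxx (bigD1 j)//=; last by rewrite eq_sym.
rewrite eq_sym (negbTE ij) eqxx [X in _ * (_ * X)]big1 ?mulr1//.
by move=> k /andP[/negbTE -> /negbTE ->]; under eq_bigr do rewrite mulr1.
Qed.

Definition upd w i a : {ffun I -> A} := [ffun k => if k == i then a else w k].

Definition avg i f w : R := \sum_a q i a * f (upd w i a).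

Lemma upd_upd w i a b : upd (upd w i a) i b = upd w i b.
Proof. by apply/ffunP => k; rewrite !ffunE; case: eqP. Qed.

Lemma upd_id w i : upd w i (w i) = w.
Proof. by apply/ffunP => k; rewrite !ffunE; case: eqP => [->|]. Qed.

Lemma updC w i j a b : i != j -> upd (upd w i a) j b = upd (upd w j b) i a.
Proof.
move=> ij; apply/ffunP => k; rewrite !ffunE; case: (k =P j) => [->|//].
by rewrite eq_sym (negbTE ij).
Qed.

(** Resampling one coordinate is an involution of the pairs (configuration,
    fresh value) which exchanges the old value and the new one; it preserves
    the product weights. *)
Lemma Ex_avg i f : Ex (avg i f) = Ex f.
Proof.
pose swap (x : {ffun I -> A} * A) := (upd x.1 i x.2, x.1 i).
have swapK : involutive swap.
  by case=> w a; rewrite /swap /= upd_upd upd_id ffunE eqxx.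
transitivity (\sum_(x : {ffun I -> A} * A)
    (\prod_k q k (x.1 k)) * q i x.2 * f (upd x.1 i x.2)).
  rewrite -(pair_bigA _ (fun w a => (\prod_k q k (w k)) * q i a * f (upd w i a)))/=.
  by apply: eq_bigr => w _; rewrite mulr_sumr; apply: eq_bigr => a _; rewrite mulrA.
rewrite (reindex_inj (inv_inj swapK)) /=.
transitivity (\sum_(x : {ffun I -> A} * A)
    (\prod_k q k (x.1 k)) * f x.1 * q i x.2); last first.
  rewrite -(pair_bigA _ (fun w a => (\prod_k q k (w k)) * f w * q i a))/=.
  by apply: eq_bigr => w _; rewrite -mulr_sumr q_sum1 mulr1.
apply: eq_bigr => -[w a] _ /=; rewrite upd_upd upd_id.
rewrite (bigD1 i)//= [in RHS](bigD1 i)//= ffunE eqxx.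
have -> : \prod_(k | k != i) q k (upd w i a k) = \prod_(k | k != i) q k (w k).
  by apply: eq_bigr => k /negbTE ki; rewrite ffunE ki.
ring.
Qed.

Definition bounded_diff (c : I -> R) f :=
  forall w i a, `|f (upd w i a) - f w| <= c i.

Lemma avg_bounded_diff i c f : bounded_diff c f ->
  bounded_diff (fun k => if k == i then 0 else c k) (avg i f).
Proof.
move=> bf w k a; case: eqP => [->|/eqP ki].
  by rewrite /avg; under eq_bigr do rewrite upd_upd; rewrite subrr normr0.
rewrite /avg -sumrB (le_trans (ler_norm_sum _ _ _))//.
rewrite -[leRHS]mul1r -(q_sum1 i) mulr_suml ler_sum// => b _.
rewrite -mulrBr normrM (ger0_norm (q_ge0 _ _)) ler_wpM2l//.
by rewrite updC.
Qed.

Lemma bounded_diff0_cst f : bounded_diff (fun=> 0) f -> forall w w', f w = f w'.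
Proof.
move=> f0 w w'.
have f0' v i a : f (upd v i a) = f v.
  by apply/eqP; rewrite -subr_eq0 -normr_le0 f0.
pose patch s := foldr (fun i v => upd v i (w i)) w' s.
have patchE s : f (patch s) = f w' by elim: s => //= i s IH; rewrite f0'.
rewrite -(patchE (enum I)); congr f; apply/ffunP => k.
have : k \in enum I by rewrite mem_enum.
elim: (enum I) => //= i s IH; rewrite inE ffunE.
by case: eqP => [->|_ /IH].
Qed.

(** The inverse of the bound 1 - z <= exp(- z). *)
Lemma expR_le_quad (z : R) : z <= 1/2 -> expR z <= 1 + z + 2 * z ^+ 2.
Proof.
move=> z2; have := expR_ge1Dx (- z); rewrite expRN => ez.
have ez0 := expR_gt0 z.
have {}ez : (1 - z) * expR z <= 1 by rewrite -ler_pdivlMr// div1r.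
have z1 : 0 < 1 - z by lra.
rewrite -(ler_pM2l z1) (le_trans ez)//.
rewrite -subr_ge0.
have -> : (1 - z) * (1 + z + 2 * z ^+ 2) - 1 = z ^+ 2 * (1 - 2 * z) by ring.
by rewrite mulr_ge0 ?sqr_ge0//; lra.
Qed.

(** Hoeffding's lemma for one resampled coordinate, with a worse constant: the
    linear term of the quadratic bound on exp averages to zero. *)
Lemma avg_expR i (lam c : R) f : 0 <= lam -> lam * c <= 1/2 ->
  (forall w a, `|f (upd w i a) - f w| <= c) ->
  forall w, avg i (fun v => expR (lam * f v)) w <=
            expR (2 * (lam * c) ^+ 2) * expR (lam * avg i f w).
Proof.
move=> lam0 lamc fc w.
set m := avg i f w.
pose z a := lam * (f (upd w i a) - m).
have zc a : `|z a| <= lam * c.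
  rewrite /z normrM ger0_norm// ler_wpM2l//.
  have -> : f (upd w i a) - m = \sum_b q i b * (f (upd w i a) - f (upd w i b)).
    under [RHS]eq_bigr do rewrite mulrBr.
    by rewrite sumrB -mulr_suml q_sum1 mul1r.
  rewrite (le_trans (ler_norm_sum _ _ _))//.
  rewrite -[leRHS]mul1r -(q_sum1 i) mulr_suml ler_sum// => b _.
  rewrite normrM (ger0_norm (q_ge0 _ _)) ler_wpM2l//.
  by rewrite -(upd_upd w i b a) fc.
have z0 : \sum_a q i a * z a = 0.
  rewrite /z; under eq_bigr do rewrite mulrCA mulrBr.
  by rewrite -mulr_sumr sumrB -mulr_suml q_sum1 mul1r subrr mulr0.
have -> : avg i (fun v => expR (lam * f v)) w =
    (\sum_a q i a * expR (z a)) * expR (lam * m).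
  rewrite /avg mulr_suml; apply: eq_bigr => a _.
  by rewrite -mulrA -expRD /z; congr (_ * expR _); ring.
rewrite ler_wpM2r ?expR_ge0//.
apply: (@le_trans _ _ (1 + 2 * (lam * c) ^+ 2)); last exact: expR_ge1Dx.
apply: (@le_trans _ _ (\sum_a q i a * (1 + z a + 2 * (lam * c) ^+ 2))).
  apply: ler_sum => a _; rewrite ler_wpM2l//.
  apply: (le_trans (expR_le_quad _)).
    by rewrite (le_trans _ lamc)// (le_trans (ler_norm _)).
  rewrite lerD2l ler_wpM2l//.
  have lc0 : 0 <= lam * c by exact: le_trans (zc a).
  by rewrite -real_normK ?num_real// ler_sqr ?nnegrE// zc.
under eq_bigr do rewrite !mulrDr mulr1.
by rewrite !big_split /= q_sum1 z0 -mulr_suml q_sum1 addr0 mul1r.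
Qed.

(** Averaging out all the coordinates, one after the other, leaves the constant
    Ex f, and each step costs one factor of Hoeffding's lemma. *)
Lemma Ex_expR (lam c : R) f : 0 <= lam -> 0 <= c -> lam * c <= 1/2 ->
  bounded_diff (fun=> c) f ->
  Ex (fun w => expR (lam * (f w - Ex f))) <=
  expR (2 * (lam * c) ^+ 2 *+ #|I|).
Proof.
move=> lam0 c0 lamc fc.
pose fs s := foldr avg f s.
have fsbd s : bounded_diff (fun k => if k \in s then 0 else c) (fs s).
  elim: s => [//|i s IH] w k a /=.
  have := avg_bounded_diff i IH w k a; rewrite inE.
  by case: (k == i).
have fsE s : Ex (fs s) = Ex f by elim: s => //= i s <-; rewrite Ex_avg.
have step s : Ex (fun w => expR (lam * f w)) <=
    expR (2 * (lam * c) ^+ 2 *+ size s) * Ex (fun w => expR (lam * fs s w)).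
  elim: s => [|i s IH] /=; first by rewrite mulr0n expR0 mul1r.
  apply: (le_trans IH); rewrite [_ *+ (size s).+1]mulrSr expRD -mulrA ler_wpM2l ?expR_ge0//.
  rewrite -(Ex_avg i (fun w => expR _)) -ExZ; apply: le_Ex => w.
  apply: avg_expR => // v a; apply: (le_trans (fsbd s v i a)).
  by case: ifP.
have fcst w : fs (enum I) w = Ex f.
  rewrite -(fsE (enum I)) -[LHS]Ex_cst; apply: eq_Ex => v.
  apply: bounded_diff0_cst => {v} v i a.
  by have := fsbd (enum I) v i a; rewrite mem_enum.
have -> : Ex (fun w => expR (lam * (f w - Ex f))) =
    expR (- (lam * Ex f)) * Ex (fun w => expR (lam * f w)).
  rewrite -ExZ; apply: eq_Ex => w; rewrite -expRD; congr expR; ring.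
have := step (enum I); rewrite -cardE.
have -> : Ex (fun w => expR (lam * fs (enum I) w)) = expR (lam * Ex f).
  by rewrite -[RHS]Ex_cst; apply: eq_Ex => w; rewrite fcst.
move=> h; rewrite mulrC expRN ler_pdivrMr ?expR_gt0//.
Qed.

Definition Pr (B : pred {ffun I -> A}) : R := Ex (fun w => (B w)%:R).

Lemma le_Pr (B B' : pred {ffun I -> A}) : (forall w, B w -> B' w) -> Pr B <= Pr B'.
Proof.
by move=> BB'; apply: le_Ex => w; case: (B w) (BB' w) => // ->.
Qed.

Lemma Pr_or (B B' : pred {ffun I -> A}) :
  Pr (fun w => B w || B' w) <= Pr B + Pr B'.
Proof.
rewrite -ExD; apply: le_Ex => w.
by case: (B w); case: (B' w) => //=; lra.
Qed.

(** McDiarmid's inequality, one sided. The choice lam = eps / (4 c^2) optimizes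
    the exponent - lam eps n + 2 lam^2 c^2 n. *)
Lemma mcdiarmid (eps c : R) f : 0 < c -> 0 < eps -> eps <= 2 * c ->
  bounded_diff (fun=> c) f ->
  Pr (fun w => Ex f + eps * #|I|%:R < f w) <=
  expR (- (eps ^+ 2 / (8 * c ^+ 2)) * #|I|%:R).
Proof.
move=> c0 e0 ec fc.
pose lam := eps / (4 * c ^+ 2).
have lam0 : 0 < lam by rewrite divr_gt0// mulr_gt0// exprn_gt0.
have lamc : lam * c = eps / (4 * c) by rewrite /lam; field; rewrite gt_eqF.
have lamc2 : lam * c <= 1/2.
  by rewrite lamc ler_pdivrMr ?mulr_gt0//; lra.
have := Ex_expR (ltW lam0) (ltW c0) lamc2 fc.
rewrite -(ler_pM2l (expR_gt0 (- (lam * eps * #|I|%:R)))) -ExZ -expRD => h.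
apply: (@le_trans _ _ (Ex (fun w => expR (- (lam * eps * #|I|%:R)) *
    expR (lam * (f w - Ex f))))).
  apply: le_Ex => w; case: (boolP (_ < f w)) => [fw|_] /=; last first.
    by rewrite mulr_ge0 ?expR_ge0.
  rewrite -expRD -[leLHS]expR0 ler_expR.
  have -> : - (lam * eps * #|I|%:R) + lam * (f w - Ex f) =
      lam * (f w - (Ex f + eps * #|I|%:R)) by ring.
  by rewrite mulr_ge0 ?ltW// subr_gt0.
apply: (le_trans h); rewrite ler_expR le_eqVlt; apply/orP; left; apply/eqP.
rewrite lamc -mulr_natr /lam; field; rewrite gt_eqF//.
Qed.

Lemma bounded_diffN c f : bounded_diff c f -> bounded_diff c (fun w => - f w).
Proof. by move=> fc w i a; rewrite -opprD normrN fc. Qed.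

Lemma mcdiarmid_abs (eps c : R) f : 0 < c -> 0 < eps -> eps <= 2 * c ->
  bounded_diff (fun=> c) f ->
  Pr (fun w => eps * #|I|%:R < `|f w - Ex f|) <=
  2 * expR (- (eps ^+ 2 / (8 * c ^+ 2)) * #|I|%:R).
Proof.
move=> c0 e0 ec fc.
have h1 := mcdiarmid c0 e0 ec fc.
have h2 := mcdiarmid c0 e0 ec (bounded_diffN fc).
rewrite ExN in h2.
rewrite mulr_natl mulr2n; apply: le_trans (lerD h1 h2).
apply: le_trans (Pr_or _ _); apply: le_Pr => w.
by rewrite ltr_normr => /orP[] ?; apply/orP; [left|right]; lra.
Qed.

End finite_product.

(** * Sums over the edges of a random functional graph *)

Section edge_sums.
Context (R : realType) (n : nat) (g : 'I_n -> R) (wt : 'I_n -> 'I_n -> R).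
Hypothesis g01 : forall i, 0 <= g i <= 1.
Hypothesis wt_ge0 : forall i j, 0 <= wt i j.
Hypothesis wt_sum1 : forall i, \sum_j wt i j = 1.
Hypothesis wt_diag : forall i, wt i i = 0.

Definition bern (x : R) (v : bool) : R := if v then x else 1 - x.

Lemma bern_ge0 x v : 0 <= x <= 1 -> 0 <= bern x v.
Proof. by case: v => /andP[x0 x1] //=; rewrite subr_ge0. Qed.

Lemma bern_sum1 x : \sum_v bern x v = 1.
Proof. by rewrite big_bool /=; ring. Qed.

(** A letter is a response indicator together with the index of a neighbor. *)
Definition edge_law (i : 'I_n) (a : bool * 'I_n) : R := bern (g i) a.1 * wt i a.2.

Implicit Types w : {ffun 'I_n -> bool * 'I_n}.

Lemma edge_law_ge0 i a : 0 <= edge_law i a.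
Proof. by rewrite mulr_ge0// bern_ge0. Qed.

Lemma sum_edge_law i (F : bool -> R) (G : 'I_n -> R) :
  \sum_a edge_law i a * (F a.1 * G a.2) =
  (\sum_v bern (g i) v * F v) * (\sum_j wt i j * G j).
Proof.
rewrite mulr_suml -(pair_bigA _ (fun v j => edge_law i (v, j) * (F v * G j))) /=.
apply: eq_bigr => v _; rewrite mulr_sumr; apply: eq_bigr => j _.
by rewrite /edge_law /=; ring.
Qed.

Lemma edge_law_sum1 i : \sum_a edge_law i a = 1.
Proof.
have := sum_edge_law i (fun=> 1) (fun=> 1).
under eq_bigr do rewrite !mulr1.
move=> ->; under eq_bigr do rewrite mulr1.
rewrite bern_sum1 mul1r; by under eq_bigr do rewrite mulr1.
Qed.

Let E := Ex edge_law.

Definition edge_sum w : R := \sum_i (w i).1%:R * (w (w i).2).1%:R.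

Definition indeg w j : R := \sum_i ((w i).2 == j)%:R.

(** The number of successful sources of the edges that end in j. *)
Definition vote w j : R := \sum_i (w i).1%:R * ((w i).2 == j)%:R.

Definition trunc_edge_sum (D : R) w : R :=
  \sum_j (w j).1%:R * Num.min D (vote w j).

Definition excess (D : R) w : R := \sum_j Num.max 0 (indeg w j - D).

Lemma edge_sumE w : edge_sum w = \sum_j (w j).1%:R * vote w j.
Proof.
rewrite /edge_sum /vote.
under [RHS]eq_bigr do rewrite mulr_sumr.
rewrite exchange_big /=; apply: eq_bigr => i _.
rewrite (bigD1 (w i).2)//= eqxx mulr1 big1 ?addr0 1?mulrC// => j ji.
by rewrite eq_sym (negbTE ji) !mulr0.
Qed.

Lemma vote_le_indeg w j : 0 <= vote w j <= indeg w j.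
Proof.
apply/andP; split; first by apply: sumr_ge0 => i _; rewrite mulr_ge0.
by apply: ler_sum => i _; case: (w i).1; rewrite ?mul1r ?mul0r.
Qed.

(** Truncation loses at most the edges that exceed the in-degree D. *)
Lemma trunc_edge_sum_le D w :
  0 <= edge_sum w - trunc_edge_sum D w <= excess D w.
Proof.
rewrite edge_sumE /trunc_edge_sum -sumrB; apply/andP; split.
  apply: sumr_ge0 => j _; rewrite -mulrBr mulr_ge0// subr_ge0.
  by rewrite ge_min lexx orbT.
apply: ler_sum => j _; rewrite -mulrBr.
have /andP[v0 vd] := vote_le_indeg w j.
have h : vote w j - Num.min D (vote w j) <= Num.max 0 (indeg w j - D).
  rewrite le_max; case: (leP D (vote w j)) => Dv; last by rewrite subrr lexx.
  by rewrite lerD2r vd orbT.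
case: (w j).1; rewrite ?mul1r// mul0r.
by rewrite le_max lexx.
Qed.

Lemma sum_eq_le1 (a : 'I_n) : \sum_j (a == j)%:R = 1 :> R.
Proof.
rewrite (bigD1 a)//= eqxx big1 ?addr0// => j; by rewrite eq_sym => /negbTE ->.
Qed.

Lemma indeg_upd w k a j : `|indeg (upd w k a) j - indeg w j| <=
  (a.2 == j)%:R + ((w k).2 == j)%:R.
Proof.
rewrite /indeg -sumrB (bigD1 k)//= big1 ?addr0; last first.
  by move=> i /negbTE ik; rewrite ffunE ik subrr.
rewrite ffunE eqxx.
by case: (a.2 == j); case: (_ == j) => /=; rewrite ?subr0 ?subrr ?sub0r ?normrN ?normr0 ?normr1//; lra.
Qed.

Lemma vote_upd w k a j : `|vote (upd w k a) j - vote w j| <=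
  (a.2 == j)%:R + ((w k).2 == j)%:R.
Proof.
rewrite /vote -sumrB (bigD1 k)//= big1 ?addr0; last first.
  by move=> i /negbTE ik; rewrite ffunE ik subrr.
rewrite ffunE eqxx.
by case: (a.2 == j); case: (_ == j); case: a.1; case: (w k).1 => /=;
  rewrite ?mulr1 ?mulr0 ?subr0 ?subrr ?sub0r ?normrN ?normr0 ?normr1//; lra.
Qed.

Lemma excess_bounded_diff D : 0 <= D -> bounded_diff (fun=> D + 2) (excess D).
Proof.
move=> D0 w k a; rewrite /excess -sumrB (le_trans (ler_norm_sum _ _ _))//.
apply: (@le_trans _ _ (\sum_j ((a.2 == j)%:R + ((w k).2 == j)%:R))).
  apply: ler_sum => j _; apply: le_trans (indeg_upd w k a j).
  set x := indeg _ _; set y := indeg _ _.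
  have b1 := ler_norm (x - y); have b2 := ler_norm (y - x).
  rewrite (distrC y) in b2.
  by rewrite ler_norml; case: (leP 0 (x - D)); case: (leP 0 (y - D)); lra.
by rewrite big_split /= !sum_eq_le1; lra.
Qed.

(** Moving one edge changes one source, with at most D truncated votes, and the
    votes of its old and new targets. *)
Lemma trunc_bounded_diff D : 0 <= D ->
  bounded_diff (fun=> D + 2) (trunc_edge_sum D).
Proof.
move=> D0 w k a; rewrite /trunc_edge_sum -sumrB (le_trans (ler_norm_sum _ _ _))//.
apply: (@le_trans _ _ (\sum_j (D * (k == j)%:R +
    ((a.2 == j)%:R + ((w k).2 == j)%:R)))); last first.
  by rewrite !big_split /= !sum_eq_le1 -mulr_sumr sum_eq_le1; lra.
apply: ler_sum => j _.
set x := Num.min D (vote (upd w k a) j); set y := Num.min D (vote w j).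
have [x0 xD] : 0 <= x /\ x <= D.
  rewrite /x ge_min lexx le_min D0; split=> //.
  by have /andP[] := vote_le_indeg (upd w k a) j.
have [y0 yD] : 0 <= y /\ y <= D.
  rewrite /y ge_min lexx le_min D0; split=> //.
  by have /andP[] := vote_le_indeg w j.
have xy : `|x - y| <= (a.2 == j)%:R + ((w k).2 == j)%:R.
  apply: le_trans (vote_upd w k a j); rewrite /x /y.
  set s := vote _ _; set t := vote _ _.
  have b1 := ler_norm (s - t); have b2 := ler_norm (t - s).
  rewrite (distrC t) in b2.
  by rewrite ler_norml; case: (leP D s); case: (leP D t); lra.
rewrite ffunE [j == k]eq_sym; case: eqP => [kj|_]; last first.
  rewrite mulr0 add0r -mulrBr normrM.
  by case: (w j).1; rewrite ?normr1 ?normr0 ?mul1r// mul0r addr_ge0.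
rewrite mulr1; move: xy; rewrite !ler_norml => /andP[? ?].
by case: a.1; case: (w j).1; rewrite ?mul1r ?mul0r; apply/andP; split; lra.
Qed.

(** The source and the target of an edge are distinct, so their indicators are
    independent. *)
Lemma E_edge_sum : E edge_sum = \sum_i g i * \sum_j wt i j * g j.
Proof.
rewrite /E; under eq_Ex => w do rewrite edge_sumE /vote.
transitivity (E (fun w => \sum_j \sum_i (w j).1%:R * ((w i).1%:R * ((w i).2 == j)%:R))).
  by apply: eq_Ex => w; apply: eq_bigr => j _; rewrite mulr_sumr.
rewrite /E Ex_sum.
transitivity (\sum_j \sum_i g j * (g i * wt i j)).
  apply: eq_bigr => j _; rewrite Ex_sum; apply: eq_bigr => i _.
  have sg k : \sum_v bern (g k) v * v%:R = g k.
    by rewrite big_bool /= mulr1 mulr0 addr0.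
  have sw k l : \sum_j0 wt k j0 * (j0 == l)%:R = wt k l.
    rewrite (bigD1 l)//= eqxx mulr1 big1 ?addr0// => m /negbTE ->.
    by rewrite mulr0.
  have e1 := sum_edge_law i (fun v => v%:R) (fun j0 => (j0 == j)%:R).
  case: (eqVneq j i) => [ji|ji]; last first.
    rewrite (Ex2 edge_law_sum1 (fun a => a.1%:R)
      (fun a => a.1%:R * (a.2 == j)%:R) ji) e1 sg sw.
    congr (_ * _).
    have := sum_edge_law j (fun v => v%:R) (fun=> 1).
    under eq_bigr do rewrite mulr1.
    move=> ->; rewrite sg; under eq_bigr do rewrite mulr1.
    by rewrite wt_sum1 mulr1.
  rewrite -ji wt_diag !mulr0.
  rewrite (Ex1 edge_law_sum1 j (fun a => a.1%:R * (a.1%:R * (a.2 == j)%:R))).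
  rewrite big1// => -[v l] _ /=.
  case: (eqVneq l j) => [->|_]; last by rewrite !mulr0.
  by rewrite /edge_law /= wt_diag mulr0 mul0r.
rewrite exchange_big /=; apply: eq_bigr => i _; rewrite mulr_sumr.
by apply: eq_bigr => j _; ring.
Qed.

Section indegree_bound.
Variable kap : R.
Hypothesis kap_ge0 : 0 <= kap.
Hypothesis wt_in : forall j, \sum_i wt i j <= kap.

Lemma E_indeg2 j : E (fun w => indeg w j ^+ 2) <= kap + kap ^+ 2.
Proof.
have sw k l : \sum_a edge_law k a * (a.2 == l)%:R = wt k l.
  have := sum_edge_law k (fun=> 1) (fun j0 => (j0 == l)%:R).
  under eq_bigr do rewrite mul1r.
  move=> ->; under eq_bigr do rewrite mulr1.
  rewrite bern_sum1 mul1r (bigD1 l)//= eqxx mulr1 big1 ?addr0// => m /negbTE ->.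
  by rewrite mulr0.
have -> : E (fun w => indeg w j ^+ 2) =
    \sum_i \sum_k E (fun w => ((w i).2 == j)%:R * ((w k).2 == j)%:R).
  rewrite /E; under eq_bigr do rewrite -Ex_sum.
  rewrite -Ex_sum; apply: eq_Ex => w; rewrite expr2 /indeg mulr_suml.
  by apply: eq_bigr => i _; rewrite mulr_sumr.
apply: (@le_trans _ _ (\sum_i \sum_k ((i == k)%:R * wt i j + wt i j * wt k j))).
  apply: ler_sum => i _; apply: ler_sum => k _; rewrite /E; case: (eqVneq i k) => [<-|ik].
    rewrite mul1r (Ex1 edge_law_sum1 i (fun a => (a.2 == j)%:R * (a.2 == j)%:R)).
    under eq_bigr do rewrite -natrM mulnb andbb.
    by rewrite sw lerDl mulr_ge0.
  by rewrite (Ex2 edge_law_sum1 (fun a => (a.2 == j)%:R)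
      (fun a => (a.2 == j)%:R) ik) !sw mul0r add0r.
under eq_bigr do rewrite big_split /= -mulr_suml sum_eq_le1 mul1r -mulr_sumr.
rewrite big_split /= -mulr_suml lerD//.
have s0 : 0 <= \sum_i wt i j by apply: sumr_ge0.
by rewrite expr2 ler_pM.
Qed.

(** The positive part of x - D is at most x ^ 2 / D for x >= 0. *)
Lemma E_excess (D : R) : 0 < D -> E (excess D) <= (kap + kap ^+ 2) / D * n%:R.
Proof.
move=> D0; rewrite /E /excess Ex_sum.
apply: (@le_trans _ _ (\sum_(j < n) (kap + kap ^+ 2) / D)); last first.
  by rewrite sumr_const card_ord mulr_natr.
apply: ler_sum => j _.
apply: (@le_trans _ _ (E (fun w => D^-1 * indeg w j ^+ 2))); last first.
  rewrite /E ExZ mulrC ler_wpM2r ?invr_ge0 ?(ltW D0)//; exact: E_indeg2.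
apply: (le_Ex edge_law_ge0) => w; set d := indeg w j.
rewrite ge_max; apply/andP; split.
  by rewrite mulr_ge0 ?sqr_ge0// invr_ge0 ltW.
rewrite mulrC ler_pdivlMr//.
have := sqr_ge0 (d - D); have : 0 <= d by apply: sumr_ge0.
nra.
Qed.

(** The edge sum is not a function with bounded differences, because a vertex
    may be the neighbor of many others. Its truncation at in-degree D is, and
    so is the excess which controls the truncation error; D is chosen so that
    the expected excess is at most eps n / 2. *)
Lemma edge_sum_concentration (eps : R) : 0 < eps -> eps <= 1 ->
  Pr edge_law (fun w => 3 * eps * n%:R <
    `|edge_sum w - \sum_i g i * \sum_j wt i j * g j|) <=
  3 * expR (- (eps ^+ 2 / (8 * (2 * (kap + kap ^+ 2 + 1) / eps + 2) ^+ 2)) * n%:R).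
Proof.
move=> e0 e1; rewrite -E_edge_sum; set D := 2 * _ / eps.
have D0 : 0 < D.
  by rewrite divr_gt0// mulr_gt0// ltr_wpDl// addr_ge0// exprn_ge0.
have c0 : 0 < D + 2 by rewrite addr_gt0.
have ec : eps <= 2 * (D + 2) by lra.
have h1 := mcdiarmid_abs edge_law_ge0 edge_law_sum1 c0 e0 ec
  (trunc_bounded_diff (ltW D0)).
have h2 := mcdiarmid edge_law_ge0 edge_law_sum1 c0 e0 ec
  (excess_bounded_diff (ltW D0)).
rewrite card_ord in h1, h2.
set r := expR _ in h1 h2 *.
have -> : 3 * r = 2 * r + r by ring.
apply: le_trans (lerD h1 h2); apply: le_trans (Pr_or edge_law_ge0 _ _).
apply: (le_Pr edge_law_ge0) => w /=; apply: contraLR.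
rewrite negb_or -!leNgt -/E => /andP[a1 a2].
have [b1 b2] : 0 <= E edge_sum - E (trunc_edge_sum D) /\
    E edge_sum - E (trunc_edge_sum D) <= E (excess D).
  rewrite /E -ExN -ExD; split.
    rewrite -(Ex_cst edge_law_sum1 0); apply: (le_Ex edge_law_ge0) => v.
    by have /andP[] := trunc_edge_sum_le D v.
  by apply: (le_Ex edge_law_ge0) => v; have /andP[] := trunc_edge_sum_le D v.
have /andP[b3 b4] := trunc_edge_sum_le D w.
have b5 : E (excess D) <= eps / 2 * n%:R.
  apply: (le_trans (E_excess D0)); rewrite ler_wpM2r//.
  have k0 : 0 < kap + kap ^+ 2 + 1 by rewrite ltr_wpDl// addr_ge0// exprn_ge0.
  have -> : (kap + kap ^+ 2) / D = eps / 2 * ((kap + kap ^+ 2) / (kap + kap ^+ 2 + 1)).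
    by rewrite /D; field; rewrite !gt_eqF.
  rewrite ger_pMr ?divr_gt0// ler_pdivrMr// mul1r lerDl//.
move: a1; rewrite !ler_norml => /andP[a3 a4].
have : 0 <= eps * n%:R by rewrite mulr_ge0 ?(ltW e0).
move: b5 a2; set en := eps * n%:R.
have -> : eps / 2 * n%:R = en / 2 by rewrite /en; ring.
have -> : 3 * eps * n%:R = 3 * en by rewrite /en; ring.
rewrite -/en in a3 a4.
rewrite -/E in a3 a4 *.
by move=> *; apply/andP; split; lra.
Qed.

End indegree_bound.
End edge_sums.

(** * Geometry of nearest neighbors *)

Section euclid.
Context (R : realType) (m : nat).
Implicit Types x y z : m.-tuple R.

Lemma norm2_ge0 x : 0 <= norm2 x.
Proof. exact: sqrtr_ge0. Qed.

Lemma sqr_norm2 x : norm2 x ^+ 2 = \sum_i tnth x i ^+ 2.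
Proof. by rewrite sqr_sqrtr// sumr_ge0// => i _; rewrite sqr_ge0. Qed.

Lemma dist2_ge0 x y : 0 <= dist2 x y.
Proof. exact: norm2_ge0. Qed.

Lemma sqr_dist2 x y : dist2 x y ^+ 2 = \sum_i (tnth x i - tnth y i) ^+ 2.
Proof. by rewrite sqr_norm2; apply: eq_bigr => i _; rewrite tnth_mktuple. Qed.

Lemma dist2C x y : dist2 x y = dist2 y x.
Proof.
apply/eqP; rewrite -(eqrXn2 (n := 2)) ?dist2_ge0// !sqr_dist2; apply/eqP.
by apply: eq_bigr => i _; rewrite -sqrrN opprB.
Qed.

Lemma dist2xx x : dist2 x x = 0.
Proof.
apply/eqP; rewrite -(eqrXn2 (n := 2)) ?dist2_ge0// sqr_dist2 expr0n/=; apply/eqP.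
by rewrite big1// => i _; rewrite subrr expr0n.
Qed.

Lemma dist2_eq0 x y : dist2 x y <= 0 -> x = y.
Proof.
move=> h; have /eqP : dist2 x y = 0 by apply/eqP; rewrite eq_le h dist2_ge0.
rewrite -(eqrXn2 (n := 2)) ?dist2_ge0// sqr_dist2 expr0n/= psumr_eq0; last first.
  by move=> i _; rewrite sqr_ge0.
move=> /allP a; apply: eq_from_tnth => i.
by have := a i (mem_index_enum i); rewrite /= sqrf_eq0 subr_eq0 => /eqP.
Qed.

Lemma le_coord_norm2 x i : `|tnth x i| <= norm2 x.
Proof.
rewrite -(ler_pXn2r (n := 2)) ?nnegrE ?norm2_ge0// sqr_norm2 real_normK ?num_real//.
by rewrite (bigD1 i)//= lerDl sumr_ge0// => j _; rewrite sqr_ge0.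
Qed.

(** A triangle inequality with the constant that the convexity of the square
    gives at once. *)
Lemma norm2_le_of_close x y (b : R) : 0 <= b -> dist2 x y <= b ->
  norm2 y <= Num.sqrt 2 * (norm2 x + b).
Proof.
move=> b0 xy; have B0 : 0 <= norm2 x + b by rewrite addr_ge0// norm2_ge0.
rewrite -(ler_pXn2r (n := 2)) ?nnegrE ?norm2_ge0 ?mulr_ge0 ?sqrtr_ge0//.
rewrite exprMn [Num.sqrt 2 ^+ 2]sqr_sqrtr//.
apply: (@le_trans _ _ (2 * (norm2 x ^+ 2 + dist2 x y ^+ 2))).
  rewrite sqr_dist2 !sqr_norm2 -big_split mulr_sumr; apply: ler_sum => i _ /=.
  have := sqr_ge0 (2 * tnth x i - tnth y i); rewrite !expr2; nra.
have a0 := norm2_ge0 x; have d0 := dist2_ge0 x y.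
have : dist2 x y ^+ 2 <= b ^+ 2 by rewrite ler_pXn2r ?nnegrE.
have : 0 <= norm2 x * b by rewrite mulr_ge0.
by rewrite sqrrD mulr2n; lra.
Qed.

(** The ball of radius B is cut into finitely many cells of diameter at most
    eta: a cell is given by the coordinates rounded to multiples of
    eta / (m + 1). *)
Lemma ball_cells (B eta : R) : 0 < B -> 0 < eta ->
  exists (F : finType) (cell : m.-tuple R -> F), forall u v,
    norm2 u <= B -> norm2 v <= B -> cell u = cell v -> dist2 u v <= eta.
Proof.
move=> B0 e0; pose s := eta / m.+1%:R.
have s0 : 0 < s by rewrite divr_gt0.
pose N := Num.truncn (2 * B / s).
exists {ffun 'I_m -> 'I_N.+1}.
exists (fun u => [ffun i => inord (Num.truncn ((tnth u i + B) / s))]).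
move=> u v uB vB /ffunP uv.
have rng (w : m.-tuple R) i : norm2 w <= B -> 0 <= (tnth w i + B) / s /\
    (Num.truncn ((tnth w i + B) / s) < N.+1)%N.
  move=> wB; have := le_trans (le_coord_norm2 w i) wB.
  rewrite ler_norml => /andP[w1 w2]; split.
    by rewrite divr_ge0 ?(ltW s0)//; lra.
  by rewrite ltnS; apply: le_truncn; rewrite ler_pM2r ?invr_gt0//; lra.
rewrite -(ler_pXn2r (n := 2)) ?nnegrE ?dist2_ge0 ?(ltW e0)// sqr_dist2.
apply: (@le_trans _ _ (\sum_(i < m) s ^+ 2)).
  apply: ler_sum => i _.
  have [u0 uN] := rng u i uB; have [v0 vN] := rng v i vB.
  have := uv i; rewrite !ffunE => /(congr1 val); rewrite /= !inordK// => tE.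
  have /andP[] := truncn_itv u0; have /andP[] := truncn_itv v0.
  rewrite tE; set t := Num.truncn _; rewrite -natr1 => a1 a2 a3 a4.
  have lo w : (t%:R <= (w + B) / s) -> ((w + B) / s < t%:R + 1) ->
      t%:R * s <= w + B /\ w + B < t%:R * s + s.
    move=> b1 b2; split; first by rewrite -ler_pdivlMr.
    by move: b2; rewrite ltr_pdivrMr// mulrDl mul1r.
  have [b1 b2] := lo _ a1 a2; have [b3 b4] := lo _ a3 a4.
  rewrite -[leLHS]real_normK ?num_real// ler_pXn2r ?nnegrE ?(ltW s0)//.
  by rewrite ler_norml; apply/andP; split; lra.
rewrite sumr_const card_ord /s expr_div_n -mulrnAr -[leRHS]mulr1.
rewrite ler_pM2l ?exprn_gt0// -mulr_natl ler_pdivrMr ?exprn_gt0// mul1r.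
by rewrite -natrX ler_nat (leq_trans (leqnSn _))// leq_pmulr.
Qed.

(** Directions from c to points that are at least as far from one another as
    from c make angles of at least 60 degrees, so that two of them never share
    a cell of the unit ball. *)
Lemma kissing_bound : exists M : nat, forall n (z : 'I_n -> m.-tuple R)
    (A : {set 'I_n}) (c : m.-tuple R),
  (forall i, i \in A -> z i <> c) ->
  (forall i j, i \in A -> j \in A -> i != j -> dist2 (z i) c <= dist2 (z i) (z j)) ->
  (#|A| <= M)%N.
Proof.
have [F [cell cellP]] := @ball_cells 1 (1/2) ltr01 ltac:(lra).
exists #|F| => n z A c zc far.
pose r i := dist2 (z i) c.
pose dir i : m.-tuple R := [tuple (tnth (z i) k - tnth c k) / r i | k < m].
have r0 i : i \in A -> 0 < r i.
  by move=> iA; rewrite ltNge; apply/negP => /dist2_eq0; exact: zc.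
have dir1 i : i \in A -> \sum_k tnth (dir i) k ^+ 2 = 1.
  move=> iA; under eq_bigr do rewrite tnth_mktuple expr_div_n.
  by rewrite -mulr_suml -sqr_dist2 divff// expf_neq0// gt_eqF// r0.
have ndir i : i \in A -> norm2 (dir i) <= 1.
  by move=> iA; rewrite /norm2 dir1// sqrtr1.
suff inj : {in A &, injective (cell \o dir)} by rewrite -(card_in_imset inj) max_card.
move=> i j iA jA /= ij; apply/eqP; apply: contraT => nij.
have := cellP _ _ (ndir i iA) (ndir j jA) ij.
rewrite -(ler_pXn2r (n := 2)) ?nnegrE ?dist2_ge0 ?divr_ge0//.
rewrite sqr_dist2.
have d1 := far i j iA jA nij.
have d2 : r j <= dist2 (z i) (z j).
  by rewrite (dist2C (z i)); apply: far => //; rewrite eq_sym.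
set ip := \sum_k (tnth (z i) k - tnth c k) * (tnth (z j) k - tnth c k).
have e1 : dist2 (z i) (z j) ^+ 2 = r i ^+ 2 + r j ^+ 2 - 2 * ip.
  rewrite !sqr_dist2 /ip mulr_sumr -big_split -sumrB; apply: eq_bigr => k _ /=.
  ring.
have e2 : \sum_i0 (tnth (dir i) i0 - tnth (dir j) i0) ^+ 2 = 2 - 2 * (ip / (r i * r j)).
  transitivity (\sum_k tnth (dir i) k ^+ 2 + \sum_k tnth (dir j) k ^+ 2 -
      2 * \sum_k tnth (dir i) k * tnth (dir j) k).
    rewrite mulr_sumr -big_split -sumrB; apply: eq_bigr => k _ /=; ring.
  rewrite !dir1//; congr (_ - 2 * _); rewrite /ip mulr_suml; apply: eq_bigr => k _.
  rewrite !tnth_mktuple; field; by rewrite !gt_eqF ?r0.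
rewrite e2 => h.
have ri := r0 i iA; have rj := r0 j jA.
have : ip / (r i * r j) <= 1/2.
  rewrite ler_pdivrMr ?mulr_gt0//.
  have d1' : r i ^+ 2 <= dist2 (z i) (z j) ^+ 2.
    by rewrite ler_pXn2r ?nnegrE ?dist2_ge0.
  have d2' : r j ^+ 2 <= dist2 (z i) (z j) ^+ 2.
    by rewrite ler_pXn2r ?nnegrE ?dist2_ge0.
  have a1 : ip <= r j ^+ 2 / 2 by lra.
  have a2 : ip <= r i ^+ 2 / 2 by lra.
  by case: (leP (r i) (r j)) => rij; nra.
lra.
Qed.

End euclid.

Section nearest_weights.
Context (R : realType) (m n : nat).
Implicit Types (z : 'I_n -> m.-tuple R) (i j : 'I_n).

Definition near_set z i : {set 'I_n} :=
  [set j | (j != i) && [forall k, (k != i) ==>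
     (dist2 (z i) (z j) <= dist2 (z i) (z k))]]%SET.

Definition near_weight z i j : R :=
  if j \in near_set z i then (#|near_set z i|%:R)^-1 else 0.

Lemma near_setP z i j : reflect
  (j != i /\ forall k, k != i -> dist2 (z i) (z j) <= dist2 (z i) (z k))
  (j \in near_set z i).
Proof.
rewrite inE; apply: (iffP andP) => -[ji h]; split=> //.
  by move=> k ki; move/forallP : h => /(_ k); rewrite ki.
by apply/forallP => k; apply/implyP; exact: h.
Qed.

Lemma near_set_neq0 z i : (2 <= n)%N -> (0 < #|near_set z i|)%N.
Proof.
move=> n2.
have [k ki] : exists k, k != i.
  have : (0 < #|[set~ i]%SET|)%N by rewrite cardsC1 card_ord -ltnS prednK// (leq_trans _ n2).
  by move=> /card_gt0P[k]; rewrite !inE => ki; exists k.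
case: (@arg_minP _ _ _ k (fun k => k != i) (fun k => dist2 (z i) (z k)) ki) => j ji h.
by apply/card_gt0P; exists j; apply/near_setP.
Qed.

Lemma near_weight_ge0 z i j : 0 <= near_weight z i j.
Proof. by rewrite /near_weight; case: ifP; rewrite ?invr_ge0. Qed.

Lemma near_weight_diag z i : near_weight z i i = 0.
Proof. by rewrite /near_weight inE eqxx. Qed.

Lemma near_weight_sum1 z i : (2 <= n)%N -> \sum_j near_weight z i j = 1.
Proof.
move=> n2; rewrite /near_weight -big_mkcond /= sumr_const -[LHS]mulr_natr mulVf//.
by rewrite pnatr_eq0 -lt0n near_set_neq0.
Qed.

(** A point which shares its location has its nearest neighbors there, and the
    k - 1 companions of j in its class contribute 1 / (k - 1) each; the other
    points that have j as a nearest neighbor are pairwise far apart. *)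
Lemma near_weight_in (M : nat) z j :
  (forall (A : {set 'I_n}) (c : m.-tuple R),
    (forall i, i \in A -> z i <> c) ->
    (forall i j, i \in A -> j \in A -> i != j -> dist2 (z i) c <= dist2 (z i) (z j)) ->
    (#|A| <= M)%N) ->
  \sum_i near_weight z i j <= M.+1%:R.
Proof.
move=> kiss.
pose C := [set i | (z i == z j) && (i != j)]%SET.
pose A := [set i | (z i != z j) && (j \in near_set z i)]%SET.
rewrite (bigID (fun i => z i == z j)) /= -natr1 addrC lerD//.
  apply: (@le_trans _ _ (\sum_(i in A) 1)); last first.
    rewrite sumr_const ler_nat; apply: (kiss A (z j)) => [i|i k].
      by rewrite inE => /andP[/eqP].
    rewrite inE => /andP[_ /near_setP[_ h]] _ ik.
    by apply: h; rewrite eq_sym.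
  rewrite [leRHS](bigID (fun i => z i == z j))/= ler_wpDl ?sumr_ge0//.
  rewrite big_mkcond [leRHS]big_mkcond /=; apply: ler_sum => i _.
  rewrite inE /near_weight; case: eqP => //= _; case: ifPn => // jn.
  rewrite invf_le1 ?ler1n ?ltr0n//; apply/card_gt0P; by exists j.
apply: (@le_trans _ _ (\sum_(i in C) (#|C|%:R)^-1)); last first.
  rewrite sumr_const -[X in X <= _]mulr_natr.
  have [->|C0] := eqVneq #|C| 0%N; first by rewrite mulr0.
  by rewrite mulVf// pnatr_eq0.
rewrite (bigD1 j)//= near_weight_diag add0r.
rewrite big_mkcond [leRHS]big_mkcond /=; apply: ler_sum => i _.
rewrite inE; case: (boolP (_ && _)) => // /andP[/eqP zij ij].
rewrite /near_weight; case: ifPn => [jn|_]; last by rewrite invr_ge0.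
have -> // : #|near_set z i| = #|C|.
(* both sets are the class of j without one of its points *)
have -> : near_set z i = [set k | (z k == z j) && (k != i)]%SET.
  apply/setP => k; rewrite [RHS]inE; apply/near_setP/andP => [[ki h]|[/eqP zk ki]].
    split=> //; apply/eqP; rewrite -zij; apply/esym/dist2_eq0.
    have := h j; rewrite eq_sym => /(_ ij) /le_trans; apply.
    by rewrite zij dist2xx.
  by split=> // l _; rewrite zk zij dist2xx dist2_ge0.
have e k : z k = z j -> #|[set l | (z l == z j) && (l != k)]%SET|.+1 =
    #|[set l | z l == z j]%SET|.
  move=> zk; rewrite [RHS](cardsD1 k) inE zk eqxx add1n; congr (_.+1).
  by apply: eq_card => l; rewrite !inE andbC.
by apply: succn_inj; rewrite !e.
Qed.

(** Two points of the ball in the same cell are within eta of each other, hence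
    also within eta of their nearest neighbors. So there is at most one exception
    per cell, apart from the points outside the ball. *)
Lemma card_far_neighbor (B eta : R) (F : finType) (cell : m.-tuple R -> F) z :
  (forall u v, norm2 u <= B -> norm2 v <= B -> cell u = cell v -> dist2 u v <= eta) ->
  (#|[set i | [exists j, (j \in near_set z i) && (eta < dist2 (z i) (z j))%R]]%SET|
    <= #|[set i | (B < norm2 (z i))%R]%SET| + #|F|)%N.
Proof.
move=> cellP; set X := [set i | _]%SET; set O := [set i | _]%SET.
rewrite -(cardsID O X) leq_add//; first by rewrite subset_leq_card// subsetIr.
have inj : {in X :\: O &, injective (cell \o z)}%SET.
  move=> i k /setDP[iX iO] /setDP[_ kO] /= ck.
  have iB : norm2 (z i) <= B by move: iO; rewrite inE -leNgt.
  have kB : norm2 (z k) <= B by move: kO; rewrite inE -leNgt.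
  move: iX; rewrite inE => /existsP[j /andP[jn jf]].
  apply/eqP; apply: contraTT jf => ik; rewrite -leNgt.
  have /near_setP[_ h] := jn; apply: le_trans (h k _) _; first by rewrite eq_sym.
  exact: cellP.
by rewrite -(card_in_imset inj) max_card.
Qed.

End nearest_weights.

(** * Expectations of bounded measurable functions *)

Section bounded_measurable.
Context d (T : measurableType d) (R : realType).
Implicit Types f g : T -> R.

Definition bm f : Prop :=
  measurable_fun setT f /\ exists M, forall w, `|f w| <= M.

Lemma bm_measurable f : bm f -> measurable_fun setT f.
Proof. by case. Qed.

Lemma bm_cst (c : R) : bm (fun=> c).
Proof. by split; [exact: measurable_cst | exists `|c|]. Qed.

Lemma bm01 f : measurable_fun setT f -> (forall w, 0 <= f w <= 1) -> bm f.
Proof.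
by move=> mf f01; split=> //; exists 1 => w; have /andP[a b] := f01 w; rewrite ger0_norm.
Qed.

Lemma bmD f g : bm f -> bm g -> bm (fun w => f w + g w).
Proof.
move=> [mf [M hM]] [mg [N hN]]; split; first exact: measurable_funD.
by exists (M + N) => w; rewrite (le_trans (ler_normD _ _))// lerD.
Qed.

Lemma bmM f g : bm f -> bm g -> bm (fun w => f w * g w).
Proof.
move=> [mf [M hM]] [mg [N hN]]; split; first exact: measurable_funM.
by exists (M * N) => w; rewrite normrM ler_pM.
Qed.

Lemma bmZ (c : R) f : bm f -> bm (fun w => c * f w).
Proof. by move=> bf; apply: bmM => //; exact: bm_cst. Qed.

Lemma bmN f : bm f -> bm (fun w => - f w).
Proof.
move=> bf; have -> : (fun w => - f w) = (fun w => (-1) * f w).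
  by apply/funext => w; rewrite mulN1r.
exact: bmZ.
Qed.

Lemma bmB f g : bm f -> bm g -> bm (fun w => f w - g w).
Proof. by move=> bf bg; apply: bmD => //; exact: bmN. Qed.

Lemma bm_sum (I : Type) (s : seq I) (Q : pred I) (F : I -> T -> R) :
  (forall i, bm (F i)) -> bm (fun w => \sum_(i <- s | Q i) F i w).
Proof.
move=> bF; elim: s => [|i s IH].
  rewrite (_ : (fun _ => _) = (fun=> 0)); first exact: bm_cst.
  by apply/funext => w; rewrite big_nil.
rewrite (_ : (fun _ => _) =
  (fun w => (if Q i then F i w else 0) + \sum_(j <- s | Q j) F j w)).
  by apply: bmD => //; case: (Q i) => //; exact: bm_cst.
by apply/funext => w; rewrite big_cons; case: ifP; rewrite ?add0r.
Qed.

Lemma bm_prod (I : Type) (s : seq I) (Q : pred I) (F : I -> T -> R) :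
  (forall i, bm (F i)) -> bm (fun w => \prod_(i <- s | Q i) F i w).
Proof.
move=> bF; elim: s => [|i s IH].
  rewrite (_ : (fun _ => _) = (fun=> 1)); first exact: bm_cst.
  by apply/funext => w; rewrite big_nil.
rewrite (_ : (fun _ => _) =
  (fun w => (if Q i then F i w else 1) * \prod_(j <- s | Q j) F j w)).
  by apply: bmM => //; case: (Q i) => //; exact: bm_cst.
by apply/funext => w; rewrite big_cons; case: ifP; rewrite ?mul1r.
Qed.

Lemma bm_indic (A : set T) : measurable A -> bm (\1_A : T -> R).
Proof.
move=> mA; apply: bm01; first exact: measurable_indic.
by move=> w; rewrite indicE; case: (_ \in _); rewrite /= ?ler01 ?lexx.
Qed.

End bounded_measurable.

Lemma bm_comp d d' (T : measurableType d) (T' : measurableType d') (R : realType)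
    (f : T' -> R) (W : T -> T') :
  bm f -> measurable_fun setT W -> bm (fun w => f (W w)).
Proof.
move=> [mf [M hM]] mW; split; first exact: (measurableT_comp mf mW).
by exists M.
Qed.

Lemma measurable_preimage d d' (T : measurableType d) (T' : measurableType d')
    (W : T -> T') (B : set T') :
  measurable_fun setT W -> measurable B -> measurable (W @^-1` B).
Proof. by move=> mW mB; rewrite -[X in measurable X]setTI; exact: mW. Qed.

Section expectation_bm.
Context d (T : measurableType d) (R : realType) (P : probability T R).
Implicit Types f g : T -> R.

Definition EE f : R := \int[P]_w f w.

Definition pr (A : set T) : R := fine (P A).

Lemma prE A : measurable A -> (pr A)%:E = P A.
Proof. by move=> mA; rewrite /pr fineK// fin_num_measure. Qed.

Lemma bm_integrable (D : set T) f : measurable D -> bm f ->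
  P.-integrable D (EFin \o f).
Proof.
move=> mD [mf [M hM]]; apply: measurable_bounded_integrable => //.
- exact: le_lt_trans (probability_le1 P mD) (ltry 1).
- exact: measurable_funTS.
- by exists M; split; rewrite ?num_real// => x Mx w Dw /=; apply: le_trans (hM w) (ltW Mx).
Qed.

Lemma EED f g : bm f -> bm g -> EE (fun w => f w + g w) = EE f + EE g.
Proof. by move=> bf bg; apply: RintegralD => //; exact: bm_integrable. Qed.

Lemma EEB f g : bm f -> bm g -> EE (fun w => f w - g w) = EE f - EE g.
Proof. by move=> bf bg; apply: RintegralB => //; exact: bm_integrable. Qed.

Lemma EEZ (c : R) f : bm f -> EE (fun w => c * f w) = c * EE f.
Proof. by move=> bf; apply: RintegralZl => //; exact: bm_integrable. Qed.

Lemma EE_cst (c : R) : EE (fun=> c) = c.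
Proof. by rewrite /EE Rintegral_cst//= probability_setT mulr1. Qed.

Lemma EE_sum (I : Type) (s : seq I) (Q : pred I) (F : I -> T -> R) :
  (forall i, bm (F i)) ->
  EE (fun w => \sum_(i <- s | Q i) F i w) = \sum_(i <- s | Q i) EE (F i).
Proof.
move=> bF; elim: s => [|i s IH].
  rewrite big_nil -[RHS](EE_cst 0); congr EE.
  by apply/funext => w; rewrite big_nil.
rewrite big_cons -IH; case: ifP => Qi; last first.
  by congr EE; apply/funext => w; rewrite big_cons Qi.
rewrite -EED//; last exact: bm_sum.
by congr EE; apply/funext => w; rewrite big_cons Qi.
Qed.

Lemma le_EE f g : bm f -> bm g -> (forall w, f w <= g w) -> EE f <= EE g.
Proof. by move=> bf bg fg; apply: le_Rintegral => //; exact: bm_integrable. Qed.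

Lemma EE_ge0 f : (forall w, 0 <= f w) -> 0 <= EE f.
Proof. by move=> f0; apply: Rintegral_ge0. Qed.

Lemma EE_close f g (e : R) : bm f -> bm g -> (forall w, `|f w - g w| <= e) ->
  `|EE f - EE g| <= e.
Proof.
move=> bf bg fg.
have h w : - e <= f w - g w <= e by rewrite -ler_norml.
rewrite -EEB// ler_norml -{1}(EE_cst (- e)) -{2}(EE_cst e).
apply/andP; split; apply: le_EE; try exact: bm_cst; try exact: bmB.
  by move=> w; have /andP[] := h w.
by move=> w; have /andP[] := h w.
Qed.

Lemma EE_indic A : measurable A -> EE (\1_A : T -> R) = pr A.
Proof. by move=> mA; rewrite /EE /Rintegral integral_indic// setIT. Qed.

Lemma EE_restrict (A : set T) f : measurable A -> bm f ->
  EE (fun w => \1_A w * f w) = \int[P]_(w in A) f w.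
Proof.
move=> mA bf; rewrite [RHS]Rintegral_mkcond /EE; apply: eq_Rintegral => w _.
by rewrite patch_indic /= mulrC.
Qed.

Lemma EE_EFin (A : set T) f : measurable A -> bm f ->
  (EE (fun w => \1_A w * f w))%:E = (\int[P]_(w in A) (f w)%:E)%E.
Proof.
move=> mA bf; rewrite EE_restrict// /Rintegral fineK//.
by apply: integrable_fin_num => //; exact: bm_integrable.
Qed.

Lemma EE_ae_eq f g : bm f -> bm g -> {ae P, forall w, f w = g w} -> EE f = EE g.
Proof.
move=> [mf _] [mg _] fg; congr fine; apply: ae_eq_integral => //.
- exact/measurable_EFinP.
- exact/measurable_EFinP.
- by apply: filterS fg => w -> _.
Qed.

End expectation_bm.

Lemma EE_pushforward d d' (T : measurableType d) (T' : measurableType d')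
    (R : realType) (P : probability T R) (W : {mfun T >-> T'}) (f : T' -> R) :
  bm f -> EE (distribution P W) f = EE P (fun w => f (W w)).
Proof.
move=> bf; congr fine; rewrite integral_distribution//.
  by apply/measurable_EFinP; exact: bm_measurable.
by apply: (@bm_integrable _ _ _ P setT (fun w => f (W w))) => //; exact: bm_comp.
Qed.

Lemma indic_bool (T : Type) (R : realType) (b : T -> bool) w :
  \1_[set w | b w] w = (b w)%:R :> R.
Proof.
by rewrite indicE; congr (nat_of_bool _)%:R; apply/idP/idP; rewrite inE.
Qed.

(** * Extending identities between measures *)

Section layers.
Context (R : realType).

(** The approximation of x in [0, 1] from below by the thresholds l / r that it
    reaches; it reduces bounded functions to finitely many events. *)
Definition layer (r : nat) (x : R) : R :=
  r%:R^-1 * \sum_(l < r) ((l.+1%:R <= r%:R * x)%R)%:R.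

Lemma layer_approx r (x : R) : (0 < r)%N -> 0 <= x <= 1 -> `|x - layer r x| <= r%:R^-1.
Proof.
move=> r0 /andP[x0 x1]; have R0 : 0 < r%:R :> R by rewrite ltr0n.
have rx0 : 0 <= r%:R * x by rewrite mulr_ge0.
have tr : (Num.truncn (r%:R * x) <= r)%N.
  by rewrite truncn_le_nat (@le_lt_trans _ _ r%:R)// ?ltr_nat// ler_piMr.
have -> : layer r x = r%:R^-1 * (Num.truncn (r%:R * x))%:R.
  congr (_ * _); under eq_bigr do rewrite -truncn_gt_nat.
  move: tr; set t := Num.truncn _ => tr.
  rewrite -natr_sum; congr (_%:R).
  elim: r t tr {R0 rx0 r0} => [|r IH] t tr; first by rewrite big_ord0; case: t tr.
  rewrite big_ord_recr /=; case: (leqP t r) => rt; first by rewrite IH// addn0.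
  have -> : t = r.+1 by apply/eqP; rewrite eqn_leq tr.
  rewrite (eq_bigr (fun=> 1%N)) => [|l _]; last by rewrite ltnS ltnW.
  rewrite sum_nat_const card_ord muln1.
  by rewrite addn1.
have /andP[t1 t2] := truncn_itv rx0.
have -> : x - r%:R^-1 * (Num.truncn (r%:R * x))%:R =
    r%:R^-1 * (r%:R * x - (Num.truncn (r%:R * x))%:R).
  by rewrite mulrBr mulKf// gt_eqF.
rewrite -natr1 in t2.
have ri : 0 < r%:R^-1 :> R by rewrite invr_gt0.
rewrite normrM (gtr0_norm ri) ger_pMr//.
by rewrite ler_norml; apply/andP; split; lra.
Qed.

Lemma eq_of_close (x y M : R) : (forall r, (0 < r)%N -> `|x - y| <= M / r%:R) -> x = y.
Proof.
move=> h; apply/eqP; rewrite -subr_eq0 -normr_le0 leNgt; apply/negP => e0.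
pose r := (Num.truncn (M / `|x - y|)).+1.
have := h r isT; rewrite ler_pdivlMr ?ltr0n// mulrC -ler_pdivlMr//.
by rewrite leNgt truncnS_gt.
Qed.

End layers.

Section transfer.
Context d d' (T : measurableType d) (U : measurableType d') (R : realType).
Context (P : probability T R) (W : T -> U).
Hypothesis mW : measurable_fun setT W.

Lemma measurable_layer (f : U -> R) r l : measurable_fun setT f ->
  measurable [set u | (l.+1%:R <= r%:R * f u)%R].
Proof.
move=> mf; have mrf : measurable_fun setT (fun u => r%:R * f u).
  by apply: measurable_funM => //; exact: measurable_cst.
rewrite [X in measurable X](_ : _ = (fun u => r%:R * f u) @^-1` `[l.+1%:R, +oo[%classic).
  exact: measurable_preimage.
by apply/seteqP; split => u /=; rewrite in_itv /= andbT.
Qed.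

(** Two weights that agree on the events defined by W agree on the functions of
    W. *)
Lemma EE_transfer (k1 k2 : T -> R) (h : U -> R) : bm k1 -> bm k2 ->
  (forall B, measurable B -> EE P (fun w => k1 w * \1_B (W w)) =
                             EE P (fun w => k2 w * \1_B (W w))) ->
  measurable_fun setT h -> (forall u, 0 <= h u <= 1) ->
  EE P (fun w => k1 w * h (W w)) = EE P (fun w => k2 w * h (W w)).
Proof.
move=> b1 b2 hB mh h01; have [_ [M1 hM1]] := b1; have [_ [M2 hM2]] := b2.
apply: (@eq_of_close _ _ _ (M1 + M2)) => r r0.
pose S l : set U := [set u | (l.+1%:R <= r%:R * h u)%R].
have mS l : measurable (S l) by exact: measurable_layer.
have bh : bm h by exact: bm01.
have layE u : layer r (h u) = r%:R^-1 * \sum_(l < r) \1_(S l) u.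
  by congr (_ * _); apply: eq_bigr => l _; rewrite indic_bool.
have EL k : bm k -> EE P (fun w => k w * layer r (h (W w))) =
    r%:R^-1 * \sum_(l < r) EE P (fun w => k w * \1_(S l) (W w)).
  move=> bk.
  have bkl (l : 'I_r) : bm (fun w => k w * \1_(S l) (W w)).
    apply: bmM => //; apply: bm_comp => //; exact: bm_indic.
  rewrite -EE_sum// -EEZ; last exact: bm_sum.
  congr EE; apply/funext => w; rewrite layE mulrCA; congr (_ * _).
  by rewrite mulr_sumr.
have blay : bm (fun w => layer r (h (W w))).
  rewrite (_ : (fun _ => _) = (fun w => r%:R^-1 * \sum_(l < r) \1_(S l) (W w))).
    by apply: bmZ; apply: bm_sum => l; apply: bm_comp => //; exact: bm_indic.
  by apply/funext => w; rewrite layE.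
have close k (M : R) : bm k -> (forall w, `|k w| <= M) ->
    `|EE P (fun w => k w * h (W w)) - EE P (fun w => k w * layer r (h (W w)))| <= M / r%:R.
  move=> bk kM; apply: EE_close; [|exact: bmM|].
    by apply: bmM => //; exact: bm_comp.
  by move=> w; rewrite -mulrBr normrM ler_pM// layer_approx.
have c1 := close k1 M1 b1 hM1; have c2 := close k2 M2 b2 hM2.
rewrite (EL _ b1) in c1; rewrite (EL _ b2) in c2.
have e12 : \sum_(l < r) EE P (fun w => k1 w * \1_(S l) (W w)) =
    \sum_(l < r) EE P (fun w => k2 w * \1_(S l) (W w)).
  by apply: eq_bigr => l _; exact: hB.
rewrite e12 in c1; rewrite mulrDl; move: c1 c2.
set a := EE P _; set b := EE P _; set c := r%:R^-1 * _ => c1 c2.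
have -> : a - b = (a - c) - (b - c) by ring.
by rewrite (le_trans (ler_normB _ _))// lerD.
Qed.

End transfer.

Section rectangles.
Context d d' (T : measurableType d) (U : measurableType d') (R : realType).
Context (P : probability T R) (n : nat) (W : T -> n.-tuple U).
Hypothesis mW : measurable_fun setT W.

Definition rectangle (B : 'I_n -> set U) : set (n.-tuple U) :=
  [set t | forall i, B i (tnth t i)].

Lemma rectangleE B : rectangle B = \big[setI/setT]_(i < n) ((@tnth n U ^~ i) @^-1` B i).
Proof.
rewrite -bigcap_seq; apply/seteqP; split => t /=.
  by move=> h i _; exact: h.
by move=> h i; apply: h; rewrite /= mem_index_enum.
Qed.

Lemma measurable_rectangle B : (forall i, measurable (B i)) -> measurable (rectangle B).
Proof.
move=> mB; rewrite rectangleE; apply: bigsetI_measurable => i _.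
apply: measurable_preimage => //; exact: measurable_tnth.
Qed.

Definition rectangles : set (set (n.-tuple U)) :=
  [set A | exists2 B, (forall i, measurable (B i)) & A = rectangle B].

Lemma measurable_tupleE :
  @measurable _ (n.-tuple U) = <<s rectangles >>.
Proof.
apply/seteqP; split; last first.
  apply: smallest_sub; first exact: sigma_algebra_measurable.
  by move=> A [B mB ->]; exact: measurable_rectangle.
rewrite {1}/measurable/= /g_sigma_preimage; apply: smallest_sub.
  exact: smallest_sigma_algebra.
move=> A; rewrite -bigcup_seq => -[i _ [B mB <-]]; apply: sub_sigma_algebra.
exists (fun k => if k == i then B else setT) => [k|]; first by case: ifP.
rewrite setTI; apply/seteqP; split => t /=.
  by move=> h k; case: eqP => [->|].
by move=> /(_ i); rewrite eqxx.
Qed.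

(** The pi-lambda theorem for the rectangles. *)
Lemma EE_rectangles (k1 k2 : T -> R) : bm k1 -> bm k2 ->
  (forall w, 0 <= k1 w) -> (forall w, 0 <= k2 w) ->
  (forall B, (forall i, measurable (B i)) ->
    EE P (fun w => k1 w * \1_(rectangle B) (W w)) =
    EE P (fun w => k2 w * \1_(rectangle B) (W w))) ->
  forall S, measurable S ->
    EE P (fun w => k1 w * \1_S (W w)) = EE P (fun w => k2 w * \1_S (W w)).
Proof.
move=> b1 b2 p1 p2 hB S mS.
have EEi k (A : set (n.-tuple U)) : measurable A -> bm k ->
    (EE P (fun w => k w * \1_A (W w)))%:E = (\int[P]_(w in W @^-1` A) (k w)%:E)%E.
  move=> mA bk; rewrite -EE_EFin//; last exact: measurable_preimage.
  by congr (EE _ _)%:E; apply/funext => w; rewrite mulrC !indicE.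
have hT : EE P k1 = EE P k2.
  have := hB (fun=> setT) (fun=> measurableT).
  have -> : rectangle (fun=> setT) = setT by apply/seteqP; split.
  rewrite indicT; have e k : EE P (fun w => k w * cst 1 (W w)) = EE P k.
    by congr EE; apply/funext => w /=; rewrite mulr1.
  by rewrite !e.
apply: (@dynkin_induction _ _ rectangles
  [set S | EE P (fun w => k1 w * \1_S (W w)) = EE P (fun w => k2 w * \1_S (W w))]).
- exact: measurable_tupleE.
- move=> A B [A' mA ->] [B' mB ->]; exists (fun i => A' i `&` B' i).
    by move=> i; exact: measurableI.
  apply/seteqP; split => t /=; first by case=> h1 h2 i; split.
  by move=> h; split=> i; have [] := h i.
- have e k : EE P (fun w => k w * cst 1 (W w)) = EE P k.
    by congr EE; apply/funext => w /=; rewrite mulr1.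
  by rewrite /= indicT !e.
- by move=> A [B mB ->]; exact: hB.
- move=> A mA /= hA.
  have e k : bm k -> EE P (fun w => k w * \1_(~` A) (W w)) =
      EE P k - EE P (fun w => k w * \1_A (W w)).
    move=> bk; rewrite -EEB//; last first.
      by apply: bmM => //; apply: bm_comp => //; exact: bm_indic.
    congr EE; apply/funext => w; rewrite !indicE in_setC.
    by case: (_ \in _) => /=; rewrite ?mulr1 ?mulr0 ?subrr ?subr0.
  by rewrite !e// hT hA.
- move=> F mF tF hF /=; apply: EFin_inj; rewrite !EEi//; try exact: bigcup_measurable.
  rewrite preimage_bigcup.
  have tW : trivIset setT (fun i => W @^-1` F i).
    apply/trivIsetP => i j _ _ ij; rewrite -preimage_setI.
    by move/trivIsetP : tF => -> //; rewrite preimage_set0.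
  have mWF i : measurable (W @^-1` F i) by exact: measurable_preimage.
  rewrite !ge0_integral_bigcup//; try by move=> w _; rewrite lee_fin.
  + by apply: eq_eseriesr => i _; rewrite -!EEi// hF.
  + by apply: measurable_funTS; apply/measurable_EFinP; exact: bm_measurable.
  + by apply: measurable_funTS; apply/measurable_EFinP; exact: bm_measurable.
- by rewrite -measurable_tupleE.
Qed.

End rectangles.

Section product_expectation.
Context d d' (T : measurableType d) (U : measurableType d') (R : realType).
Context (P : probability T R) (n : nat) (D : 'I_n -> T -> U).
Hypothesis mD : forall i, measurable_fun setT (D i).
Hypothesis indepD : forall B : 'I_n -> set U, (forall i, measurable (B i)) ->
  pr P [set w | forall i, B i (D i w)] = \prod_i pr P (D i @^-1` B i).

Lemma indic_forall (B : 'I_n -> set U) w :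
  \1_[set w | forall i, B i (D i w)] w = \prod_i \1_(B i) (D i w) :> R.
Proof.
rewrite indicE; case: (boolP (_ \in _)).
  rewrite inE /= => h; rewrite big1// => i _; by rewrite indicE mem_set.
rewrite notin_setE /= => /existsNP[i hi].
by rewrite (bigD1 i)//= indicE memNset// mul0r.
Qed.

(** Indicators are replaced by functions one coordinate at a time. *)
Lemma EE_prod (F : 'I_n -> U -> R) :
  (forall i, measurable_fun setT (F i)) -> (forall i u, 0 <= F i u <= 1) ->
  EE P (fun w => \prod_i F i (D i w)) = \prod_i EE P (fun w => F i (D i w)).
Proof.
suff gen (s : seq 'I_n) : forall F : 'I_n -> U -> R,
    (forall i, measurable_fun setT (F i)) -> (forall i u, 0 <= F i u <= 1) ->
    (forall i, i \notin s -> exists2 B, measurable B & F i = \1_B) ->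
    EE P (fun w => \prod_i F i (D i w)) = \prod_i EE P (fun w => F i (D i w)).
  move=> mF F01; apply: (gen (enum 'I_n)) => // i.
  by rewrite mem_enum.
elim: s => [|k s IH] {}F mF F01 Fs.
  have /choice[B hB] : forall i, exists B, measurable B /\ F i = \1_B.
    by move=> i; have [B mB FB] := Fs i isT; exists B.
  have mB i : measurable (B i) by have [] := hB i.
  have -> : (fun w => \prod_i F i (D i w)) = \1_[set w | forall i, B i (D i w)].
    apply/funext => w; rewrite indic_forall; apply: eq_bigr => i _.
    by have [_ ->] := hB i.
  rewrite EE_indic ?indepD//.
    apply: eq_bigr => i _; rewrite -EE_indic; last exact: measurable_preimage.
    by congr EE; apply/funext => w; have [_ ->] := hB i; rewrite !indicE.
  rewrite [X in measurable X](_ : _ = \big[setI/setT]_(i < n) (D i @^-1` B i)).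
    by apply: bigsetI_measurable => i _; exact: measurable_preimage.
  rewrite -bigcap_seq; apply/seteqP; split => w /=; first by move=> h i _; exact: h.
  by move=> h i; apply: h; rewrite /= mem_index_enum.
have bF i : bm (fun w => F i (D i w)) by apply: bm_comp => //; exact: bm01.
pose c := \prod_(i | i != k) EE P (fun w => F i (D i w)).
have h : EE P (fun w => (\prod_(i | i != k) F i (D i w)) * F k (D k w)) =
    EE P (fun w => c * F k (D k w)).
  apply: (EE_transfer (mD k)) => //; [exact: bm_prod|exact: bm_cst|].
  move=> B mB.
  have bB : bm (fun w => \1_B (D k w) : R) by apply: bm_comp => //; exact: bm_indic.
  rewrite EEZ//.
  pose G i := if i == k then \1_B : U -> R else F i.
  have -> : (fun w => \prod_(i | i != k) F i (D i w) * \1_B (D k w)) =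
      (fun w => \prod_i G i (D i w)).
    apply/funext => w; rewrite [RHS](bigD1 k)//= /G eqxx mulrC; congr (_ * _).
    by apply: eq_bigr => i /negbTE ->.
  rewrite IH.
  - rewrite (bigD1 k)//= mulrC /G eqxx; congr (_ * _).
    by apply: eq_bigr => i /negbTE ->.
  - by move=> i; rewrite /G; case: eqP => // _; exact: measurable_indic.
  - move=> i u; rewrite /G; case: eqP => // _.
    by rewrite indicE; case: (_ \in _); rewrite /= ?ler01 ?lexx.
  - move=> i si; rewrite /G; case: eqP => [_|/eqP ik]; first by exists B.
    by apply: Fs; rewrite inE negb_or ik.
rewrite (bigD1 k)//= mulrC -/c -EEZ// -h; congr EE; apply/funext => w.
by rewrite (bigD1 k)//= mulrC.
Qed.

End product_expectation.

(** * Empirical frequencies *)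

Section probability_bounds.
Context d (T : measurableType d) (R : realType) (P : probability T R).
Implicit Types A B : set T.

Lemma pr_ge0 A : 0 <= pr P A.
Proof. by rewrite /pr fine_ge0. Qed.

Lemma pr_setT : pr P setT = 1.
Proof. by rewrite /pr probability_setT. Qed.

Lemma pr_le1 A : measurable A -> pr P A <= 1.
Proof. by move=> mA; rewrite -lee_fin prE// probability_le1. Qed.

Lemma le_pr A B : measurable A -> measurable B -> A `<=` B -> pr P A <= pr P B.
Proof. by move=> mA mB AB; rewrite -lee_fin !prE// le_measure ?inE. Qed.

Lemma pr_setC A : measurable A -> pr P (~` A) = 1 - pr P A.
Proof.
move=> mA; apply: EFin_inj; rewrite EFinB !prE//; last exact: measurableC.
by rewrite probability_setC.
Qed.

Lemma pr_setU_le A B : measurable A -> measurable B ->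
  pr P (A `|` B) <= pr P A + pr P B.
Proof.
move=> mA mB; rewrite -lee_fin EFinD !prE//; last exact: measurableU.
exact: measureU2.
Qed.

Lemma pr_bigcup_le (I : finType) (A : set T) (F : I -> set T) (b : I -> R) :
  measurable A -> (forall i, measurable (F i)) ->
  (forall w, A w -> exists i, F i w) -> (forall i, pr P (F i) <= b i) ->
  pr P A <= \sum_i b i.
Proof.
move=> mA mF AF Fb; apply: (@le_trans _ _ (\sum_i pr P (F i))); last exact: ler_sum.
rewrite -EE_indic//.
under eq_bigr do rewrite -EE_indic//.
rewrite -EE_sum; last by move=> i; exact: bm_indic.
apply: le_EE; [exact: bm_indic|by apply: bm_sum => i; exact: bm_indic|].
move=> w; rewrite indicE; case: (boolP (w \in A)) => [|_]; last first.
  by apply: sumr_ge0 => i _; rewrite indicE.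
rewrite inE => /AF[i Fi]; rewrite (bigD1 i)//= indicE mem_set//= lerDl.
by apply: sumr_ge0 => j _; rewrite indicE.
Qed.

Section finite_valued.
Variables (F : finType) (phi : T -> F).
Hypothesis mphi : forall c, measurable [set w | phi w = c].

Lemma measurable_finite_valued (Q : pred F) : measurable [set w | Q (phi w)].
Proof.
rewrite [X in measurable X](_ : _ =
    \big[setU/set0]_(c : F) (if Q c then [set w | phi w = c] else set0)).
  by apply: bigsetU_measurable => c _; case: ifP.
rewrite -bigcup_seq; apply/seteqP; split => w /=.
  by move=> Qw; exists (phi w); rewrite /= ?mem_index_enum// Qw.
by move=> [c _]; case: ifP => // Qc /= ->.
Qed.

Lemma indic_finite_valued (Q : pred F) (w : T) :
  \1_[set w | Q (phi w)] w = \sum_(c | Q c) \1_[set w | phi w = c] w :> R.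
Proof.
rewrite indic_bool; have e c : \1_[set w | phi w = c] w = (phi w == c)%:R :> R.
  rewrite -(indic_bool R (fun u => phi u == c)).
  have -> // : [set u | phi u = c] = [set u | phi u == c].
  by apply/seteqP; split => u /= /eqP.
under eq_bigr do rewrite e.
case: (boolP (Q (phi w))) => Qw; last first.
  rewrite big1// => c Qc; case: eqP => // ec; by rewrite ec Qc in Qw.
rewrite (bigD1 (phi w))//= eqxx big1 ?addr0// => c /andP[_].
by rewrite eq_sym => /negbTE ->.
Qed.

Lemma pr_finite_valued (Q : pred F) :
  pr P [set w | Q (phi w)] = \sum_(c | Q c) pr P [set w | phi w = c].
Proof.
rewrite -EE_indic; last exact: measurable_finite_valued.
under eq_bigr do rewrite -EE_indic//.
rewrite -EE_sum; last by move=> i; exact: bm_indic.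
by congr EE; apply/funext => w; rewrite indic_finite_valued.
Qed.

Lemma measurable_fun_finite_valued (f : F -> R) :
  measurable_fun setT (fun w => f (phi w)).
Proof.
rewrite (_ : (fun _ => _) = (fun w => \sum_c f c * \1_[set w | phi w = c] w)).
  apply: bm_measurable; apply: bm_sum => c; apply: bmZ; exact: bm_indic.
apply/funext => w; rewrite (bigD1 (phi w))//= indicE mem_set// mulr1 big1 ?addr0//.
move=> c cw; rewrite indicE memNset ?mulr0//= => e.
by rewrite e eqxx in cw.
Qed.

End finite_valued.

End probability_bounds.

Lemma measurable_bool_pattern d (T : measurableType d) (I : finType) (b : I -> T -> bool) :
  (forall i, measurable [set w | b i w]) -> forall v : {ffun I -> bool},
  measurable [set w | [ffun i => b i w] = v].
Proof.
move=> mb v; rewrite [X in measurable X](_ : _ = \big[setI/setT]_(i : I)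
    (if v i then [set w | b i w] else ~` [set w | b i w])).
  apply: bigsetI_measurable => i _; case: ifP => _ //; exact: measurableC.
rewrite -bigcap_seq; apply/seteqP; split => w /=.
  by move=> <- i _ /=; rewrite ffunE; case: ifP => //= ->.
move=> h; apply/ffunP => i; rewrite ffunE.
by have := h i (mem_index_enum _); case: (v i) => /=; case: (b i w).
Qed.

Section iid.
Context d d' du (T : measurableType d) (T' : measurableType d')
  (U : measurableType du) (R : realType).
Context (P : probability T R) (P' : probability T' R) (n : nat).
Context (D0 : T -> U) (D : 'I_n -> T' -> U).
Hypothesis mD0 : measurable_fun setT D0.
Hypothesis mD : forall i, measurable_fun setT (D i).
Hypothesis indepD : forall B : 'I_n -> set U, (forall i, measurable (B i)) ->
  pr P' [set w | forall i, B i (D i w)] = \prod_i pr P' (D i @^-1` B i).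
Hypothesis identD : forall i B, measurable B ->
  pr P' (D i @^-1` B) = pr P (D0 @^-1` B).

Lemma EE_ident i (f : U -> R) : bm f ->
  EE P' (fun w => f (D i w)) = EE P (fun w => f (D0 w)).
Proof.
move=> bf.
pose Di : {mfun T' >-> U} := HB.pack (D i) (isMeasurableFun.Build _ _ _ _ _ (mD i)).
pose D0' : {mfun T >-> U} := HB.pack D0 (isMeasurableFun.Build _ _ _ _ _ mD0).
rewrite -(EE_pushforward P' Di bf) -(EE_pushforward P D0' bf).
congr fine; apply: eq_measure_integral => A mA _.
have := identD i mA; rewrite /pr => h.
have m1 : measurable (D i @^-1` A) by exact: measurable_preimage.
have m0 : measurable (D0 @^-1` A) by exact: measurable_preimage.
by have := congr1 EFin h; rewrite -/(pr P' _) -/(pr P _) !prE.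
Qed.

Variable E : U -> bool.
Hypothesis mE : measurable [set u | E u].

Let hit w : {ffun 'I_n -> bool} := [ffun i => E (D i w)].
Let pE := pr P (D0 @^-1` [set u | E u]).

Let mhit v : measurable [set w | hit w = v].
Proof.
apply: measurable_bool_pattern => i.
exact: (measurable_preimage (mD i) mE).
Qed.

Lemma pr_hit v : pr P' [set w | hit w = v] = \prod_i bern pE (v i).
Proof.
have -> : [set w | hit w = v] =
    [set w | forall i, (if v i then [set u | E u] else ~` [set u | E u]) (D i w)].
  apply/seteqP; split => w /=.
    by move=> <- i; rewrite ffunE; case: ifP => //= ->.
  move=> h; apply/ffunP => i; rewrite ffunE.
  by have := h i; case: (v i) => /=; case: (E _).
have mB i : measurable (if v i then [set u | E u] else ~` [set u | E u]).
  by case: ifP => _ //; exact: measurableC.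
rewrite (indepD mB); apply: eq_bigr => i _; rewrite identD//.
case: (v i) => //=; rewrite preimage_setC pr_setC//.
exact: (measurable_preimage mD0 mE).
Qed.

(** The pattern of the hits has a product law on a finite set, to which
    McDiarmid's inequality applies. *)
Lemma frequency_concentration (eps : R) : 0 < eps -> eps <= 1 ->
  let bad := [set w | eps * n%:R < `|\sum_i (E (D i w))%:R - pE * n%:R|] in
  measurable bad /\ pr P' bad <= 2 * expR (- (eps ^+ 2 / 8) * n%:R).
Proof.
move=> e0 e1 bad.
pose q (i : 'I_n) v := bern pE v.
pose f (v : {ffun 'I_n -> bool}) : R := \sum_i (v i)%:R.
have mpE : measurable (D0 @^-1` [set u | E u]) by exact: measurable_preimage.
have q0 i v : 0 <= q i v by rewrite bern_ge0// pr_ge0 pr_le1.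
have q1 i : \sum_v q i v = 1 by exact: bern_sum1.
have fE : Ex q f = pE * n%:R.
  rewrite Ex_sum (eq_bigr (fun=> pE)) => [|i _].
    by rewrite sumr_const card_ord mulr_natr.
  rewrite (Ex1 q1 i (fun v => v%:R)) big_bool /= /q /bern mulr1 mulr0 addr0//.
pose Q v := eps * n%:R < `|f v - Ex q f|.
have badE : bad = [set w | Q (hit w)].
  have fh w : f (hit w) = \sum_i (E (D i w))%:R.
    by apply: eq_bigr => i _; rewrite ffunE.
  by apply/seteqP; split => w; rewrite /bad /Q /= fE fh.
split; first by rewrite badE; exact: (measurable_finite_valued mhit).
rewrite badE (pr_finite_valued _ mhit).
under eq_bigr do rewrite pr_hit.
have -> : \sum_(v | Q v) \prod_i bern pE (v i) = Pr q Q.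
  rewrite /Pr /Ex big_mkcond; apply: eq_bigr => v _.
  by case: ifP; rewrite ?mulr1 ?mulr0.
have bd : bounded_diff (fun=> 1) f.
  move=> v i a; rewrite /f -sumrB (bigD1 i)//= big1 ?addr0 => [|k /negbTE ki].
    rewrite ffunE eqxx; case: a; case: (v i) => /=; rewrite ?subrr ?subr0 ?sub0r ?normrN ?normr1 ?normr0 ?ler01//.
  by rewrite ffunE ki subrr.
have ec : eps <= 2 * 1 by lra.
by have := mcdiarmid_abs q0 q1 ltr01 e0 ec bd; rewrite card_ord expr1n mulr1.
Qed.

End iid.

Section iid_mean.
Context d d' du (T : measurableType d) (T' : measurableType d')
  (U : measurableType du) (R : realType).
Context (P : probability T R) (P' : probability T' R) (n : nat).
Context (D0 : T -> U) (D : 'I_n -> T' -> U).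
Hypothesis mD0 : measurable_fun setT D0.
Hypothesis mD : forall i, measurable_fun setT (D i).
Hypothesis indepD : forall B : 'I_n -> set U, (forall i, measurable (B i)) ->
  pr P' [set w | forall i, B i (D i w)] = \prod_i pr P' (D i @^-1` B i).
Hypothesis identD : forall i B, measurable B ->
  pr P' (D i @^-1` B) = pr P (D0 @^-1` B).

(** The layers of f turn its mean into the frequencies of r events. *)
Lemma mean_concentration (f : U -> R) (eps : R) (r : nat) :
  measurable_fun setT f -> (forall u, 0 <= f u <= 1) ->
  0 < eps -> eps <= 1 -> (0 < r)%N -> r%:R^-1 <= eps ->
  let bad := [set w | 3 * eps * n%:R <
    `|\sum_i f (D i w) - EE P (fun w => f (D0 w)) * n%:R|] in
  measurable bad /\ pr P' bad <= 2 * r%:R * expR (- (eps ^+ 2 / 8) * n%:R).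
Proof.
move=> mf f01 e0 e1 r0 re bad.
have bf : bm f by exact: bm01.
have R0 : 0 < r%:R :> R by rewrite ltr0n.
pose E (l : 'I_r) (u : U) := (l.+1%:R <= r%:R * f u)%R.
have mE l : measurable [set u | E l u] by exact: measurable_layer.
pose pE l := pr P (D0 @^-1` [set u | E l u]).
pose badl (l : 'I_r) := [set w | eps * n%:R < `|\sum_i (E l (D i w))%:R - pE l * n%:R|].
have hl l := frequency_concentration mD0 mD indepD identD (mE l) e0 e1.
have mbad : measurable bad.
  rewrite [X in measurable X](_ : _ = (fun w => `|\sum_i f (D i w) -
      EE P (fun w => f (D0 w)) * n%:R|) @^-1` `]3 * eps * n%:R, +oo[%classic).
    apply: measurable_preimage => //; apply: measurableT_comp => //.
    apply: bm_measurable; apply: bmB; last exact: bm_cst.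
    by apply: bm_sum => i; exact: bm_comp.
  by apply/seteqP; split => w /=; rewrite in_itv /= andbT.
split=> //.
set b := expR _.
have -> : 2 * r%:R * b = \sum_(l < r) 2 * b.
  by rewrite sumr_const card_ord -[RHS]mulr_natr; ring.
apply: (pr_bigcup_le (F := badl) mbad).
- by move=> l; have [] := hl l.
- move=> w; rewrite /bad /= => bw; apply: contrapT => /forallNP nb.
  move: bw; apply/negP; rewrite -leNgt.
  have nb' l : `|\sum_i (E l (D i w))%:R - pE l * n%:R| <= eps * n%:R.
    by rewrite leNgt; apply/negP; exact: nb.
  have c1 : `|\sum_i f (D i w) - \sum_i layer r (f (D i w))| <= eps * n%:R.
    rewrite -sumrB (le_trans (ler_norm_sum _ _ _))//.
    apply: (@le_trans _ _ (\sum_(i < n) eps)).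
      by apply: ler_sum => i _; rewrite (le_trans (layer_approx r0 _)).
    by rewrite sumr_const card_ord mulr_natr.
  have bE l : bm (fun w => (E l (D0 w))%:R : R).
    rewrite (_ : (fun _ => _) = \1_(D0 @^-1` [set u | E l u])).
      apply: bm_indic; exact: measurable_preimage.
    by apply/funext => v; exact: (esym (indic_bool R (fun v => E l (D0 v)) v)).
  have layE : EE P (fun w => layer r (f (D0 w))) = r%:R^-1 * \sum_l pE l.
    rewrite /layer EEZ; last exact: bm_sum.
    rewrite EE_sum//; congr (_ * _); apply: eq_bigr => l _.
    rewrite /pE -EE_indic; last exact: measurable_preimage.
    by congr EE; apply/funext => v; exact: (esym (indic_bool R (fun v => E l (D0 v)) v)).
  have blay : bm (fun w => layer r (f (D0 w))) by apply: bmZ; exact: bm_sum.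
  have c2 : `|EE P (fun w => f (D0 w)) - EE P (fun w => layer r (f (D0 w)))| <= eps.
    apply: EE_close => //; first exact: bm_comp.
    by move=> v; rewrite (le_trans (layer_approx r0 _)).
  have c3 : `|\sum_i layer r (f (D i w)) - EE P (fun w => layer r (f (D0 w))) * n%:R|
      <= eps * n%:R.
    rewrite layE /layer -mulr_sumr -mulrA -mulrBr exchange_big /= mulr_suml -sumrB.
    rewrite normrM ger0_norm ?invr_ge0 ?(ltW R0)// ler_pdivrMl//.
    rewrite (le_trans (ler_norm_sum _ _ _))//.
    apply: (@le_trans _ _ (\sum_(l < r) eps * n%:R)); first by apply: ler_sum => l _; exact: nb'.
    by rewrite sumr_const card_ord -[leLHS]mulr_natl.
  have n0 : 0 <= n%:R :> R by [].
  have c2' : `|EE P (fun w => f (D0 w)) * n%:R -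
      EE P (fun w => layer r (f (D0 w))) * n%:R| <= eps * n%:R.
    by rewrite -mulrBl normrM (ger0_norm n0) ler_wpM2r.
  move: c1 c3 c2'; rewrite !ler_norml => /andP[? ?] /andP[? ?] /andP[? ?].
  by apply/andP; split; lra.
- by move=> l; have [] := hl l.
Qed.

End iid_mean.

(** * The joint law of the predictors, the responses and the neighbors *)

Section measurability.
Context (R : realType).

Lemma measurable_le_fun d (T : measurableType d) (f g : T -> R) :
  measurable_fun setT f -> measurable_fun setT g ->
  measurable [set w | (f w <= g w)%R].
Proof.
by move=> mf mg; rewrite -[X in measurable X]setTI; exact: measurable_fun_le.
Qed.

Lemma measurable_norm2 m : measurable_fun setT (@norm2 R m).
Proof.
apply: (@measurableT_comp _ _ _ _ _ _ (@Num.sqrt R)).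
  by apply: nondecreasing_measurable => // x y; exact: ler_wsqrtr.
apply: measurable_sum => i; apply: measurable_funX; exact: measurable_tnth.
Qed.

Lemma measurable_dist2 d (T : measurableType d) m (x y : T -> m.-tuple R) :
  measurable_fun setT x -> measurable_fun setT y ->
  measurable_fun setT (fun w => dist2 (x w) (y w)).
Proof.
move=> mx my; apply: (@measurableT_comp _ _ _ _ _ _ (@norm2 R m)).
  exact: measurable_norm2.
apply/measurable_fun_tnthP => i.
rewrite (_ : _ \o _ = fun w => tnth (x w) i - tnth (y w) i); last first.
  by apply/funext => w /=; rewrite tnth_mktuple.
apply: measurable_funB.
  by apply: (measurableT_comp (measurable_tnth i) mx).
by apply: (measurableT_comp (measurable_tnth i) my).
Qed.

Lemma measurable_subvec p (S : {set 'I_p}) : measurable_fun setT (@subvec R p S).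
Proof.
apply/measurable_fun_tnthP => i.
rewrite (_ : _ \o _ = fun x => tnth x (enum_val i)); first exact: measurable_tnth.
by apply/funext => x /=; rewrite tnth_mktuple.
Qed.

Lemma measurable_near_set d (T : measurableType d) m n (z : T -> 'I_n -> m.-tuple R) i A :
  (forall k, measurable_fun setT (z ^~ k)) ->
  measurable [set w | near_set (z w) i = A].
Proof.
move=> mz.
have mj j : measurable [set w | j \in near_set (z w) i].
  rewrite [X in measurable X](_ : _ = if j == i then set0 else
      \big[setI/setT]_(k < n) (if k == i then setT else
        [set w | (dist2 (z w i) (z w j) <= dist2 (z w i) (z w k))%R])).
    case: eqP => // _; apply: bigsetI_measurable => k _; case: eqP => // _.
    by apply: measurable_le_fun; exact: measurable_dist2.
  apply/seteqP; split => w /=.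
    move=> /near_setP[/negbTE -> h]; rewrite -bigcap_seq => k _ /=.
    by case: (eqVneq k i) => // ki; exact: h.
  case: (eqVneq j i) => // ji; rewrite -bigcap_seq => h; apply/near_setP.
  split=> // k ki; have := h k (mem_index_enum _); by rewrite /= (negbTE ki).
rewrite [X in measurable X](_ : _ =
    [set w | [ffun j => j \in near_set (z w) i] = [ffun j => j \in A]]).
  exact: measurable_bool_pattern.
apply/seteqP; split => w /=; first by move=> ->.
by move=> /ffunP h; apply/setP => j; have := h j; rewrite !ffunE.
Qed.

Lemma measurable_near_weight d (T : measurableType d) m n
    (z : T -> 'I_n -> m.-tuple R) i j :
  (forall k, measurable_fun setT (z ^~ k)) ->
  measurable_fun setT (fun w => near_weight (z w) i j).
Proof.
move=> mz.
exact: (measurable_fun_finite_valued (fun A => measurable_near_set i A mz)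
  (fun A => if j \in A then (#|A|%:R)^-1 else 0)).
Qed.

Lemma near_weight01 m n (z : 'I_n -> m.-tuple R) i j : 0 <= near_weight z i j <= 1.
Proof.
rewrite near_weight_ge0 /= /near_weight; case: ifPn => // jn.
by rewrite invf_le1 ?ler1n ?ltr0n//; apply/card_gt0P; exists j.
Qed.

End measurability.

Lemma prod01 (R : realType) (I : finType) (F : I -> R) :
  (forall i, 0 <= F i <= 1) -> 0 <= \prod_i F i <= 1.
Proof.
move=> F01; apply/andP; split; first by apply: prodr_ge0 => i _; have /andP[] := F01 i.
by apply: prodr_ile1 => i _; exact: F01.
Qed.

Section sample_law.
Context d (T : measurableType d) (R : realType) (P : probability T R).
Context (p : nat) (Y : {RV P >-> R}) (X : {RV P >-> p.-tuple R}).
Context d' (T' : measurableType d') (P' : probability T' R) (n : nat).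
Context (Ys : 'I_n -> {RV P' >-> R}) (Xs : 'I_n -> {RV P' >-> p.-tuple R}).
Hypothesis iid : iid_copies Y X Ys Xs.

Definition pair0 w : R * p.-tuple R := (Y w, X w).
Definition pairs i w : R * p.-tuple R := (Ys i w, Xs i w).

Lemma measurable_pair0 : measurable_fun setT pair0.
Proof. by apply: measurable_fun_pair; exact: measurable_funP. Qed.

Lemma measurable_pairs i : measurable_fun setT (pairs i).
Proof. by apply: measurable_fun_pair; exact: measurable_funP. Qed.

Lemma ident_pairs i B : measurable B -> pr P' (pairs i @^-1` B) = pr P (pair0 @^-1` B).
Proof. by move=> mB; rewrite /pr; have [h _] := iid; rewrite (h i B mB). Qed.

Lemma indep_pairs (B : 'I_n -> set (R * p.-tuple R)) : (forall i, measurable (B i)) ->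
  pr P' [set w | forall i, B i (pairs i w)] = \prod_i pr P' (pairs i @^-1` B i).
Proof.
move=> mB; have [_ h] := iid; rewrite /pr (h B mB).
have -> : (\prod_(i < n) P' ((fun w => (Ys i w, Xs i w)) @^-1` B i) =
    \prod_(i < n) (pr P' (pairs i @^-1` B i))%:E)%E.
  apply: eq_bigr => i _; rewrite prE//.
  exact: (measurable_preimage (measurable_pairs i) (mB i)).
by rewrite -(big_morph EFin EFinM erefl).
Qed.

Section tie_breaking.
Context (N : {set 'I_p} -> 'I_n -> T' -> 'I_n).
Hypothesis tie : uniform_tie_breaking Ys Xs N.
Hypothesis n2 : (2 <= n)%N.
Variable S0 : {set 'I_p}.
Hypothesis S0n0 : S0 != finset.set0.

Let zS S w i := subvec S (Xs i w).

Let mzS S i : measurable_fun setT (zS S ^~ i).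
Proof. by apply: measurableT_comp; [exact: measurable_subvec|exact: measurable_funP]. Qed.

Definition neighbors w : {ffun 'I_n -> 'I_n} := [ffun i => N S0 i w].

Lemma measurable_ffun_eq (S : {set 'I_p}) (nu : {ffun 'I_n -> 'I_n}) :
  measurable [set w | [ffun i => N S i w] = nu].
Proof.
rewrite [X in measurable X](_ : _ = \big[setI/setT]_i [set w | N S i w = nu i]).
  by apply: bigsetI_measurable => i _; have [m _] := tie.
rewrite -bigcap_seq; apply/seteqP; split => w /=.
  by move=> <- i _ /=; rewrite ffunE.
by move=> h; apply/ffunP => i; rewrite ffunE; exact: (h i (mem_index_enum _)).
Qed.

(** Summing the joint law of the tie breaking over the neighbors for all the
    other index sets leaves the weights for S0: the weights of each of the other
    sets add up to 1. *)
Lemma pr_neighbors (B : set (n.-tuple (R * p.-tuple R)%type)) (nu : {ffun 'I_n -> 'I_n}) :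
  measurable B ->
  pr P' (data Ys Xs @^-1` B `&` [set w | neighbors w = nu]) =
  EE P' (fun w => \1_(data Ys Xs @^-1` B) w *
    \prod_i near_weight (fun k => subvec S0 (Xs k w)) i (nu i)).
Proof.
move=> mB.
have mdata : measurable_fun setT (data Ys Xs).
  apply/measurable_fun_tnthP => i.
  rewrite (_ : _ \o _ = pairs i); first exact: measurable_pairs.
  by apply/funext => w /=; rewrite tnth_mktuple.
have mDB : measurable (data Ys Xs @^-1` B) by exact: measurable_preimage.
pose G := {ffun {set 'I_p} -> {ffun 'I_n -> 'I_n}}.
(* the law of the tie breaking does not determine the neighbors for the empty
   set; the value nu there makes the code of an outcome unique *)
pose phi w : G := [ffun S => if S == finset.set0 then nu else [ffun i => N S i w]].
pose W (S : {set 'I_p}) (eta : {ffun 'I_n -> 'I_n}) w : R :=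
  \prod_i near_weight (zS S w) i (eta i).
pose F (S : {set 'I_p}) (eta : {ffun 'I_n -> 'I_n}) w : R :=
  if S == finset.set0 then (eta == nu)%:R
  else if S == S0 then (eta == nu)%:R * W S eta w else W S eta w.
have bW S eta : bm (W S eta).
  apply: bm_prod => i; apply: bm01; first exact: measurable_near_weight.
  by move=> w; exact: near_weight01.
have bF S eta : bm (F S eta).
  rewrite /F; case: eqP => _; first exact: bm_cst.
  by case: eqP => _ //; exact: bmZ.
have mphi g : measurable [set w | phi w = g].
  rewrite [X in measurable X](_ : _ = \big[setI/setT]_(S : {set 'I_p})
      [set w | (if S == finset.set0 then nu else [ffun i => N S i w]) = g S]).
    apply: bigsetI_measurable => S _; case: eqP => _; last exact: measurable_ffun_eq.
    have [->|ne] := eqVneq nu (g S).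
      by rewrite (_ : [set _ | _] = setT)//; apply/seteqP; split.
    rewrite (_ : [set _ | _] = set0)//; apply/seteqP; split=> // w /= e.
    by rewrite e eqxx in ne.
  rewrite -bigcap_seq; apply/seteqP; split => w /=.
    by move=> <- S _ /=; rewrite ffunE.
  by move=> h; apply/ffunP => S; rewrite ffunE; exact: (h S (mem_index_enum _)).
have mnu : measurable [set w | neighbors w = nu] by exact: measurable_ffun_eq.
have key g : EE P' (\1_(data Ys Xs @^-1` B `&` [set w | neighbors w = nu] `&`
      [set w | phi w = g])) =
    EE P' (fun w => \1_(data Ys Xs @^-1` B) w * \prod_S F S (g S) w).
  have zero (S : {set 'I_p}) : g S != nu -> (S == finset.set0) || (S == S0) ->
      EE P' (\1_(data Ys Xs @^-1` B `&` [set w | neighbors w = nu] `&`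
      [set w | phi w = g])) =
      EE P' (fun w => \1_(data Ys Xs @^-1` B) w * \prod_S F S (g S) w).
    move=> gS Sc; transitivity (0 : R).
      rewrite (_ : _ `&` _ = set0); first by rewrite indic0 EE_cst.
      apply/seteqP; split=> // w /= [[_ nw] pg]; move: gS; rewrite -pg ffunE.
      have [S00|Sn0] := eqVneq S finset.set0; first by rewrite eqxx.
      move: Sc; rewrite (negbTE Sn0) /= => /eqP ->.
      by rewrite -/(neighbors w) nw eqxx.
    rewrite -[LHS](EE_cst P' 0); congr EE; apply/funext => w.
    rewrite (bigD1 S)//= [F S _ _](_ : _ = 0) ?mul0r ?mulr0// /F (negbTE gS).
    by move: Sc; case: eqP => //= _ ->; rewrite mul0r.
  case: (eqVneq (g finset.set0) nu) => [g0|]; last first.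
    by move=> /zero; apply; rewrite eqxx.
  case: (eqVneq (g S0) nu) => [gS0|]; last first.
    by move=> /zero; apply; rewrite eqxx orbT.
  have [_ h] := tie.
  have := h B (fun S i => g S i) mB.
  rewrite EE_indic; last by apply: measurableI => //; exact: measurableI.
  move=> hg.
  have mI : measurable (data Ys Xs @^-1` B `&` [set w | neighbors w = nu] `&`
      [set w | phi w = g]) by apply: measurableI => //; exact: measurableI.
  have bP : bm (fun w => \prod_S F S (g S) w) by apply: bm_prod => S; exact: bF.
  apply: EFin_inj; rewrite prE// EE_EFin//.
  rewrite [LHS](_ : _ = P' (data Ys Xs @^-1` B `&`
    [set w | forall S i, S != finset.set0 -> N S i w = g S i])).
    rewrite hg; apply: eq_integral => w _; congr EFin.
    rewrite big_mkcond; apply: eq_bigr => S _; rewrite /F.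
    case: eqP => [->|_] /=; first by rewrite g0 eqxx.
    case: eqP => [->|_]; first by rewrite gS0 eqxx mul1r /W -gS0.
    by [].
  congr (P' _); apply/seteqP; split => w /=.
    move=> [[dw _] pg]; split=> // S i Sn; rewrite -pg ffunE (negbTE Sn) ffunE//.
  move=> [dw hw]; split; first split=> //.
    by apply/ffunP => i; rewrite ffunE hw// gS0.
  apply/ffunP => S; rewrite ffunE; case: eqP => [->//|/eqP Sn].
  by apply/ffunP => i; rewrite ffunE hw.
rewrite -EE_indic; last exact: measurableI.
transitivity (EE P' (fun w => \sum_(g : G)
    \1_(data Ys Xs @^-1` B `&` [set w | neighbors w = nu] `&` [set w | phi w = g]) w)).
  congr EE; apply/funext => w; rewrite (bigD1 (phi w))//= big1 ?addr0.
    rewrite !indicE; congr (nat_of_bool _)%:R; apply/idP/idP; rewrite !inE /=.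
      by move=> ?; split.
    by case.
  move=> g gw; rewrite indicE memNset//= => -[_ e].
  by rewrite e eqxx in gw.
rewrite EE_sum; last first.
  by move=> g; apply: bm_indic; apply: measurableI => //; exact: measurableI.
under eq_bigr do rewrite key.
rewrite -EE_sum; last first.
  by move=> g; apply: bmM; [exact: bm_indic|apply: bm_prod => S; exact: bF].
congr EE; apply/funext => w; rewrite -mulr_sumr; congr (_ * _).
rewrite -(bigA_distr_bigA (fun S eta => F S eta w)) /=.
have sumnu (c : {ffun 'I_n -> 'I_n} -> R) : \sum_eta (eta == nu)%:R * c eta = c nu.
  rewrite (bigD1 nu)//= eqxx mul1r big1 ?addr0// => eta /negbTE ->.
  by rewrite mul0r.
rewrite (bigD1 S0)//= [X in X * _](_ : _ = W S0 nu w); last first.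
  by rewrite /F (negbTE S0n0) eqxx; exact: (sumnu (fun eta => W S0 eta w)).
rewrite big1 ?mulr1// => S SS0; rewrite /F (negbTE SS0); case: eqP => _.
  have /= := sumnu (fun=> 1); under eq_bigr do rewrite mulr1.
  by [].
rewrite /W -(bigA_distr_bigA (fun i j => near_weight (zS S w) i j)) /=.
by rewrite big1// => i _; exact: near_weight_sum1.
Qed.

Section joint_law.
Variables (t : R) (g : #|S0|.-tuple R -> R).
Hypothesis mg : measurable_fun setT g.
Hypothesis g01 : forall z, 0 <= g z <= 1.
Hypothesis gE : is_cond_prob P (subvec S0 \o X) [set w | (t <= Y w)%R] g.

Let Z w : n.-tuple (#|S0|.-tuple R) := [tuple subvec S0 (Xs i w) | i < n].

Let mZ : measurable_fun setT Z.
Proof.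
apply/measurable_fun_tnthP => i; have -> : (@tnth n (#|S0|.-tuple R) ^~ i) \o Z = zS S0 ^~ i.
  by apply/funext => w /=; rewrite tnth_mktuple.
exact: mzS.
Qed.

Definition hits w : {ffun 'I_n -> bool} := [ffun i => (t <= Ys i w)%R].

Let mhits v : measurable [set w | hits w = v].
Proof.
by apply: measurable_bool_pattern => i; exact: measurable_le_fun.
Qed.

Let mSX : measurable_fun setT (subvec S0 \o X).
Proof. by apply: measurableT_comp; [exact: measurable_subvec|exact: measurable_funP]. Qed.

Lemma bern_bm d1 (T1 : measurableType d1) (h : T1 -> R) v :
  measurable_fun setT h -> (forall u, 0 <= h u <= 1) ->
  bm (fun w => bern (h w) v).
Proof.
move=> mh h01; case: v => /=; first exact: bm01.
by apply: bmB; [exact: bm_cst|exact: bm01].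
Qed.

Lemma bern01 (x : R) v : 0 <= x <= 1 -> 0 <= bern x v <= 1.
Proof. by case: v => /andP[a b] /=; apply/andP; split; lra. Qed.

Lemma cond_prob_bern (v : bool) B : measurable B ->
  pr P [set w | B (subvec S0 (X w)) /\ ((t <= Y w)%R = v)] =
  EE P (fun w => \1_B (subvec S0 (X w)) * bern (g (subvec S0 (X w))) v).
Proof.
move=> mB; have [_ _ h] := gE.
have mBX : measurable ((subvec S0 \o X) @^-1` B) by exact: measurable_preimage.
have mt : measurable [set w | (t <= Y w)%R].
  by apply: measurable_le_fun => //; exact: measurable_funP.
have bg : bm (fun w => g (subvec S0 (X w))).
  by apply: (@bm_comp _ _ _ _ _ g (subvec S0 \o X)) => //; exact: bm01.
have e1 : pr P ([set w | (t <= Y w)%R] `&` (subvec S0 \o X) @^-1` B) =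
    EE P (fun w => \1_B (subvec S0 (X w)) * g (subvec S0 (X w))).
  apply: EFin_inj; rewrite prE; last exact: measurableI.
  by rewrite -h//; exact: (esym (EE_EFin P mBX bg)).
case: v => /=.
  rewrite -e1; congr pr; apply/seteqP; split => w /=; first by case=> ? ->.
  by case=> -> ?.
have -> : [set w | B (subvec S0 (X w)) /\ (t <= Y w)%R = false] =
    ((subvec S0 \o X) @^-1` B) `&` ~` [set w | (t <= Y w)%R].
  apply/seteqP; split => w /= -[? h']; split=> //; first by rewrite h'.
  by apply/negbTE/negP.
have -> : EE P (fun w => \1_B (subvec S0 (X w)) * (1 - g (subvec S0 (X w)))) =
    EE P (\1_((subvec S0 \o X) @^-1` B)) -
    EE P (fun w => \1_B (subvec S0 (X w)) * g (subvec S0 (X w))).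
  rewrite -EEB; [|exact: bm_indic|].
    by congr EE; apply/funext => w; rewrite mulrBr mulr1.
  by apply: bmM => //; apply: (@bm_indic _ _ _ ((subvec S0 \o X) @^-1` B)).
rewrite -e1 -!EE_indic//; last 2 first.
- exact: measurableI.
- by apply: measurableI => //; exact: measurableC.
rewrite -EEB; [|exact: bm_indic|by apply: bm_indic; exact: measurableI].
congr EE; apply/funext => w; rewrite !indicE !in_setI in_setC.
by case: (_ \in _); case: (_ \in _); rewrite /= ?subrr ?subr0.
Qed.

(** The conditional law of the indicators of Y_i >= t given the predictors: for
    rectangles of predictors both sides factor over the sample. *)
Lemma pr_hits (A : set (n.-tuple (#|S0|.-tuple R))) (v : {ffun 'I_n -> bool}) :
  measurable A ->
  EE P' (fun w => \1_[set w | hits w = v] w * \1_A (Z w)) =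
  EE P' (fun w => (\prod_i bern (g (tnth (Z w) i)) (v i)) * \1_A (Z w)).
Proof.
move=> mA.
have mzi i : measurable_fun setT (fun w => tnth (Z w) i).
  by apply: (measurableT_comp (measurable_tnth i) mZ).
have bgz i : bm (fun w => bern (g (tnth (Z w) i)) (v i)).
  apply: (@bern_bm _ _ (fun w => g (tnth (Z w) i))) => //.
  exact: (measurableT_comp mg (mzi i)).
apply: (EE_rectangles (n := n) (W := Z)) => //.
- exact: bm_indic.
- exact: bm_prod.
- by move=> w; apply: prodr_ge0 => i _; rewrite bern_ge0.
move=> B mB.
pose D i : set (R * p.-tuple R) := [set u | B i (subvec S0 u.2) /\ (t <= u.1)%R = v i].
have ms2 : measurable_fun setT (fun u : R * p.-tuple R => subvec S0 u.2).
  by apply: measurableT_comp; [exact: measurable_subvec|exact: measurable_snd].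
have mt : measurable [set u : R * p.-tuple R | (t <= u.1)%R].
  by apply: measurable_le_fun => //; exact: measurable_fst.
have mD i : measurable (D i).
  rewrite (_ : D i = (fun u : R * p.-tuple R => subvec S0 u.2) @^-1` B i `&`
    (if v i then [set u | (t <= u.1)%R] else ~` [set u | (t <= u.1)%R])).
    apply: measurableI; first exact: measurable_preimage.
    by case: (v i) => //; exact: measurableC.
  rewrite /D; case: (v i); apply/seteqP; split => u /= -[? h]; split=> //.
    by rewrite h.
  by apply/negbTE/negP.
transitivity (pr P' [set w | forall i, D i (pairs i w)]).
  rewrite -EE_indic; last first.
    rewrite [X in measurable X](_ : _ = \big[setI/setT]_i (pairs i @^-1` D i)).
      apply: bigsetI_measurable => i _; apply: measurable_preimage => //.
      exact: measurable_pairs.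
    rewrite -bigcap_seq; apply/seteqP; split => w /=; first by move=> h i _; exact: h.
    by move=> h i; apply: (h i); rewrite /= mem_index_enum.
  congr EE; apply/funext => w; rewrite !indicE -natrM mulnb; congr (nat_of_bool _)%:R.
  apply/andP/idP; rewrite !inE /=.
    move=> [hv hB] i; split; last by rewrite -hv ffunE.
    by have := hB i; rewrite tnth_mktuple.
  move=> h; split; first by apply/ffunP => i; rewrite ffunE; have [] := h i.
  by move=> i; rewrite tnth_mktuple; have [] := h i.
rewrite (indep_pairs mD).
pose H i (u : R * p.-tuple R) : R := \1_(B i) (subvec S0 u.2) * bern (g (subvec S0 u.2)) (v i).
have H01 i u : 0 <= H i u <= 1.
  have /andP[b0 b1] := bern01 (v i) (g01 (subvec S0 u.2)).
  rewrite /H indicE; case: (_ \in _); rewrite ?mul1r ?mul0r ?b0//.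
  by rewrite lexx ler01.
have bH i : bm (H i).
  apply: bmM; first by apply: (bm_comp (bm_indic R (mB i)) ms2).
  apply: (@bern_bm _ _ (fun u : R * p.-tuple R => g (subvec S0 u.2))) => //.
  exact: (measurableT_comp mg ms2).
transitivity (\prod_i EE P' (fun w => H i (pairs i w))).
  apply: eq_bigr => i _; rewrite ident_pairs//.
  rewrite (EE_ident measurable_pair0 measurable_pairs ident_pairs)//.
  exact: cond_prob_bern.
rewrite -(EE_prod measurable_pairs indep_pairs); first last.
- exact: H01.
- by move=> i; exact: bm_measurable.
congr EE; apply/funext => w; rewrite /H big_split /= mulrC; congr (_ * _).
  by apply: eq_bigr => i _; rewrite tnth_mktuple.
rewrite indicE; case: (boolP (_ \in _)).
  rewrite inE => h; apply: big1 => i _; rewrite indicE mem_set//.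
  by have := h i; rewrite tnth_mktuple.
rewrite notin_setE /rectangle /= => /existsNP[i]; rewrite tnth_mktuple => hi.
by rewrite (bigD1 i)//= indicE memNset// mul0r.
Qed.

Definition outcomes w : {ffun 'I_n -> bool * 'I_n} :=
  [ffun i => ((t <= Ys i w)%R, N S0 i w)].

Lemma measurable_outcomes o : measurable [set w | outcomes w = o].
Proof.
rewrite (_ : [set _ | _] = [set w | hits w = [ffun i => (o i).1]] `&`
    [set w | neighbors w = [ffun i => (o i).2]]).
  by apply: measurableI => //; exact: measurable_ffun_eq.
apply/seteqP; split => w /=.
  by move=> <-; split; apply/ffunP => i; rewrite !ffunE.
move=> [/ffunP h1 /ffunP h2]; apply/ffunP => i.
by move: (h1 i) (h2 i); rewrite !ffunE => -> ->; rewrite -surjective_pairing.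
Qed.

Let zc (z : n.-tuple (#|S0|.-tuple R)) := tnth z.

Let law (z : n.-tuple (#|S0|.-tuple R)) := edge_law (g \o zc z) (near_weight (zc z)).

(** The tie breaking brings the weights of the neighbors, which are functions of
    the predictors; they are taken out of the conditioning on the predictors
    before the indicators of the responses are replaced by their conditional
    probabilities. *)
Lemma pr_outcomes (A : set (n.-tuple (#|S0|.-tuple R))) o : measurable A ->
  pr P' ((Z @^-1` A) `&` [set w | outcomes w = o]) =
  EE P' (fun w => \1_A (Z w) * \prod_i law (Z w) i (o i)).
Proof.
move=> mA.
pose v := [ffun i => (o i).1]; pose nu := [ffun i => (o i).2].
have zE w : (fun k => subvec S0 (Xs k w)) = zc (Z w).
  by apply/funext => k; rewrite /zc tnth_mktuple.
pose sub (s : n.-tuple (R * p.-tuple R)%type) : n.-tuple (#|S0|.-tuple R) :=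
  [tuple subvec S0 (tnth s i).2 | i < n].
pose B := sub @^-1` A `&` [set s | [ffun i => (t <= (tnth s i).1)%R] = v].
have mti i : measurable_fun setT (fun s : n.-tuple (R * p.-tuple R)%type => tnth s i).
  exact: measurable_tnth.
have mB : measurable B.
  apply: measurableI.
    apply: measurable_preimage => //; apply/measurable_fun_tnthP => i.
    rewrite (_ : _ \o _ = subvec S0 \o snd \o (fun s => tnth s i)); last first.
      by apply/funext => s /=; rewrite tnth_mktuple.
    apply: measurableT_comp => //; apply: measurableT_comp => //.
    exact: measurable_subvec.
  apply: measurable_bool_pattern => i; apply: measurable_le_fun => //.
  exact: (measurableT_comp measurable_fst (mti i)).
have dB : data Ys Xs @^-1` B = (Z @^-1` A) `&` [set w | hits w = v].
  have subE w : sub (data Ys Xs w) = Z w.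
    by apply: eq_from_tnth => i; rewrite !tnth_mktuple.
  have hE w : [ffun i => (t <= (tnth (data Ys Xs w) i).1)%R] = hits w.
    by apply/ffunP => i; rewrite !ffunE tnth_mktuple.
  by apply/seteqP; split => w; rewrite /B /= subE hE.
have oE : (Z @^-1` A) `&` [set w | outcomes w = o] =
    data Ys Xs @^-1` B `&` [set w | neighbors w = nu].
  rewrite dB -setIA; congr (_ `&` _); apply/seteqP; split => w /=; rewrite /v /nu.
    by move=> ow; split; apply/ffunP => i; rewrite !ffunE -ow ffunE.
  move=> [/ffunP h1 /ffunP h2]; apply/ffunP => i.
  by move: (h1 i) (h2 i); rewrite !ffunE => -> ->; rewrite -surjective_pairing.
rewrite oE pr_neighbors// dB.
pose h (z : n.-tuple (#|S0|.-tuple R)) : R :=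
  \1_A z * \prod_i near_weight (zc z) i (nu i).
have mzi i : measurable_fun setT (fun w => tnth (Z w) i).
  by apply: (measurableT_comp (measurable_tnth i) mZ).
have mh : measurable_fun setT h.
  apply: bm_measurable; apply: bmM; first exact: bm_indic.
  apply: bm_prod => i; apply: bm01 => [|z]; last exact: near_weight01.
  by apply: measurable_near_weight => k; exact: measurable_tnth.
have h01 z : 0 <= h z <= 1.
  have /andP[a b] := prod01 (fun i => near_weight01 (zc z) i (nu i)).
  by rewrite /h indicE; case: (_ \in _); rewrite ?mul1r ?mul0r ?a ?b ?lexx ?ler01.
have tr := @EE_transfer _ _ _ _ _ P' Z mZ \1_[set w | hits w = v]
  (fun w => \prod_i bern (g (tnth (Z w) i)) (v i)) h (bm_indic R (mhits v)).
transitivity (EE P' (fun w => \1_[set w | hits w = v] w * h (Z w))).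
  congr EE; apply/funext => w; rewrite /h indicE in_setI mulrCA mulrA; congr (_ * _).
    by rewrite !indicE -natrM mulnb.
  by apply: eq_bigr => i _; rewrite zE.
rewrite tr//; last 2 first.
- apply: bm_prod => i; apply: (@bern_bm _ _ (fun w => g (tnth (Z w) i))) => //.
  exact: (measurableT_comp mg (mzi i)).
- by move=> B' mB'; exact: pr_hits.
congr EE; apply/funext => w; rewrite /h mulrCA; congr (_ * _).
rewrite -big_split /=; apply: eq_bigr => i _.
by rewrite /law /edge_law /= !ffunE.
Qed.

(** A bound which holds for the conditional law of the outcomes given the
    predictors, uniformly over a set A of predictors, holds on A. *)
Lemma pr_outcomes_le (A : set (n.-tuple (#|S0|.-tuple R)))
    (Q : pred {ffun 'I_n -> bool * 'I_n}) (c : R) : measurable A -> 0 <= c ->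
  (forall z, A z -> Pr (law z) Q <= c) ->
  pr P' ((Z @^-1` A) `&` [set w | Q (outcomes w)]) <= c.
Proof.
move=> mA c0 hc.
have mZA : measurable (Z @^-1` A) by exact: measurable_preimage.
have mQ := measurable_finite_valued measurable_outcomes Q.
rewrite -EE_indic; last exact: measurableI.
have blaw i a : bm (fun w => law (Z w) i a).
  have mzi : measurable_fun setT (fun w => tnth (Z w) i).
    by apply: (measurableT_comp (measurable_tnth i) mZ).
  apply: bmM.
    apply: (@bern_bm _ _ (fun w => g (tnth (Z w) i))) => //.
    exact: (measurableT_comp mg mzi).
  apply: bm01 => [|z]; last exact: near_weight01.
  apply: measurable_near_weight => k.
  by apply: (measurableT_comp (measurable_tnth k) mZ).
have -> : EE P' \1_((Z @^-1` A) `&` [set w | Q (outcomes w)]) =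
    EE P' (fun w => \sum_(o | Q o) \1_((Z @^-1` A) `&` [set w | outcomes w = o]) w).
  congr EE; apply/funext => w; rewrite indicE in_setI -mulnb natrM -!indicE.
  rewrite (indic_finite_valued R outcomes Q) mulr_sumr; apply: eq_bigr => o _.
  by rewrite !indicE in_setI -natrM mulnb.
rewrite EE_sum; last first.
  by move=> o; apply: bm_indic; apply: measurableI => //; exact: measurable_outcomes.
under eq_bigr => o _.
  rewrite EE_indic; last by apply: measurableI => //; exact: measurable_outcomes.
  rewrite pr_outcomes//.
  over.
rewrite -EE_sum; last first.
  move=> o; apply: bmM; first exact: (bm_indic R mZA).
  by apply: bm_prod => i; exact: blaw.
rewrite -(EE_cst P' c); apply: le_EE; last 1 first.
- move=> w; rewrite -mulr_sumr indicE; case: (boolP (_ \in _)); rewrite ?mul0r//.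
  rewrite inE mul1r => /hc; apply: le_trans.
  rewrite /Pr /Ex big_mkcond; apply: ler_sum => o _.
  by case: (Q o); rewrite ?mulr1 ?mulr0.
- apply: bm_sum => o; apply: bmM; first exact: (bm_indic R mZA).
  by apply: bm_prod => i; exact: blaw.
- exact: bm_cst.
Qed.

End joint_law.
End tie_breaking.
End sample_law.

(** * Concentration of the neighbor statistic at a fixed threshold *)

Definition lipschitz_growth (R : realType) m (beta C : R) (g : m.-tuple R -> R) :=
  forall x x', `|g x - g x'| <=
    C * (1 + norm2 x `^ beta + norm2 x' `^ beta) * dist2 x x'.

Definition exp_tail d (T : measurableType d) (R : realType) (P : probability T R)
    m (C1 C2 : R) (W : T -> m.-tuple R) :=
  forall t, 0 < t -> (P [set w | (t <= norm2 (W w))%R] <= (C1 * expR (- C2 * t))%:E)%E.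

(** A point of the ball of radius B and its nearest neighbors are close together
    unless it is alone in its cell; so the sum of g_i g_j over the edges is close
    to the sum of the squares g_i ^ 2. *)
Lemma edge_mean_close (R : realType) (m n : nat) (g : m.-tuple R -> R)
    (z : 'I_n -> m.-tuple R) (B eta eps : R) (F : finType) (cell : m.-tuple R -> F) :
  (2 <= n)%N -> (forall x, 0 <= g x <= 1) ->
  (forall u v, norm2 u <= B -> norm2 v <= B -> cell u = cell v -> dist2 u v <= eta) ->
  (forall u v, norm2 u <= B -> dist2 u v <= eta -> `|g u - g v| <= eps) ->
  0 <= eps ->
  `|\sum_i g (z i) * (\sum_j near_weight z i j * g (z j)) - \sum_i g (z i) ^+ 2| <=
  eps * n%:R + 2 * (\sum_(i < n) ((B < norm2 (z i))%R)%:R) + #|F|%:R.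
Proof.
move=> n2 g01 cellP gP e0; rewrite -sumrB (le_trans (ler_norm_sum _ _ _))//.
pose X := [set i | [exists j, (j \in near_set z i) && (eta < dist2 (z i) (z j))%R]]%SET.
pose O := [set i | (B < norm2 (z i))%R]%SET.
have cX : (#|X| <= #|O| + #|F|)%N by exact: (card_far_neighbor z cellP).
have OE : \sum_(i < n) ((B < norm2 (z i))%R)%:R = #|O|%:R :> R.
  rewrite -natr_sum; congr (_%:R); rewrite -sum1_card [RHS]big_mkcond /=.
  by apply: eq_bigr => i _; rewrite inE; case: ifP.
have XE : \sum_i (i \in X)%:R = #|X|%:R :> R.
  rewrite -natr_sum; congr (_%:R); rewrite -sum1_card [RHS]big_mkcond /=.
  by apply: eq_bigr => i _; case: ifP.
apply: (@le_trans _ _ (\sum_i (eps + ((i \in X)%:R + ((B < norm2 (z i))%R)%:R)))).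
  apply: ler_sum => i _; rewrite expr2 -mulrBr normrM.
  have /andP[gi0 gi1] := g01 (z i); rewrite (ger0_norm gi0).
  apply: (@le_trans _ _ `|\sum_j near_weight z i j * g (z j) - g (z i)|).
    by rewrite ler_piMl.
  set c := eps + _.
  have avgB (y : R) (f : 'I_n -> R) : \sum_j near_weight z i j * f j - y =
      \sum_j near_weight z i j * (f j - y).
    under [RHS]eq_bigr do rewrite mulrBr.
    by rewrite sumrB -mulr_suml near_weight_sum1// mul1r.
  rewrite avgB (le_trans (ler_norm_sum _ _ _))//.
  have -> : c = \sum_j near_weight z i j * c.
    by rewrite -mulr_suml near_weight_sum1// mul1r.
  apply: ler_sum => j _; rewrite normrM (ger0_norm (near_weight_ge0 _ _ _)) /c {c}.
  rewrite /near_weight; case: ifPn => [jn|_]; last by rewrite !mul0r.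
  rewrite ler_wpM2l ?invr_ge0//.
  have /andP[gj0 gj1] := g01 (z j).
  have le1 : `|g (z j) - g (z i)| <= 1 by rewrite ler_norml; apply/andP; split; lra.
  case: (leP (norm2 (z i)) B) => zB /=; last first.
    by apply: (le_trans le1); rewrite addrA lerDr addr_ge0.
  rewrite addr0; case: (boolP (i \in X)) => /= iX; first by apply: (le_trans le1); rewrite lerDr.
  rewrite addr0 distrC; apply: gP => //.
  by move: iX; rewrite inE => /existsPn/(_ j); rewrite jn /= -leNgt.
rewrite !big_split /= sumr_const card_ord XE OE -[eps *+ n]mulr_natr.
have : (#|X|%:R : R) <= #|O|%:R + #|F|%:R by rewrite -natrD ler_nat.
lra.
Qed.

Section core.
Context (R : realType) (beta C C1 C2 : R).
Hypotheses (hbeta : 0 <= beta) (hC : 0 <= C) (hC1 : 0 < C1) (hC2 : 0 < C2).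

Lemma tail_radius (eps : R) : 0 < eps -> exists2 B, 0 < B & C1 * expR (- C2 * B) <= eps.
Proof.
move=> e0; exists (1 + `|ln (C1 / eps)| / C2).
  by rewrite ltr_wpDr// divr_ge0// ltW.
rewrite -ler_pdivlMl// -[leRHS](@lnK R) ?posrE ?mulr_gt0 ?invr_gt0//.
rewrite ler_expR [C1^-1 * _](_ : _ = (C1 / eps)^-1); last by rewrite invf_div mulrC.
rewrite lnV ?posrE ?divr_gt0//.
have -> : - C2 * (1 + `|ln (C1 / eps)| / C2) = - C2 - `|ln (C1 / eps)|.
  by field; rewrite gt_eqF.
have := ler_norm (ln (C1 / eps)); have := hC2; lra.
Qed.

Lemma growth_modulus (B eps : R) : 0 < B -> 0 < eps -> exists2 eta, 0 < eta &
  forall m (g : m.-tuple R -> R), lipschitz_growth beta C g ->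
  forall u v, norm2 u <= B -> dist2 u v <= eta -> `|g u - g v| <= eps.
Proof.
move=> B0 e0; pose B2 := Num.sqrt 2 * (B + 1).
pose A := C * (1 + B `^ beta + B2 `^ beta) + 1.
have A0 : 0 < A.
  by rewrite ltr_wpDl// mulr_ge0// !addr_ge0// powR_ge0.
exists (Num.min 1 (eps / A)); first by rewrite lt_min ltr01 divr_gt0.
move=> m g hg u v uB; rewrite le_min => /andP[d1 dA].
have vB : norm2 v <= B2.
  apply: (le_trans (norm2_le_of_close ler01 d1)).
  by rewrite ler_wpM2l ?sqrtr_ge0// lerD2r.
apply: (le_trans (hg u v)).
apply: (@le_trans _ _ (A * (eps / A))); last by rewrite mulrCA divff ?gt_eqF// mulr1.
apply: ler_pM => //.
- by rewrite mulr_ge0// !addr_ge0// powR_ge0.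
- exact: dist2_ge0.
rewrite (@le_trans _ _ (C * (1 + B `^ beta + B2 `^ beta)))//; last by rewrite lerDl.
have B20 : 0 <= B2 by rewrite mulr_ge0 ?sqrtr_ge0// addr_ge0// ltW.
rewrite ler_wpM2l// lerD// ?lerD2l; apply: ge0_ler_powR => //; rewrite ?nnegrE ?norm2_ge0//.
exact: ltW.
Qed.

(** The deviation of the edge statistic at a threshold t, for index sets S0
    whose size satisfies dim; a and b do not depend on the laws. *)
Definition threshold_bound (dim : pred nat) (eps a b : R) : Prop :=
  forall d (T : measurableType d) (P : probability T R)
    (p : nat) (Y : {RV P >-> R}) (X : {RV P >-> p.-tuple R})
    d' (T' : measurableType d') (P' : probability T' R) (n : nat)
    (Ys : 'I_n -> {RV P' >-> R}) (Xs : 'I_n -> {RV P' >-> p.-tuple R})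
    (N : {set 'I_p} -> 'I_n -> T' -> 'I_n) (S0 : {set 'I_p}) (t : R)
    (g : #|S0|.-tuple R -> R),
  iid_copies Y X Ys Xs -> uniform_tie_breaking Ys Xs N -> (2 <= n)%N ->
  S0 != finset.set0 -> dim #|S0| ->
  measurable_fun setT g -> (forall z, 0 <= g z <= 1) ->
  is_cond_prob P (subvec S0 \o X) [set w | (t <= Y w)%R] g ->
  lipschitz_growth beta C g -> exp_tail P C1 C2 (subvec S0 \o X) ->
  let bad := [set w | 12 * eps * n%:R <
    `|\sum_i ((t <= Ys i w)%R)%:R * ((t <= Ys (N S0 i w) w)%R)%:R -
      EE P (fun w => g (subvec S0 (X w)) ^+ 2) * n%:R|] in
  measurable bad /\ pr P' bad <= a * expR (- b * n%:R).

(** Of the deviation 12 eps n, edge_sum_concentration takes 3 and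
    mean_concentration 3; the conditional mean takes the remaining 6: 1 for the
    oscillation of g, 4 for the points outside the ball and 1 for the cells,
    whose number is at most eps n for large n. For small n the bound holds
    because a exp(- b n) exceeds 1. *)
Lemma threshold_concentration (m : nat) (eps : R) : 0 < eps -> eps <= 1 ->
  exists a b : R, [/\ 0 < a, 0 < b & threshold_bound (pred1 m) eps a b].
Proof.
move=> e0 e1.
have [B B0 hB] := tail_radius e0.
have [eta eta0 heta] := growth_modulus B0 e0.
have [F [cell cellP]] := @ball_cells R m B eta B0 eta0.
have [M kiss] := kissing_bound R m.
pose kap : R := M.+1%:R.
pose r := (Num.truncn eps^-1).+1.
have r0 : (0 < r)%N by [].
have re : r%:R^-1 <= eps.
  by rewrite -[leRHS]invrK lef_pV2 ?posrE ?invr_gt0 ?ltr0n// ltW// truncnS_gt.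
pose b1 := eps ^+ 2 / (8 * (2 * (kap + kap ^+ 2 + 1) / eps + 2) ^+ 2).
pose b2 := eps ^+ 2 / 8.
have k0 : 0 < kap by rewrite ltr0n.
have b10 : 0 < b1.
  rewrite divr_gt0 ?exprn_gt0// mulr_gt0// exprn_gt0// addr_gt0// divr_gt0//.
  by rewrite mulr_gt0// !addr_gt0// exprn_gt0.
have b20 : 0 < b2 by rewrite divr_gt0// exprn_gt0.
pose b := Num.min b1 b2.
have b0 : 0 < b by rewrite lt_min b10.
pose a := 5 + 2 * r%:R + expR (b * (#|F|%:R / eps)).
exists a, b; split=> //.
  by rewrite !addr_gt0 ?expR_gt0// mulr_gt0// ltr0n.
move=> d T P p Y X d' T' P' n Ys Xs N S0 t g iid tie n2 S0n0 /eqP S0m mg g01 gE gL tail bad.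
have n0 : 0 < n%:R :> R by rewrite ltr0n; exact: leq_trans n2.
move: cell cellP kiss; rewrite -{}S0m => cell cellP kiss.
set aS := EE P _ in bad *.
pose Q (o : {ffun 'I_n -> bool * 'I_n}) := 12 * eps * n%:R < `|edge_sum R o - aS * n%:R|.
have badE : bad = [set w | Q (outcomes Ys N S0 t w)].
  have eE w : edge_sum R (outcomes Ys N S0 t w) =
      \sum_i ((t <= Ys i w)%R)%:R * ((t <= Ys (N S0 i w) w)%R)%:R.
    by apply: eq_bigr => i _; rewrite !ffunE.
  by apply/seteqP; split => w; rewrite /bad /Q /= eE.
have mo := measurable_outcomes tie S0 t.
have mbad : measurable bad by rewrite badE; exact: measurable_finite_valued.
split=> //.
have [nF|nF] := leP (#|F|%:R / eps) n%:R; last first.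
  apply: (le_trans (pr_le1 P' mbad)).
  apply: (@le_trans _ _ (expR (b * (#|F|%:R / eps)) * expR (- (b * (#|F|%:R / eps))))).
    by rewrite -expRD subrr expR0.
  apply: ler_pM; rewrite ?expR_ge0//.
    by rewrite lerDr addr_ge0// mulr_ge0.
  by rewrite ler_expR mulNr lerN2 ler_pM2l// ltW.
have nFe : #|F|%:R <= eps * n%:R by rewrite mulrC -ler_pdivrMr.
pose Z w : n.-tuple (#|S0|.-tuple R) := [tuple subvec S0 (Xs i w) | i < n].
have ms2 : measurable_fun setT (fun u : R * p.-tuple R => subvec S0 u.2).
  by apply: measurableT_comp; [exact: measurable_subvec|exact: measurable_snd].
(* the number of sample points outside the ball of radius B *)
pose E (u : R * p.-tuple R) := B < norm2 (subvec S0 u.2).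
have mE : measurable [set u | E u].
  rewrite [X in measurable X](_ : _ =
    (fun u : R * p.-tuple R => norm2 (subvec S0 u.2)) @^-1` `]B, +oo[%classic).
    apply: measurable_preimage => //.
    by apply: measurableT_comp => //; exact: measurable_norm2.
  by apply/seteqP; split => u /=; rewrite in_itv /= andbT.
have [mbox prbox] := frequency_concentration (measurable_pair0 Y X) (measurable_pairs Ys Xs)
  (indep_pairs iid) (ident_pairs iid) mE e0 e1.
set box := [set w | _] in mbox prbox.
have mean := mean_concentration (measurable_pair0 Y X) (measurable_pairs Ys Xs)
  (indep_pairs iid) (ident_pairs iid) (f := fun u => g (subvec S0 u.2) ^+ 2) _ _
  e0 e1 r0 re.
have [||mmean prmean] := mean.
- by apply: measurable_funX; exact: (measurableT_comp mg ms2).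
- move=> u; have /andP[g0 g1] := g01 (subvec S0 u.2).
  by rewrite exprn_ge0//= exprn_ile1.
set mn := [set w | _] in mmean prmean.
have pE : pr P (pair0 Y X @^-1` [set u | E u]) <= eps.
  apply: le_trans hB; rewrite -lee_fin prE; last first.
    by apply: measurable_preimage => //; exact: measurable_pair0.
  apply: le_trans (tail B B0); apply: le_measure; rewrite ?inE.
  - by apply: measurable_preimage => //; exact: measurable_pair0.
  - apply: measurable_le_fun => //; apply: measurableT_comp; first exact: measurable_norm2.
    by apply: measurableT_comp; [exact: measurable_subvec|exact: measurable_funP].
  - by move=> w /= /ltW.
pose A : set (n.-tuple (#|S0|.-tuple R)) := [set z |
  (\sum_(i < n) ((B < norm2 (tnth z i))%R)%:R <= 2 * eps * n%:R)%R /\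
  (`|\sum_i g (tnth z i) ^+ 2 - aS * n%:R| <= 3 * eps * n%:R)%R].
have mA : measurable A.
  have mz i : measurable_fun setT (fun z : n.-tuple (#|S0|.-tuple R) => tnth z i).
    exact: measurable_tnth.
  apply: (@measurableI _ _ [set z | _] [set z | _]); apply: measurable_le_fun => //.
    apply: bm_measurable; apply: bm_sum => i.
    rewrite (_ : (fun _ => _) = \1_((fun z : n.-tuple (#|S0|.-tuple R) =>
        norm2 (tnth z i)) @^-1` `]B, +oo[%classic)).
      apply: bm_indic; apply: measurable_preimage => //.
      by apply: (measurableT_comp (@measurable_norm2 R #|S0|) (mz i)).
    apply/funext => z; rewrite indicE; congr (nat_of_bool _)%:R.
    by apply/idP/idP; rewrite inE /= in_itv /= andbT.
  apply: measurableT_comp => //; apply: measurable_funB; last exact: measurable_cst.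
  apply: measurable_sum => i; apply: measurable_funX; exact: (measurableT_comp mg (mz i)).
have mZ : measurable_fun setT Z.
  apply/measurable_fun_tnthP => i.
  have -> : (@tnth n (#|S0|.-tuple R) ^~ i) \o Z = (fun w => subvec S0 (Xs i w)).
    by apply/funext => w /=; rewrite tnth_mktuple.
  by apply: measurableT_comp; [exact: measurable_subvec|exact: measurable_funP].
have mZA : measurable (Z @^-1` A) by exact: measurable_preimage.
have main : pr P' ((Z @^-1` A) `&` [set w | Q (outcomes Ys N S0 t w)]) <=
    3 * expR (- b1 * n%:R).
  apply: (pr_outcomes_le iid tie n2 S0n0 mg g01 gE (Q := Q) mA); first by rewrite mulr_ge0// expR_ge0.
  move=> z [zB zg].
  have kin j : \sum_i near_weight (tnth z) i j <= kap.
    by apply: near_weight_in => A' c h1 h2; exact: kiss h1 h2.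
  have conc := @edge_sum_concentration R n (fun i => g (tnth z i)) (near_weight (tnth z))
    (fun i => g01 _) (near_weight_ge0 _) (fun i => near_weight_sum1 _ i n2)
    (near_weight_diag _) kap (ltW k0) kin eps e0 e1.
  apply: le_trans conc; apply: le_Pr.
    by move=> i o; apply: edge_law_ge0 => [j|j k]; [exact: g01|exact: near_weight_ge0].
  move=> o; rewrite /Q; apply: contraLR; rewrite -!leNgt => ho.
  have cl : `|\sum_i g (tnth z i) * (\sum_j near_weight (tnth z) i j * g (tnth z j)) -
      \sum_i g (tnth z i) ^+ 2| <=
      eps * n%:R + 2 * (\sum_(i < n) ((B < norm2 (tnth z i))%R)%:R) + #|F|%:R.
    apply: (@edge_mean_close _ _ _ g (tnth z) B eta eps F cell) => //.
    - by move=> u v; exact: heta.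
    - exact: ltW.
  have chain (x1 x2 x3 x4 e s f : R) : `|x1 - x2| <= 3 * e -> `|x2 - x3| <= e + 2 * s + f ->
      `|x3 - x4| <= 3 * e -> s <= 2 * e -> f <= e -> `|x1 - x4| <= 12 * e.
    clear; rewrite !ler_norml => /andP[? ?] /andP[? ?] /andP[? ?] ? ?.
    by apply/andP; split; lra.
  move: ho cl zg zB nFe.
  set s := \sum_i ((_ < _)%R)%:R; set s1 := edge_sum _ _; set s2 := \sum_i _ * _; set s3 := \sum_i _ ^+ 2.
  have -> : 12 * eps * n%:R = 12 * (eps * n%:R) by ring.
  have -> : 3 * eps * n%:R = 3 * (eps * n%:R) by ring.
  have -> : 2 * eps * n%:R = 2 * (eps * n%:R) by ring.
  set en := eps * n%:R; set an := aS * n%:R.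
  exact: chain.
have le_bad : pr P' bad <= pr P' ((Z @^-1` A `&` [set w | Q (outcomes Ys N S0 t w)]) `|`
    (box `|` mn)).
  apply: le_pr => //.
    apply: measurableU; last exact: measurableU.
    by apply: measurableI => //; rewrite -badE.
  rewrite badE => w /= Qw.
  have [Aw|nAw] := pselect (A (Z w)); first by left.
  right; apply: contrapT => /not_orP[nbox nmn]; apply: nAw; split.
    have nbox' : `|\sum_i (E (pairs Ys Xs i w))%:R - pr P (pair0 Y X @^-1` [set u | E u]) * n%:R|
      <= eps * n%:R by rewrite leNgt; apply/negP.
    have -> : \sum_(i < n) ((B < norm2 (tnth (Z w) i))%R)%:R = \sum_i (E (pairs Ys Xs i w))%:R :> R.
      by apply: eq_bigr => i _; rewrite tnth_mktuple.
    have : pr P (pair0 Y X @^-1` [set u | E u]) * n%:R <= eps * n%:R.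
      by rewrite ler_wpM2r// ltW.
    move: nbox'; rewrite ler_norml => /andP[_ h] h'.
    have -> : 2 * eps * n%:R = eps * n%:R + eps * n%:R by ring.
    lra.
  have -> : \sum_i g (tnth (Z w) i) ^+ 2 = \sum_i g (subvec S0 (pairs Ys Xs i w).2) ^+ 2.
    by apply: eq_bigr => i _; rewrite tnth_mktuple.
  by rewrite leNgt; apply/negP.
apply: (le_trans le_bad).
apply: (le_trans (pr_setU_le _ _ _)); [|exact: measurableU|].
  by apply: measurableI => //; rewrite -badE.
have h2 := pr_setU_le P' mbox mmean.
have x1 : expR (- b1 * n%:R) <= expR (- b * n%:R).
  by rewrite ler_expR !mulNr lerN2 ler_wpM2r ?(ltW n0)// /b ge_min lexx.
have x2 : expR (- b2 * n%:R) <= expR (- b * n%:R).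
  by rewrite ler_expR !mulNr lerN2 ler_wpM2r ?(ltW n0)// /b ge_min lexx orbT.
have rr : 0 <= r%:R * (expR (- b * n%:R) - expR (- b2 * n%:R)) by rewrite mulr_ge0// subr_ge0.
have x3 : 0 <= expR (b * (#|F|%:R / eps)) * expR (- b * n%:R) by rewrite mulr_ge0 ?expR_ge0.
rewrite /a; move: main h2 prbox prmean x1 x2 x3 rr; rewrite -/b2 -/b1.
set X1 := expR (- b1 * _); set X2 := expR (- b2 * _); set X0 := expR (- b * _).
set pm := pr _ mn; set pb := pr _ box.
have -> : r%:R * (X0 - X2) = r%:R * X0 - r%:R * X2 by ring.
have -> : 2 * r%:R * X2 = 2 * (r%:R * X2) by ring.
set e3 := expR (b * _).
have -> : (5 + 2 * r%:R + e3) * X0 = 5 * X0 + 2 * (r%:R * X0) + e3 * X0 by ring.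
set rX0 := r%:R * X0; set rX2 := r%:R * X2.
lra.
Qed.

Lemma threshold_concentration_upto (K : nat) (eps : R) : 0 < eps -> eps <= 1 ->
  exists a b : R, [/\ 0 < a, 0 < b & threshold_bound (fun m => (m <= K)%N) eps a b].
Proof.
move=> e0 e1; elim: K => [|K [a [b [a0 b0 IH]]]].
  exists 1, 1; split; rewrite ?ltr01//.
  move=> d T P p Y X d' T' P' n Ys Xs N S0 t g _ _ _ S0n0.
  by rewrite leqn0 cards_eq0 (negbTE S0n0).
have [a' [b' [a'0 b'0 h]]] := threshold_concentration K.+1 e0 e1.
exists (a + a'), (Num.min b b'); split; [exact: addr_gt0|by rewrite lt_min b0|].
move=> d T P p Y X d' T' P' n Ys Xs N S0 t g iid tie n2 S0n0 S0K mg g01 gE gL tail bad.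
have le_exp (c : R) : Num.min b b' <= c -> expR (- c * n%:R) <= expR (- Num.min b b' * n%:R).
  by move=> hc; rewrite ler_expR !mulNr lerN2 ler_wpM2r.
move: S0K; rewrite leq_eqVlt => /orP[S0K|S0K].
  have [m1 m2] := h _ _ _ _ _ _ _ _ _ _ _ _ _ _ _ _ iid tie n2 S0n0 S0K mg g01 gE gL tail.
  split=> //; apply: (le_trans m2); apply: ler_pM; rewrite ?expR_ge0 ?(ltW a'0)//.
    by rewrite lerDr ltW.
  by rewrite le_exp// ge_min lexx orbT.
have [m1 m2] := IH _ _ _ _ _ _ _ _ _ _ _ _ _ _ _ _ iid tie n2 S0n0 S0K mg g01 gE gL tail.
split=> //; apply: (le_trans m2); apply: ler_pM; rewrite ?expR_ge0 ?(ltW a0)//.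
  by rewrite lerDl ltW.
by rewrite le_exp// ge_min lexx.
Qed.

End core.

(** * Quantiles and staircase approximation *)

Section quantile.
Context d (T : measurableType d) (R : realType) (P : probability T R).
Variable Y : {RV P >-> R}.

Lemma measurable_ge_rv t : measurable [set w | (t <= Y w)%R].
Proof. by apply: measurable_le_fun => //; exact: measurable_funP. Qed.

Lemma measurable_le_rv t : measurable [set w | (Y w <= t)%R].
Proof. by apply: measurable_le_fun => //; exact: measurable_funP. Qed.

Lemma measurable_gt_rv t : measurable [set w | (t < Y w)%R].
Proof.
rewrite (_ : [set _ | _] = ~` [set w | (Y w <= t)%R]); last first.
  by apply/seteqP; split => w /=; rewrite ltNge => /negP.
by apply: measurableC; exact: measurable_le_rv.
Qed.

Definition quantile (u : R) : R := inf [set t | u <= pr P [set w | (Y w <= t)%R]].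

Lemma cdfE t : cdf Y t = (pr P [set w | (Y w <= t)%R])%:E.
Proof.
rewrite prE; last exact: measurable_le_rv.
by rewrite /cdf /distribution /pushforward; congr (P _).
Qed.

Variable u : R.
Hypotheses (u0 : 0 < u) (u1 : u < 1).

Let S : set R := [set t | u <= pr P [set w | (Y w <= t)%R]].

Lemma quantile_set_neq0 : S !=set0.
Proof.
apply: contrapT => /forallNP h.
have : (1 <= u%:E)%E.
  apply: (cvge_to_le (cvg_cdfy1 Y)); apply: nearW => t; rewrite cdfE lee_fin.
  by have := h t; rewrite /S /= => /negP; rewrite -ltNge => /ltW.
by rewrite lee_fin leNgt u1.
Qed.

Lemma quantile_set_lbound : has_lbound S.
Proof.
have [t0 ht0] : exists t0, pr P [set w | (Y w <= t0)%R] < u.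
  apply: contrapT => /forallNP h.
  have : (u%:E <= 0)%E.
    apply: (cvge_to_ge (cvg_cdfNy0 Y)); apply: nearW => t; rewrite cdfE lee_fin.
    by have := h t => /negP; rewrite -leNgt.
  by rewrite lee_fin leNgt u0.
exists t0 => t St; rewrite leNgt; apply/negP => tt0.
have : pr P [set w | (Y w <= t)%R] <= pr P [set w | (Y w <= t0)%R].
  apply: le_pr; [exact: measurable_le_rv|exact: measurable_le_rv|].
  by move=> w /= /le_trans; apply; exact: ltW.
by rewrite leNgt (lt_le_trans ht0 St).
Qed.

Lemma quantile_le : u <= pr P [set w | (Y w <= quantile u)%R].
Proof.
rewrite -lee_fin -cdfE.
apply: (cvge_to_ge (@cdf_right_continuous _ _ _ P Y (quantile u))).
near=> t; rewrite cdfE lee_fin.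
have qt : quantile u < t by near: t; exact: nbhs_right_gt.
have [|s Ss st] := @inf_adherent _ S (t - quantile u) _ (conj quantile_set_neq0 quantile_set_lbound).
  by rewrite subr_gt0.
have {}st : s < t by move: st; rewrite -/(quantile u) addrCA subrr addr0.
apply: (le_trans Ss); apply: le_pr; [exact: measurable_le_rv|exact: measurable_le_rv|].
by move=> w /= /le_trans; apply; exact: ltW.
Unshelve. all: by end_near.
Qed.

Lemma quantile_ge : 1 - u <= pr P [set w | (quantile u <= Y w)%R].
Proof.
set q := quantile u.
suff : pr P (~` [set w | (q <= Y w)%R]) <= u.
  rewrite pr_setC; last exact: measurable_ge_rv.
  by lra.
rewrite -lee_fin prE; last by apply: measurableC; exact: measurable_ge_rv.
pose F k := [set w | (Y w <= q - k.+1%:R^-1)%R].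
have mF k : measurable (F k) by exact: measurable_le_rv.
have -> : ~` [set w | (q <= Y w)%R] = \bigcup_k F k.
  apply/seteqP; split => w /=.
    move/negP; rewrite -ltNge => wq.
    have /ltr_add_invr[k hk] := wq.
    by exists k => //; rewrite /F /= lerBrDr ltW.
  move=> [k _]; rewrite /F /= => wk; apply/negP; rewrite -ltNge.
  by rewrite (le_lt_trans wk)// ltrBlDr ltrDl invr_gt0.
have c : P (F k) @[k --> \oo] --> P (\bigcup_k F k).
  apply: nondecreasing_cvg_mu => //; first exact: bigcup_measurable.
  move=> k l kl; apply/subsetPset => w; rewrite /F /= => /le_trans; apply.
  by rewrite lerD2l lerN2 lef_pV2 ?posrE// ler_nat.
apply: (cvge_to_le c); apply: nearW => k; rewrite -prE// lee_fin leNgt; apply/negP => hk.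
have : S (q - k.+1%:R^-1) by rewrite /S /=; exact: ltW.
move=> /(ge_inf quantile_set_lbound); rewrite -/(quantile u) -/q leNgt => /negP; apply.
by rewrite ltrBlDr ltrDl invr_gt0.
Qed.

End quantile.

Lemma quantile_mono d (T : measurableType d) (R : realType) (P : probability T R)
    (Y : {RV P >-> R}) (u v : R) : 0 < u -> u <= v -> v < 1 ->
  quantile Y u <= quantile Y v.
Proof.
move=> u0 uv v1; apply: lb_le_inf.
  exact: quantile_set_neq0.
move=> t vt; apply: ge_inf.
  by apply: quantile_set_lbound.
exact: le_trans uv vt.
Qed.

Section staircase.
Context (R : realType) (k : nat) (tau : nat -> R).
Hypothesis tau_mono : forall i j, (i <= j)%N -> (j < k)%N -> tau i <= tau j.
Implicit Types (A : R -> R) (y : R).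

(** The values of A along the thresholds, with the values 1 and 0 of a survival
    function at the two ends. *)
Definition level A i : R :=
  if i is i'.+1 then (if (i' < k)%N then A (tau i') else 0) else 1.

(** The step functions A(lo y) and A(hi y), where lo y and hi y are the
    thresholds next to y, expanded in the indicators of the half-lines. *)
Definition upper_stair A y : R :=
  1 - \sum_(i < k) (level A i - level A i.+1) * ((tau i <= y)%R)%:R.

Definition lower_stair A y : R :=
  level A 1 - \sum_(i < k) (level A i.+1 - level A i.+2) * ((tau i < y)%R)%:R.

Section bounds.
Variable A : R -> R.
Hypothesis A01 : forall y, 0 <= A y <= 1.
Hypothesis A_noninc : forall x y, x <= y -> A y <= A x.

Lemma le_upper_stair y : A y <= upper_stair A y.
Proof.
suff h j : (j <= k)%N -> let U := 1 - \sum_(i < j) (level A i - level A i.+1) *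
      ((tau i <= y)%R)%:R in
    A y <= U /\ ((if j is i.+1 then tau i <= y else true) -> U = level A j).
  by have [] := h k (leqnn k).
elim: j => [_|j IH jk] /=; first by rewrite big_ord0 subr0; have /andP[] := A01 y.
have [h1 h2] := IH (ltnW jk); rewrite big_ord_recr /=.
have [ty|ty] := leP (tau j) y; last by rewrite mulr0 addr0.
have {}h2 : 1 - \sum_(i < j) (level A i - level A i.+1) * ((tau i <= y)%R)%:R = level A j.
  by apply: h2; case: j jk ty {IH h1} => // j jk ty; apply: le_trans ty; exact: tau_mono.
rewrite mulr1 opprD addrA h2 opprB addrC subrK /= jk.
by split=> //; exact: A_noninc.
Qed.

Lemma lower_stair_le y : lower_stair A y <= A y.
Proof.
suff h j : (j <= k)%N -> let L := level A 1 - \sum_(i < j) (level A i.+1 - level A i.+2) *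
      ((tau i < y)%R)%:R in
    if (if j is i.+1 then tau i < y else true) then L = level A j.+1 else L <= A y.
  have := h k (leqnn k); rewrite -/(lower_stair A y) /=; case: ifP => // _ ->.
  by rewrite ltnn; have /andP[] := A01 y.
elim: j => [_|j IH jk] /=; first by rewrite big_ord0 subr0.
have := IH (ltnW jk); rewrite big_ord_recr /=.
set s := \sum_(i < j) _ => h.
have [ty|ty] := ltP (tau j) y.
  rewrite mulr1 opprD addrA.
  move: h; have -> : (match j with 0%N => true | i.+1 => (tau i < y)%R end) = true.
    by case: j jk ty {IH s} => // j jk ty; apply: le_lt_trans ty; exact: tau_mono.
  by rewrite jk => ->; rewrite opprB addrC subrK.
rewrite mulr0 addr0; move: h; case: ifP => // _ ->.
by rewrite jk; exact: A_noninc.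
Qed.

Lemma level01 i : 0 <= level A i <= 1.
Proof.
by case: i => [|i] /=; rewrite ?ler01 ?lexx//; case: ifP => //; rewrite ler01 lexx.
Qed.

Lemma level_noninc i : (i <= k)%N -> level A i.+1 <= level A i.
Proof.
case: i => [_|i ik] /=; first by case: ifP; have /andP[] := A01 (tau 0); rewrite ?ler01.
rewrite ik; case: ifP => i1; last by have /andP[] := A01 (tau i).
by apply: A_noninc; exact: tau_mono.
Qed.

End bounds.

(** The averages of the stairs, in terms of the survival probabilities v and v'
    at the thresholds. *)
Definition upper_avg A (v : nat -> R) : R :=
  1 - \sum_(i < k) (level A i - level A i.+1) * v i.

Definition lower_avg A (v : nat -> R) : R :=
  level A 1 - \sum_(i < k) (level A i.+1 - level A i.+2) * v i.

Lemma level_close A a (eps : R) : 0 <= eps ->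
  (forall i, (i < k)%N -> `|A (tau i) - a (tau i)| <= eps) ->
  forall i, `|level A i - level a i| <= eps.
Proof.
move=> e0 h [|i] /=; first by rewrite subrr normr0.
by case: ifP => [/h//|_]; rewrite subrr normr0.
Qed.

Lemma term_close (x x' y y' v w eps : R) : 0 <= v <= 1 -> -1 <= y - y' <= 1 ->
  `|x - y| <= eps -> `|x' - y'| <= eps -> `|v - w| <= eps ->
  `|(x - x') * v - (y - y') * w| <= 3 * eps.
Proof.
move=> /andP[v0 v1] /andP[y0 y1] h1 h2 h3.
have -> : (x - x') * v - (y - y') * w =
  ((x - y) - (x' - y')) * v + (y - y') * (v - w) by ring.
have e0 : 0 <= eps by exact: le_trans h1.
apply: (le_trans (ler_normD _ _)); rewrite !normrM.
have a1 : `|x - y - (x' - y')| <= 2 * eps.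
  by apply: (le_trans (ler_normB _ _)); lra.
have a2 : `|x - y - (x' - y')| * `|v| <= 2 * eps.
  rewrite (ger0_norm v0) -[leRHS]mulr1; apply: ler_pM => //.
have a3 : `|y - y'| * `|v - w| <= eps.
  by rewrite -[leRHS]mul1r; apply: ler_pM => //; rewrite ler_norml y0.
lra.
Qed.

Section compare.
Variables (A a : R -> R) (v w : nat -> R) (eps : R).
Hypothesis a01 : forall y, 0 <= a y <= 1.
Hypothesis e0 : 0 <= eps.
Hypothesis Aa : forall i, (i < k)%N -> `|A (tau i) - a (tau i)| <= eps.
Hypothesis v01 : forall i, 0 <= v i <= 1.
Hypothesis vw : forall i, (i < k)%N -> `|v i - w i| <= eps.

Let dlevel i j : -1 <= level a i - level a j <= 1.
Proof.
have /andP[h1 h2] := level01 a01 i; have /andP[h3 h4] := level01 a01 j.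
by apply/andP; split; lra.
Qed.

Lemma upper_avg_close : `|upper_avg A v - upper_avg a w| <= 3 * k%:R * eps.
Proof.
rewrite /upper_avg.
set s := \sum_(i < k) _; set s' := \sum_(i < k) _.
have -> : 1 - s - (1 - s') = - (s - s') by ring.
rewrite normrN /s /s' -sumrB (le_trans (ler_norm_sum _ _ _))//.
apply: (@le_trans _ _ (\sum_(i < k) 3 * eps)); last first.
  by rewrite sumr_const card_ord -[leLHS]mulr_natr mulrAC.
by apply: ler_sum => i _; apply: term_close => //; [exact: level_close|exact: level_close|exact: vw].
Qed.

Lemma lower_avg_close : `|lower_avg A v - lower_avg a w| <= (3 * k%:R + 1) * eps.
Proof.
rewrite /lower_avg.
set s := \sum_(i < k) _; set s' := \sum_(i < k) _.
have -> : level A 1 - s - (level a 1 - s') = (level A 1 - level a 1) - (s - s') by ring.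
rewrite (le_trans (ler_normB _ _))// mulrDl addrC mul1r lerD//; last exact: level_close.
rewrite /s /s' -sumrB (le_trans (ler_norm_sum _ _ _))//.
apply: (@le_trans _ _ (\sum_(i < k) 3 * eps)); last first.
  by rewrite sumr_const card_ord -[leLHS]mulr_natr mulrAC.
by apply: ler_sum => i _; apply: term_close => //; [exact: level_close|exact: level_close|exact: vw].
Qed.

End compare.

(** The two stairs differ only on the open intervals between consecutive
    thresholds, where they differ by consecutive values of a; these differences
    add up to at most 1. *)
Lemma stair_gap a (v v' : nat -> R) (eps : R) : (forall y, 0 <= a y <= 1) ->
  (forall x y, x <= y -> a y <= a x) -> (0 < k)%N ->
  1 - v' 0%N <= eps -> v k.-1 <= eps ->
  (forall i, (i.+1 < k)%N -> v i - v' i.+1 <= eps) ->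
  upper_avg a v' - lower_avg a v <= eps.
Proof.
move=> a01 an k0 h0 hk hi.
have dl i : (i <= k)%N -> 0 <= level a i - level a i.+1.
  by move=> ik; rewrite subr_ge0 level_noninc.
pose D i := level a i - level a i.+1.
pose p i := if i is i'.+1 then v i' else 1.
pose p' i := if (i < k)%N then v' i else 0.
have e : upper_avg a v' - lower_avg a v = \sum_(i < k.+1) D i * (p i - p' i).
  under eq_bigr do rewrite mulrBr.
  have eA : \sum_(i < k.+1) D i * p i = D 0%N + \sum_(i < k) D i.+1 * v i.
    by rewrite big_ord_recl /= mulr1.
  have eB : \sum_(i < k.+1) D i * p' i = \sum_(i < k) D i * v' i.
    rewrite big_ord_recr /= {2}/p' ltnn mulr0 addr0; apply: eq_bigr => i _.
    by rewrite /p' ltn_ord.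
  rewrite sumrB eA eB /upper_avg /lower_avg /D.
  have -> : level a 0 = 1 by [].
  ring.
rewrite e; apply: (@le_trans _ _ (\sum_(i < k.+1) D i * eps)).
  apply: ler_sum => i _; apply: ler_wpM2l; first by rewrite dl// -ltnS.
  rewrite /p /p'; case: i => [[|i] /= ik]; first by rewrite k0.
  case: ifP => [/hi//|]; move/negbT; rewrite -leqNgt subr0 => ki.
  have ek : i.+1 = k by apply/eqP; rewrite eqn_leq ki andbT -ltnS.
  by move: hk; rewrite -{1}ek.
rewrite -mulr_suml.
have -> : \sum_(i < k.+1) D i = 1.
  rewrite /D -(big_mkord xpredT (fun i => level a i - level a i.+1)).
  under eq_bigr do rewrite -opprB.
  rewrite sumrN telescope_sumr//= ltnn; ring.
by rewrite mul1r.
Qed.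

End staircase.

(** * Averages of survival functions *)

Section sandwich.
Context d (T : measurableType d) (R : realType) (P : probability T R).
Context (Y : {RV P >-> R}) (k : nat).
Hypothesis k0 : (0 < k)%N.

Definition grid (i : nat) : R := quantile Y (i.+1%:R / k.+1%:R).

Lemma grid_level i : (i < k)%N ->
  0 < (i.+1%:R / k.+1%:R : R) < 1.
Proof.
move=> ik; rewrite divr_gt0 ?ltr0n//= ltr_pdivrMr ?ltr0n// mul1r ltr_nat ltnS.
exact: ik.
Qed.

Lemma grid_mono i j : (i <= j)%N -> (j < k)%N -> grid i <= grid j.
Proof.
move=> ij jk; have /andP[u0 _] := grid_level (leq_ltn_trans ij jk).
have /andP[_ v1] := grid_level jk.
by apply: quantile_mono => //; rewrite ler_pM2r ?invr_gt0 ?ltr0n// ler_nat ltnS.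
Qed.

Let w' i := pr P [set w | (grid i <= Y w)%R].
Let w i := pr P [set w | (grid i < Y w)%R].

Let w'_ge i : (i < k)%N -> 1 - i.+1%:R / k.+1%:R <= w' i.
Proof. by move=> /grid_level/andP[u0 u1]; exact: quantile_ge. Qed.

Let w_le i : (i < k)%N -> w i <= 1 - i.+1%:R / k.+1%:R.
Proof.
move=> /grid_level/andP[u0 u1]; have := quantile_le Y u0 u1.
rewrite /w (_ : [set w | (grid i < Y w)%R] = ~` [set w | (Y w <= grid i)%R]).
  rewrite pr_setC; last exact: measurable_le_rv.
  by rewrite -/(grid i) lerD2l lerN2.
by apply/seteqP; split => x /=; rewrite ltNge => /negP.
Qed.

Lemma population_gap a : (forall y, 0 <= a y <= 1) -> (forall x y, x <= y -> a y <= a x) ->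
  upper_avg k grid a w' - lower_avg k grid a w <= k.+1%:R^-1.
Proof.
move=> a01 an; apply: stair_gap => //.
- exact: grid_mono.
- by have := w'_ge k0; rewrite div1r lerBlDl -lerBlDr.
- have kk : (k.-1 < k)%N by rewrite prednK.
  have := w_le kk; rewrite prednK// => /le_trans; apply.
  have kn : k.+1%:R != 0 :> R by rewrite pnatr_eq0.
  rewrite lerBlDr -[leLHS](mulfV kn) -[X in _ <= X + _]mul1r -mulrDl.
  by rewrite nat1r.
- move=> i ik; have := w'_ge ik; have := w_le (ltnW ik).
  have -> : i.+2%:R / k.+1%:R = i.+1%:R / k.+1%:R + k.+1%:R^-1 :> R.
    by rewrite -[i.+2%:R]natr1 mulrDl div1r.
  set x := i.+1%:R / _; set y := _^-1; lra.
Qed.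

Lemma stair_EE a (c c' : nat -> R) :
  EE P (fun x => 1 - \sum_(i < k) c i * ((grid i <= Y x)%R)%:R) =
    1 - \sum_(i < k) c i * w' i /\
  EE P (fun x => a - \sum_(i < k) c' i * ((grid i < Y x)%R)%:R) =
    a - \sum_(i < k) c' i * w i.
Proof.
have b' i : bm (fun x => ((grid i <= Y x)%R)%:R : R).
  rewrite (_ : (fun _ => _) = \1_[set x | (grid i <= Y x)%R]).
    by apply: bm_indic; exact: measurable_ge_rv.
  by apply/funext => x; exact: (esym (indic_bool R (fun x => grid i <= Y x) x)).
have b i : bm (fun x => ((grid i < Y x)%R)%:R : R).
  rewrite (_ : (fun _ => _) = \1_[set x | (grid i < Y x)%R]).
    by apply: bm_indic; exact: measurable_gt_rv.
  by apply/funext => x; exact: (esym (indic_bool R (fun x => grid i < Y x) x)).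
split; (rewrite EEB; [|exact: bm_cst|by apply: bm_sum => i; exact: bmZ]);
  rewrite EE_cst EE_sum; try (by move=> i; exact: bmZ); congr (_ - _);
  apply: eq_bigr => i _; rewrite EEZ//; congr (_ * _).
  rewrite /w' -EE_indic; last exact: measurable_ge_rv.
  by congr EE; apply/funext => x; exact: (esym (indic_bool R (fun x => grid i <= Y x) x)).
rewrite /w -EE_indic; last exact: measurable_gt_rv.
by congr EE; apply/funext => x; exact: (esym (indic_bool R (fun x => grid i < Y x) x)).
Qed.

Lemma bm_noninc (a : R -> R) : (forall y, 0 <= a y <= 1) ->
  (forall x y, x <= y -> a y <= a x) -> bm (fun x => a (Y x)).
Proof.
move=> a01 an; apply: (@bm_comp _ _ _ _ _ a) => //; apply: bm01 => //.
by apply: nonincreasing_measurable => // x y; exact: an.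
Qed.

Lemma population_bounds a : (forall y, 0 <= a y <= 1) ->
  (forall x y, x <= y -> a y <= a x) ->
  lower_avg k grid a w <= EE P (fun x => a (Y x)) <= upper_avg k grid a w'.
Proof.
move=> a01 an; have ba := bm_noninc a01 an.
have [e1 e2] := stair_EE (level k grid a 1)
  (fun i => level k grid a i - level k grid a i.+1)
  (fun i => level k grid a i.+1 - level k grid a i.+2).
have bs (c0 : R) (c : nat -> R) (E : nat -> R -> bool) :
    (forall i, measurable [set x | E i (Y x)]) ->
    bm (fun x => c0 - \sum_(i < k) c i * (E i (Y x))%:R).
  move=> mE; apply: bmB; first exact: bm_cst.
  apply: bm_sum => i; apply: bmZ.
  rewrite (_ : (fun _ => _) = \1_[set x | E i (Y x)]); first exact: bm_indic.
  by apply/funext => x; exact: (esym (indic_bool R (fun x => E i (Y x)) x)).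
rewrite /lower_avg /upper_avg -e1 -e2; apply/andP; split; apply: le_EE => //.
- apply: (bs _ (fun i => level k grid a i.+1 - level k grid a i.+2)
    (fun i y => grid i < y)) => i; exact: measurable_gt_rv.
- by move=> x; exact: (lower_stair_le grid_mono a01 an).
- apply: (bs _ (fun i => level k grid a i - level k grid a i.+1)
    (fun i y => grid i <= y)) => i; exact: measurable_ge_rv.
- by move=> x; exact: (le_upper_stair grid_mono a01 an).
Qed.

Section empirical.
Variables (n : nat) (y : 'I_n -> R).
Hypothesis n0 : (0 < n)%N.

Definition freq (E : R -> bool) : R := n%:R^-1 * \sum_j (E (y j))%:R.

Lemma empirical_bounds A : (forall z, 0 <= A z <= 1) ->
  (forall x z, x <= z -> A z <= A x) ->
  lower_avg k grid A (fun i => freq (fun z => grid i < z)) <=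
  n%:R^-1 * \sum_j A (y j) <=
  upper_avg k grid A (fun i => freq (fun z => grid i <= z)).
Proof.
move=> A01 An; have nn : n%:R != 0 :> R by rewrite pnatr_eq0 -lt0n.
have avgE (c0 : R) (c : nat -> R) (E : nat -> R -> bool) :
    c0 - \sum_(i < k) c i * freq (E i) =
    n%:R^-1 * \sum_j (c0 - \sum_(i < k) c i * (E i (y j))%:R).
  rewrite sumrB sumr_const card_ord -[c0 *+ n]mulr_natl mulrBr mulKf//.
  congr (_ - _); rewrite exchange_big mulr_sumr; apply: eq_bigr => i _ /=.
  by rewrite /freq mulrCA mulr_sumr.
rewrite /lower_avg /upper_avg.
rewrite (avgE _ (fun i => level k grid A i.+1 - level k grid A i.+2)
  (fun i z => grid i < z)).
rewrite (avgE _ (fun i => level k grid A i - level k grid A i.+1)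
  (fun i z => grid i <= z)).
apply/andP; split; (rewrite ler_wpM2l ?invr_ge0//; apply: ler_sum => j _).
  exact: (lower_stair_le grid_mono A01 An).
exact: (le_upper_stair grid_mono A01 An).
Qed.

(** Both averages lie between the averages of the stairs, which depend only on
    the values at the quantiles and on the probabilities of the half-lines, and
    the two population stairs are 1 / (k + 1) apart. The quantiles control the
    averages, but not the distance of A and a, when Y has atoms. *)
Lemma average_close (A a : R -> R) (eps : R) :
  (forall z, 0 <= A z <= 1) -> (forall x z, x <= z -> A z <= A x) ->
  (forall z, 0 <= a z <= 1) -> (forall x z, x <= z -> a z <= a x) ->
  0 <= eps ->
  (forall i, (i < k)%N -> `|A (grid i) - a (grid i)| <= eps) ->
  (forall i, (i < k)%N -> `|freq (fun z => grid i <= z) - w' i| <= eps) ->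
  (forall i, (i < k)%N -> `|freq (fun z => grid i < z) - w i| <= eps) ->
  `|n%:R^-1 * \sum_j A (y j) - EE P (fun x => a (Y x))| <=
  k.+1%:R^-1 + (3 * k%:R + 1) * eps.
Proof.
move=> A01 An a01 an e0 hA hw' hw.
have /andP[s1 s2] := empirical_bounds A01 An.
have /andP[s3 s4] := population_bounds a01 an.
have s5 := population_gap a01 an.
have f01 E : 0 <= freq E <= 1.
  rewrite /freq mulr_ge0 ?invr_ge0 ?sumr_ge0//= mulrC ler_pdivrMr ?ltr0n// mul1r.
  rewrite -[X in _ <= X%:R]card_ord -sum1_card natr_sum.
  by apply: ler_sum => j _; case: (E _).
have c1 := upper_avg_close a01 e0 hA (fun i => f01 _) hw'.
have c2 := lower_avg_close a01 e0 hA (fun i => f01 _) hw.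
move: c1 c2; rewrite mulrDl mul1r; set ke := 3 * k%:R * eps.
move: s1 s2 s3 s4 s5 e0.
set x1 := n%:R^-1 * _; set x2 := EE P _; set x3 := upper_avg _ _ A _; set x4 := lower_avg _ _ A _.
set x5 := upper_avg _ _ a _; set x6 := lower_avg _ _ a _; set x7 := k.+1%:R^-1.
clear; rewrite !ler_norml => ? ? ? ? ? ? /andP[? ?] /andP[? ?].
by apply/andP; split; lra.
Qed.

End empirical.
End sandwich.

(** * Versions of conditional probabilities *)

Section cond_prob_versions.
Context d d' (T : measurableType d) (T' : measurableType d') (R : realType).
Context (P : probability T R) (W : T -> T').
Hypothesis mW : measurable_fun setT W.

(** The conditional probabilities are compared on the event where they are in the
    wrong order, which is defined by W. *)
Lemma cond_prob_ae_le (E E' : set T) (g g' : T' -> R) :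
  is_cond_prob P W E g -> is_cond_prob P W E' g' ->
  (forall B, measurable B -> (P (E `&` W @^-1` B) <= P (E' `&` W @^-1` B))%E) ->
  {ae P, forall w, g (W w) <= g' (W w)}.
Proof.
move=> [mg ig hg] [mg' ig' hg'] hB.
pose B := [set x | (g' x < g x)%R].
have mB : measurable B.
  rewrite (_ : B = ~` [set x | (g x <= g' x)%R]).
    by apply: measurableC; exact: measurable_le_fun.
  by apply/seteqP; split => x; rewrite /B /= ltNge => /negP.
have mD : measurable (W @^-1` B) by exact: measurable_preimage.
have igD : P.-integrable (W @^-1` B) (EFin \o g \o W) by exact: integrableS ig.
have igD' : P.-integrable (W @^-1` B) (EFin \o g' \o W) by exact: integrableS ig'.
have mh : measurable_fun (W @^-1` B) (fun w => (g (W w) - g' (W w))%:E).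
  by apply/measurable_EFinP; apply: measurable_funTS; apply: measurable_funB;
    apply: measurableT_comp.
have I0 : (\int[P]_(w in W @^-1` B) `|(g (W w) - g' (W w))%:E| = 0)%E.
  apply/eqP; rewrite eq_le integral_ge0// andbT.
  rewrite (eq_integral (fun w => (g (W w))%:E - (g' (W w))%:E)%E); last first.
    move=> w; rewrite inE /B /= => /ltW h.
    by rewrite ger0_norm ?subr_ge0// EFinB.
  rewrite integralB// hg// hg'// sube_le0; exact: hB.
have := (ae_eq_integral_abs P mD mh).1 I0.
apply: filterS => w hw; rewrite leNgt; apply/negP => gw.
have := hw gw => -[] /eqP; rewrite subr_eq0 => /eqP e.
by rewrite e ltxx in gw.
Qed.

Lemma cond_prob_ae_eq (E : set T) (g g' : T' -> R) :
  is_cond_prob P W E g -> is_cond_prob P W E g' ->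
  {ae P, forall w, g (W w) = g' (W w)}.
Proof.
move=> hg hg'; have h1 := cond_prob_ae_le hg hg' (fun B _ => lexx _).
have h2 := cond_prob_ae_le hg' hg (fun B _ => lexx _).
by apply: filterS2 h1 h2 => w h1 h2; apply/eqP; rewrite eq_le h1 h2.
Qed.

Definition clip (x : R) : R := Num.max 0 (Num.min x 1).

Lemma clip01 x : 0 <= clip x <= 1.
Proof. by rewrite /clip le_max lexx /= ge_max ler01 ge_min lexx orbT. Qed.

Lemma clip_id x : 0 <= x <= 1 -> clip x = x.
Proof. by move=> /andP[x0 x1]; rewrite /clip (min_idPl x1) (max_idPr x0). Qed.

Lemma clipE z : clip z = if z <= 0 then 0 else if z <= 1 then z else 1.
Proof.
rewrite /clip; case: (leP z 1) => z1; case: (leP z 0) => z0 //.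
  by have := lt_le_trans z1 z0; rewrite ltr10.
by apply/max_idPr; exact: ler01.
Qed.

Lemma clip_lip x y : `|clip x - clip y| <= `|x - y|.
Proof.
have h1 := ler_norm (x - y); have h2 := ler_norm (y - x); rewrite distrC in h2.
rewrite !clipE ler_norml.
by case: (leP x 0); case: (leP y 0); case: (leP x 1); case: (leP y 1); lra.
Qed.

Lemma measurable_clip (g : T' -> R) : measurable_fun setT g ->
  measurable_fun setT (clip \o g).
Proof.
move=> mg; apply: measurableT_comp => //.
apply: nondecreasing_measurable => // x y xy.
rewrite !clipE.
by case: (leP x 0); case: (leP y 0); case: (leP x 1); case: (leP y 1); lra.
Qed.

Lemma cond_prob_ae01 (E : set T) (g : T' -> R) : measurable E ->
  is_cond_prob P W E g -> {ae P, forall w, 0 <= g (W w) <= 1}.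
Proof.
move=> mE hg.
have c0 : is_cond_prob P W set0 (cst 0).
  split; [exact: measurable_cst| |].
    exact: (bm_integrable P measurableT (bm_cst _ 0)).
  by move=> B mB; rewrite set0I measure0 integral0.
have c1 : is_cond_prob P W setT (cst 1).
  split; [exact: measurable_cst| |].
    exact: (bm_integrable P measurableT (bm_cst _ 1)).
  move=> B mB; rewrite setTI -[RHS]mul1e.
  by rewrite -(integral_cst P (measurable_preimage mW mB) 1%E).
have h1 : {ae P, forall w, (cst 0 : T' -> R) (W w) <= g (W w)}.
  by apply: (cond_prob_ae_le c0 hg) => B mB; rewrite set0I measure0.
have h2 : {ae P, forall w, g (W w) <= (cst 1 : T' -> R) (W w)}.
  apply: (cond_prob_ae_le hg c1) => B mB; apply: le_measure; rewrite ?inE.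
  - by apply: measurableI => //; exact: measurable_preimage.
  - by rewrite setTI; exact: measurable_preimage.
  - exact: setSI.
by apply: filterS2 h1 h2 => w /= -> ->.
Qed.

Lemma is_cond_prob_clip (E : set T) (g : T' -> R) : measurable E ->
  is_cond_prob P W E g -> is_cond_prob P W E (clip \o g).
Proof.
move=> mE hg; have [mg ig h] := hg.
have mc := measurable_clip mg.
split=> //.
  apply: (bm_integrable P measurableT (f := fun w => clip (g (W w)))).
  by apply: (bm_comp (f := clip \o g)) => //; apply: bm01 => // x; exact: clip01.
move=> B mB; rewrite -h//.
have mD : measurable (W @^-1` B) by exact: measurable_preimage.
apply: ae_eq_integral => //.
- by apply/measurable_EFinP; apply: measurable_funTS; exact: measurableT_comp.
- by apply/measurable_EFinP; apply: measurable_funTS; exact: measurableT_comp.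
- apply: filterS (cond_prob_ae01 mE hg) => w hw _ /=.
  by rewrite clip_id.
Qed.

Lemma cond_prob_version (E : set T) : measurable E -> exists g : T' -> R,
  [/\ measurable_fun setT g, forall x, 0 <= g x <= 1 & is_cond_prob P W E g].
Proof.
move=> mE.
pose W' : {mfun T >-> T'} := HB.pack W (isMeasurableFun.Build _ _ _ _ _ mW).
have [g hg] := is_cond_prob_exists P W' mE.
exists (clip \o g); split; last exact: (is_cond_prob_clip mE hg).
- by apply: measurable_clip; have [] := hg.
- by move=> x; exact: clip01.
Qed.

Lemma cond_prob_ae_version (E : set T) (g : T' -> R) : measurable E ->
  is_cond_prob P W E g -> {ae P, forall w, cond_prob P W E w = g (W w)}.
Proof.
move=> mE hg; rewrite /cond_prob; apply: (cond_prob_ae_eq _ hg).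
by apply: (@xgetPex _ (cst 0) [set g | is_cond_prob P W E g]); exists g.
Qed.

End cond_prob_versions.

(** * The population quantities *)

Section cond_prob_EE.
Context d d' (T : measurableType d) (T' : measurableType d') (R : realType).
Context (P : probability T R) (W : T -> T') (E : set T).
Hypotheses (mW : measurable_fun setT W) (mE : measurable E).

Let bind B : measurable B -> bm (fun w => \1_B (W w) : R).
Proof. by move=> mB; apply: bm_comp => //; exact: bm_indic. Qed.

Lemma is_cond_probP (g : T' -> R) : measurable_fun setT g ->
  (forall x, 0 <= g x <= 1) ->
  is_cond_prob P W E g <->
  forall B, measurable B ->
    EE P (fun w => \1_E w * \1_B (W w)) = EE P (fun w => g (W w) * \1_B (W w)).
Proof.
move=> mg g01; have bg : bm (fun w => g (W w)) by apply: bm_comp => //; exact: bm01.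
have e1 B : measurable B -> P (E `&` W @^-1` B) = (EE P (fun w => \1_E w * \1_B (W w)))%:E.
  move=> mB; have mWB : measurable (W @^-1` B) by exact: measurable_preimage.
  have mEB : measurable (E `&` W @^-1` B) by exact: measurableI.
  rewrite -prE// -EE_indic//; congr (EE _ _)%:E; apply/funext => w.
  by rewrite !indicE in_setI -natrM mulnb.
have e2 B : measurable B -> (\int[P]_(w in W @^-1` B) (g (W w))%:E =
    (EE P (fun w => g (W w) * \1_B (W w)))%:E)%E.
  move=> mB; rewrite -(EE_EFin P (measurable_preimage mW mB) bg).
  by congr (EE _ _)%:E; apply/funext => w; rewrite mulrC.
split=> [[_ _ h] B mB|h]; first by apply: EFin_inj; rewrite -e1// -e2// h.
split=> //; first exact: bm_integrable.
by move=> B mB; rewrite e2// e1// h.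
Qed.

(** Functions of W can be taken out of what is conditioned on W. *)
Lemma cond_prob_pull_out (g h : T' -> R) : measurable_fun setT g ->
  (forall x, 0 <= g x <= 1) -> is_cond_prob P W E g ->
  measurable_fun setT h -> (forall x, 0 <= h x <= 1) ->
  EE P (fun w => \1_E w * h (W w)) = EE P (fun w => g (W w) * h (W w)).
Proof.
move=> mg g01 hg mh h01; apply: EE_transfer => //.
- exact: bm_indic.
- by apply: bm_comp => //; exact: bm01.
- by apply/is_cond_probP.
Qed.

End cond_prob_EE.

Lemma EE_ae_le d (T : measurableType d) (R : realType) (P : probability T R)
    (f g : T -> R) : bm f -> bm g -> {ae P, forall w, f w <= g w} -> EE P f <= EE P g.
Proof.
move=> bf bg fg; have bmax : bm (fun w => Num.max (f w) (g w)).
  have [mf [M hM]] := bf; have [mg [N hN]] := bg.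
  split; first exact: measurable_maxr.
  exists (M + N) => w; have := hM w; have := hN w.
  have := normr_ge0 (f w); have := normr_ge0 (g w).
  by case: (leP (f w) (g w)); lra.
rewrite -(EE_ae_eq bmax bg); last first.
  by apply: filterS fg => w /max_idPr.
by apply: le_EE => // w; rewrite le_max lexx.
Qed.

Section population_quantities.
Context d (T : measurableType d) (R : realType) (P : probability T R).
Context (p : nat) (Y : {RV P >-> R}) (X : {RV P >-> p.-tuple R}).
Implicit Types S : {set 'I_p}.

Lemma measurable_subvecX S : measurable_fun setT (subvec S \o X).
Proof. by apply: measurableT_comp; [exact: measurable_subvec|exact: measurable_funP]. Qed.

Arguments measurable_subvecX S : clear implicits.

(** A version of P(Y >= t | X_S) with values in the unit interval. *)
Definition version S t : #|S|.-tuple R -> R :=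
  sval (cid (cond_prob_version P (measurable_subvecX S) (measurable_ge_rv Y t))).

Arguments version S t : clear implicits.

Lemma versionP S t : [/\ measurable_fun setT (version S t),
  forall x, 0 <= version S t x <= 1 &
  is_cond_prob P (subvec S \o X) [set w | (t <= Y w)%R] (version S t)].
Proof. by rewrite /version; case: cid. Qed.

(** The second moment of P(Y >= t | X_S), as a function of t. *)
Definition curve S t : R := EE P (fun w => version S t (subvec S (X w)) ^+ 2).

Definition surv t : R := pr P [set w | (t <= Y w)%R].

Let bm_version (m : nat) (W : T -> m.-tuple R) (g : m.-tuple R -> R) :
  measurable_fun setT W -> measurable_fun setT g -> (forall x, 0 <= g x <= 1) ->
  bm (fun w => g (W w)) /\ bm (fun w => g (W w) ^+ 2).
Proof.
move=> mW mg g01; have b : bm (fun w => g (W w)) by apply: bm_comp => //; exact: bm01.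
by split=> //; under eq_fun do rewrite expr2; exact: bmM.
Qed.

Lemma curveE S t (g : #|S|.-tuple R -> R) : measurable_fun setT g ->
  (forall x, 0 <= g x <= 1) ->
  is_cond_prob P (subvec S \o X) [set w | (t <= Y w)%R] g ->
  EE P (fun w => g (subvec S (X w)) ^+ 2) = curve S t.
Proof.
move=> mg g01 hg; have [mv v01 hv] := versionP S t.
apply: EE_ae_eq.
- by have [] := bm_version (measurable_subvecX S) mg g01.
- by have [] := bm_version (measurable_subvecX S) mv v01.
- by apply: filterS (cond_prob_ae_eq (measurable_subvecX S) hg hv) => w /= ->.
Qed.

Lemma EE_version S t : EE P (fun w => version S t (subvec S (X w))) = surv t.
Proof.
have [mv v01 hv] := versionP S t.
have := (is_cond_probP P (measurable_subvecX S) (measurable_ge_rv Y t) mv v01).1 hv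
  setT measurableT.
rewrite indicT => e; transitivity (EE P (fun w => version S t (subvec S (X w)) * cst 1 (subvec S (X w)))).
  by congr EE; apply/funext => w; rewrite /= mulr1.
rewrite -[LHS]e /surv -EE_indic; last exact: measurable_ge_rv.
by congr EE; apply/funext => w; rewrite /= mulr1.
Qed.

Lemma surv01 t : 0 <= surv t <= 1.
Proof. by rewrite pr_ge0 pr_le1//; exact: measurable_ge_rv. Qed.

Lemma surv_noninc s t : s <= t -> surv t <= surv s.
Proof.
move=> st; apply: le_pr; [exact: measurable_ge_rv|exact: measurable_ge_rv|].
by move=> w /=; exact: le_trans.
Qed.

Lemma curve_le_surv S t : 0 <= curve S t <= surv t.
Proof.
have [mv v01 hv] := versionP S t.
have [b1 b2] := bm_version (measurable_subvecX S) mv v01.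
apply/andP; split; first by apply: EE_ge0 => w; rewrite sqr_ge0.
rewrite -(EE_version S); apply: le_EE => // w.
have /andP[v0 v1] := v01 (subvec S (X w)).
by rewrite expr2 ler_piMl.
Qed.

Lemma curve01 S t : 0 <= curve S t <= 1.
Proof.
have /andP[c0 c1] := curve_le_surv S t; have /andP[_ s1] := surv01 t.
by rewrite c0 (le_trans c1).
Qed.

Lemma curve_noninc S s t : s <= t -> curve S t <= curve S s.
Proof.
move=> st; have [ms s01 hs] := versionP S s; have [mt t01 ht] := versionP S t.
have [_ b1] := bm_version (measurable_subvecX S) ms s01.
have [_ b2] := bm_version (measurable_subvecX S) mt t01.
have ae_le : {ae P, forall w, version S t ((subvec S \o X) w) <=
    version S s ((subvec S \o X) w)}.
  apply: (cond_prob_ae_le (measurable_subvecX S) ht hs) => B mB.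
  have mWB := measurable_preimage (measurable_subvecX S) mB.
  apply: le_measure; rewrite ?inE.
  - by apply: measurableI => //; exact: measurable_ge_rv.
  - by apply: measurableI => //; exact: measurable_ge_rv.
  - by apply: setSI => w /=; exact: le_trans.
apply: EE_ae_le => //; apply: filterS ae_le => w /= h.
have /andP[v0 v1] := t01 (subvec S (X w)).
by rewrite ler_pXn2r ?nnegrE// (le_trans v0).
Qed.

Lemma variance_cond_prob S t :
  variance P (cond_prob P (subvec S \o X) [set w | (t <= Y w)%R]) =
  (curve S t - surv t ^+ 2)%:E.
Proof.
have [mv v01 hv] := versionP S t.
have [b1 b2] := bm_version (measurable_subvecX S) mv v01.
have ae_v := cond_prob_ae_version (measurable_subvecX S) (measurable_ge_rv Y t) hv.
set c := cond_prob _ _ _ in ae_v *.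
have mc : measurable_fun setT c.
  apply: measurableT_comp; last exact: measurable_subvecX.
  have : is_cond_prob P (subvec S \o X) [set w | (t <= Y w)%R] (xget (cst 0)
      [set g | is_cond_prob P (subvec S \o X) [set w | (t <= Y w)%R] g]).
    by apply: (@xgetPex _ (cst 0) [set g | is_cond_prob P (subvec S \o X) [set w | (t <= Y w)%R] g]); exists (version S t).
  by case.
pose v w := version S t (subvec S (X w)).
have fE (f : R -> R) : measurable_fun setT f -> bm (fun w => f (v w)) ->
    (\int[P]_w (f (c w))%:E = (EE P (fun w => f (v w)))%:E)%E.
  move=> mf bf; transitivity (\int[P]_w (f (v w))%:E)%E.
    apply: ae_eq_integral => //.
    - by apply/measurable_EFinP; exact: measurableT_comp.
    - by apply/measurable_EFinP; exact: (bm_measurable bf).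
    - by apply: filterS ae_v => w -> _.
  rewrite /EE /Rintegral fineK//; apply: integrable_fin_num => //.
  exact: bm_integrable.
have Ec : (fine ('E_P[c])%E) = surv t.
  rewrite unlock (fE id)//= -(EE_version S)//.
rewrite /variance unlock Ec unlock.
pose f x := (x - surv t) * (x - surv t).
have mf : measurable_fun setT f.
  by apply: measurable_funM; apply: measurable_funB => //; exact: measurable_cst.
have bf : bm (fun w => f (v w)).
  by apply: bmM; apply: bmB => //; exact: bm_cst.
rewrite -[LHS]/(\int[P]_w (f (c w))%:E)%E fE//; congr EFin.
have -> : (fun w => f (v w)) =
    (fun w => v w ^+ 2 - (2 * surv t) * v w + surv t ^+ 2).
  by apply/funext => w; rewrite /f; ring.
rewrite EED; [|by apply: bmB => //; exact: bmZ|exact: bm_cst].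
rewrite EEB//; last exact: bmZ.
by rewrite EEZ// EE_cst EE_version -/(curve S t); ring.
Qed.

Definition Qval S : R := if S == finset.set0 then 0 else
  EE P (fun w => curve S (Y w)) - EE P (fun w => surv (Y w) ^+ 2).

Lemma bm_curve S : bm (fun w => curve S (Y w)).
Proof. by apply: bm_noninc; [exact: curve01|exact: curve_noninc]. Qed.

Lemma bm_surv2 : bm (fun w => surv (Y w) ^+ 2).
Proof.
have b : bm (fun w => surv (Y w)) by apply: bm_noninc; [exact: surv01|exact: surv_noninc].
by under eq_fun do rewrite expr2; exact: bmM.
Qed.

Lemma QpopE S : Qpop Y X S = (Qval S)%:E.
Proof.
rewrite /Qpop /Qval; case: eqP => // _.
under eq_integral do rewrite variance_cond_prob.
have mcs : measurable_fun setT (fun t => (curve S t - surv t ^+ 2)%:E).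
  apply/measurable_EFinP; apply: measurable_funB.
    by apply: nonincreasing_measurable => // s t; exact: curve_noninc.
  apply: measurable_funX; apply: nonincreasing_measurable => // s t.
  exact: surv_noninc.
have b : bm (fun w => curve S (Y w) - surv (Y w) ^+ 2).
  by apply: bmB; [exact: bm_curve|exact: bm_surv2].
rewrite integral_distribution//; last exact: (bm_integrable P measurableT b).
rewrite -EEB; [|exact: bm_curve|exact: bm_surv2].
rewrite /EE /Rintegral fineK//; apply: integrable_fin_num => //.
exact: (bm_integrable P measurableT b).
Qed.

Lemma Qval_le S : Qval S <= 1/4.
Proof.
rewrite /Qval; case: eqP => [_|_]; first by rewrite divr_ge0.
rewrite -EEB; [|exact: bm_curve|exact: bm_surv2].
rewrite -(EE_cst P (1/4)); apply: le_EE.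
- by apply: bmB; [exact: bm_curve|exact: bm_surv2].
- exact: bm_cst.
move=> w; have /andP[_ h] := curve_le_surv S (Y w).
have := sqr_ge0 (surv (Y w) - 1/2); rewrite expr2; nra.
Qed.

(** * Supersets of sufficient sets are sufficient *)

(** For a sufficient S, P(Y in A | X) is a function of X_S. The identity is first
    obtained for rectangles, which split into a condition on X_S and one on its
    complement; there it is the conditional independence. *)
Lemma sufficient_version S : sufficient Y X S -> forall A, measurable A ->
  exists g : #|S|.-tuple R -> R, [/\ measurable_fun setT g, forall x, 0 <= g x <= 1 &
    forall D, measurable D -> EE P (fun w => \1_(Y @^-1` A) w * \1_D (X w)) =
      EE P (fun w => g (subvec S (X w)) * \1_D (X w))].
Proof.
move=> suff A mA.
have mYA : measurable (Y @^-1` A) by exact: measurable_preimage.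
move: suff; rewrite /sufficient; case: eqP => [S0 ind|_ ci].
  exists (cst (pr P (Y @^-1` A))); split; first exact: measurable_cst.
    by move=> x /=; rewrite pr_ge0 pr_le1.
  move=> D mD; have mXD : measurable (X @^-1` D) by exact: measurable_preimage.
  rewrite EEZ; last exact: (bm_indic R mXD).
  rewrite (EE_indic P mXD) -[LHS]/(EE P (fun w => \1_(Y @^-1` A) w * \1_(X @^-1` D) w)).
  transitivity (EE P (\1_(Y @^-1` A `&` X @^-1` D))).
    by congr EE; apply/funext => w; rewrite !indicE in_setI -natrM mulnb.
  rewrite EE_indic; last exact: measurableI.
  by apply: EFin_inj; rewrite EFinM !prE//; [exact: ind|exact: measurableI].
have mS := measurable_subvecX S; have mSc := measurable_subvecX (~: S).
have [gA [mgA gA01 hgA]] := cond_prob_version P mS mYA.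
exists gA; split=> //.
have bgA : bm (fun w => gA (subvec S (X w))).
  by apply: (bm_comp (f := gA) (W := subvec S \o X)) => //; exact: bm01.
apply: EE_rectangles => //; first exact: bm_indic.
  by move=> w; have /andP[] := gA01 (subvec S (X w)).
move=> B mB.
pose E : set (#|S|.-tuple R) := rectangle (fun i => B (enum_val i)).
pose F : set (#|~: S|.-tuple R) := rectangle (fun i => B (enum_val i)).
have mE : measurable E by apply: measurable_rectangle.
have mF : measurable F by apply: measurable_rectangle.
have rectE w : \1_(rectangle B) (X w) = \1_F (subvec (~: S) (X w)) * \1_E (subvec S (X w)) :> R.
  rewrite !indicE -natrM mulnb; congr (nat_of_bool _)%:R; apply/idP/andP; rewrite !inE.
    by move=> h; split=> i; rewrite tnth_mktuple; exact: h.
  move=> [hF hE] i; case: (boolP (i \in S)) => iS.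
    by have := hE (enum_rank_in iS i); rewrite tnth_mktuple enum_rankK_in.
  have iSc : i \in ~: S by rewrite inE.
  by have := hF (enum_rank_in iSc i); rewrite tnth_mktuple enum_rankK_in.
pose XF := (subvec (~: S) \o X) @^-1` F.
have mXF : measurable XF by exact: measurable_preimage.
have mYF : measurable (Y @^-1` A `&` XF) by exact: measurableI.
have [gF [mgF gF01 hgF]] := cond_prob_version P mS mXF.
have [gAF [mgAF gAF01 hgAF]] := cond_prob_version P mS mYF.
have aeq : {ae P, forall w, gAF (subvec S (X w)) =
    gA (subvec S (X w)) * gF (subvec S (X w))}.
  have h1 := cond_prob_ae_version mS mYF hgAF.
  have h2 := cond_prob_ae_version mS mYA hgA.
  have h3 := cond_prob_ae_version mS mXF hgF.
  have h4 := ci A F mA mF.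
  apply: filterS (filterI (filterI h1 h2) (filterI h3 h4)) => w /= -[[e1 e2] [e3 e4]].
  by rewrite -e1 -e2 -e3 -e4.
have bv (g : #|S|.-tuple R -> R) : measurable_fun setT g -> (forall x, 0 <= g x <= 1) ->
    bm (fun w => g (subvec S (X w))).
  by move=> mg g01; apply: (bm_comp (f := g) (W := subvec S \o X)) => //; exact: bm01.
have bE : bm (fun w => \1_E (subvec S (X w)) : R).
  by apply: (bm_comp (W := subvec S \o X)) => //; exact: bm_indic.
transitivity (EE P (fun w => \1_(Y @^-1` A `&` XF) w * \1_E (subvec S (X w)))).
  congr EE; apply/funext => w; rewrite rectE mulrA; congr (_ * _).
  by rewrite !indicE in_setI -natrM mulnb.
rewrite (((is_cond_probP P mS mYF mgAF gAF01).1 hgAF) E mE).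
transitivity (EE P (fun w => gF (subvec S (X w)) * (gA (subvec S (X w)) * \1_E (subvec S (X w))))).
  apply: EE_ae_eq.
  - by apply: bmM => //; exact: bv.
  - by apply: bmM; [exact: bv|exact: bmM].
  - by apply: filterS aeq => w /= ->; rewrite mulrA [gF _ * _]mulrC.
pose h x := gA x * \1_E x.
have mh : measurable_fun setT h by apply: measurable_funM => //; exact: measurable_indic.
have h01 x : 0 <= h x <= 1.
  by rewrite /h indicE; case: (_ \in _); rewrite ?mulr1 ?mulr0 ?lexx ?ler01.
rewrite -(cond_prob_pull_out mS mXF mgF gF01 hgF mh h01) /h.
congr EE; apply/funext => w; rewrite rectE mulrCA; congr (_ * _).
Qed.

(** The function of X_S given by sufficient_version is a function of X_S', so it
    can be taken out of the conditioning on X_S'. *)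
Lemma sufficientS S S' : S \subset S' -> sufficient Y X S -> sufficient Y X S'.
Proof.
move=> SS' suff; have [S'0|S'n0] := eqVneq S' finset.set0.
  suff -> : S' = S by [].
  by apply/eqP; rewrite finset.eqEsubset SS' S'0 finset.sub0set.
rewrite /sufficient (negbTE S'n0) => A B mA mB.
have mYA : measurable (Y @^-1` A) by exact: measurable_preimage.
have [g [mg g01 hg]] := sufficient_version suff mA.
have mS' := measurable_subvecX S'.
(* the projection from the coordinates in S' to those in S *)
have S'S (i : 'I_#|S|) : enum_val i \in S' by apply: (fintype.subsetP SS'); exact: enum_valP.
pose proj (z : #|S'|.-tuple R) : #|S|.-tuple R :=
  [tuple tnth z (enum_rank_in (S'S i) (enum_val i)) | i < #|S|].
have projE x : proj (subvec S' x) = subvec S x.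
  apply: eq_from_tnth => i; rewrite !tnth_mktuple enum_rankK_in//.
have mproj : measurable_fun setT proj.
  apply/measurable_fun_tnthP => i.
  rewrite (_ : _ \o _ = fun z => tnth z (enum_rank_in (S'S i) (enum_val i))).
    exact: measurable_tnth.
  by apply/funext => z /=; rewrite tnth_mktuple.
pose g' := g \o proj.
have mg' : measurable_fun setT g' by exact: measurableT_comp.
have g'01 x : 0 <= g' x <= 1 by exact: g01.
have hg' : is_cond_prob P (subvec S' \o X) (Y @^-1` A) g'.
  apply/is_cond_probP => // D mD.
  have := hg (subvec S' @^-1` D) (measurable_preimage (@measurable_subvec R p S') mD).
  by rewrite /g' /=; under [in X in _ -> _ = X]eq_fun do rewrite projE.
pose V := (subvec (~: S') \o X) @^-1` B.
have mV : measurable V by exact: measurable_preimage (measurable_subvecX (~: S')) mB.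
have mYV : measurable (Y @^-1` A `&` V) by exact: measurableI.
have [gV [mgV gV01 hgV]] := cond_prob_version P mS' mV.
have hprod : is_cond_prob P (subvec S' \o X) (Y @^-1` A `&` V) (fun x => g' x * gV x).
  apply/is_cond_probP => //.
  - exact: measurable_funM.
  - move=> x; have /andP[a0 a1] := g'01 x; have /andP[b0 b1] := gV01 x.
    by rewrite mulr_ge0//= mulr_ile1.
  move=> D mD.
  pose h x := g' x * \1_D x.
  have mh : measurable_fun setT h by apply: measurable_funM => //; exact: measurable_indic.
  have h01 x : 0 <= h x <= 1.
    by rewrite /h indicE; case: (_ \in _); rewrite ?mulr1 ?mulr0 ?lexx ?ler01.
  have := cond_prob_pull_out mS' mV mgV gV01 hgV mh h01; rewrite /h /= => e.
  transitivity (EE P (fun w => gV (subvec S' (X w)) * (g' (subvec S' (X w)) * \1_D (subvec S' (X w))))); last first.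
    by congr EE; apply/funext => w /=; rewrite mulrA [gV _ * _]mulrC.
  rewrite -e.
  have mDV : measurable (subvec (~: S') @^-1` B `&` subvec S' @^-1` D).
    by apply: measurableI; apply: measurable_preimage => //; exact: measurable_subvec.
  have := hg _ mDV => e'.
  transitivity (EE P (fun w => \1_(Y @^-1` A) w *
      \1_(subvec (~: S') @^-1` B `&` subvec S' @^-1` D) (X w))).
    by congr EE; apply/funext => w; rewrite !indicE !in_setI -!natrM !mulnb andbA.
  rewrite e'; congr EE; apply/funext => w; rewrite mulrCA /g' /= projE; congr (_ * _).
  by rewrite !indicE in_setI -natrM mulnb.
have h1 := cond_prob_ae_version mS' mYV hprod.
have h2 := cond_prob_ae_version mS' mYA hg'.
have h3 := cond_prob_ae_version mS' mV hgV.
apply: filterS (filterI h1 (filterI h2 h3)) => w /= -[e1 [e2 e3]].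
by rewrite e1 e2 e3.
Qed.

End population_quantities.

(** * The rank statistics and the selection *)

Section rank_statistics.
Context (R : realType) (n p : nat) (y : 'I_n -> R).
Implicit Types (S : {set 'I_p}) (N : {set 'I_p} -> 'I_n -> 'I_n).

Definition edge_surv (nu : 'I_n -> 'I_n) (t : R) : R :=
  n%:R^-1 * \sum_i ((t <= y i)%R)%:R * ((t <= y (nu i))%R)%:R.

Definition sqr_surv (t : R) : R := (n%:R^-1 * \sum_i ((t <= y i)%R)%:R) ^+ 2.

Lemma card_sum_bool (b : 'I_n -> bool) : (#|[set k | b k]%SET|%:R : R) = \sum_k (b k)%:R.
Proof.
rewrite -sum1_card natr_sum big_mkcond /=; apply: eq_bigr => k _.
by rewrite inE; case: (b k).
Qed.

Lemma minrankE N S i : (minrank y N S i)%:R =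
  \sum_k ((y k <= y i)%R)%:R * ((y k <= y (N S i))%R)%:R :> R.
Proof.
have sub (a b : 'I_n) : y a <= y b ->
    [set j | y j <= y a]%SET \subset [set j | y j <= y b]%SET.
  by move=> ab; apply/fintype.subsetP => j; rewrite !inE => /le_trans; apply.
have cardI : minrank y N S i = #|[set k | (y k <= y i)%R && (y k <= y (N S i))%R]%SET|.
  rewrite /minrank /rank; case: (leP (y i) (y (N S i))) => h.
    rewrite (minn_idPl _); last exact: subset_leq_card (sub _ _ h).
    by apply: eq_card => k; rewrite !inE andb_idr// => /le_trans; apply.
  rewrite (minn_idPr _); last exact: subset_leq_card (sub _ _ (ltW h)).
  by apply: eq_card => k; rewrite !inE andb_idl// => /le_trans; apply; exact: ltW.
rewrite cardI card_sum_bool; apply: eq_bigr => k _.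
by rewrite -natrM mulnb.
Qed.

(** Counting the pairs (k, i) with Y_k at most Y_i and Y_N(i). *)
Lemma sum_minrank N S : (0 < n)%N ->
  \sum_i (minrank y N S i)%:R = n%:R ^+ 2 * (n%:R^-1 * \sum_k edge_surv (N S) (y k)) :> R.
Proof.
move=> n0; have nn : n%:R != 0 :> R by rewrite pnatr_eq0 -lt0n.
under eq_bigr do rewrite minrankE.
rewrite exchange_big /= /edge_surv -mulr_sumr expr2 mulrA mulfK// mulVKf//.
Qed.

Lemma sum_sqr_corank : (0 < n)%N ->
  \sum_i ((corank y i)%:R : R) ^+ 2 = n%:R ^+ 3 * (n%:R^-1 * \sum_k sqr_surv (y k)).
Proof.
move=> n0; have nn : n%:R != 0 :> R by rewrite pnatr_eq0 -lt0n.
rewrite /sqr_surv; under [in RHS]eq_bigr do rewrite exprMn.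
rewrite -mulr_sumr; under eq_bigr do rewrite /corank card_sum_bool.
have e (x : R) : n%:R ^+ 3 * (n%:R^-1 * (n%:R^-1 ^+ 2 * x)) = x by field.
by rewrite e.
Qed.

Lemma avg01 (F : 'I_n -> R) : (forall i, 0 <= F i <= 1) ->
  0 <= n%:R^-1 * \sum_i F i <= 1.
Proof.
move=> F01; rewrite mulr_ge0 ?invr_ge0 ?sumr_ge0//=; last first.
  by move=> i _; have /andP[] := F01 i.
have [n0|n0] := posnP n.
  have -> : n%:R = 0 :> R by rewrite n0.
  by rewrite invr0 mul0r ler01.
rewrite mulrC ler_pdivrMr ?ltr0n// mul1r.
rewrite -[X in _ <= X%:R]card_ord -sum1_card natr_sum; apply: ler_sum => i _.
by have /andP[] := F01 i.
Qed.

Lemma edge_surv01 nu t : 0 <= edge_surv nu t <= 1.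
Proof.
apply: avg01 => i; case: (t <= y i); case: (t <= y (nu i));
  by rewrite /= ?mulr1 ?mulr0 ?ler01 ?lexx.
Qed.

Lemma le_indic_ray (s t x : R) : s <= t -> ((t <= x)%R)%:R <= ((s <= x)%R)%:R :> R.
Proof.
move=> st; case: (boolP (t <= x)) => [tx|_]; first by rewrite (le_trans st tx).
exact: ler0n.
Qed.

Lemma edge_surv_noninc nu s t : s <= t -> edge_surv nu t <= edge_surv nu s.
Proof.
move=> st; rewrite /edge_surv ler_wpM2l ?invr_ge0//; apply: ler_sum => i _.
by apply: ler_pM => //; exact: le_indic_ray.
Qed.

Lemma freq_surv01 t : 0 <= (n%:R^-1 * \sum_i ((t <= y i)%R)%:R : R) <= 1.
Proof.
by apply: avg01 => i; case: (t <= y i); rewrite /= ?ler01 ?lexx.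
Qed.

Lemma sqr_surv01 t : 0 <= sqr_surv t <= 1.
Proof.
have /andP[a b] := freq_surv01 t.
by rewrite /sqr_surv exprn_ge0//= exprn_ile1.
Qed.

Lemma sqr_surv_noninc s t : s <= t -> sqr_surv t <= sqr_surv s.
Proof.
move=> st; have /andP[a _] := freq_surv01 t; have /andP[b _] := freq_surv01 s.
rewrite /sqr_surv ler_pXn2r ?nnegrE// ler_wpM2l ?invr_ge0//; apply: ler_sum => i _.
exact: le_indic_ray.
Qed.

Lemma corank_le i : (corank y i <= n)%N.
Proof. by rewrite -[leqRHS]card_ord max_card. Qed.

Lemma Tn_den_ge0 N S : 0 <= Tn_den y N S.
Proof.
rewrite /Tn_den; case: eqP => _; apply: sumr_ge0 => i _.
  by rewrite mulr_ge0// subr_ge0 ler_nat corank_le.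
by rewrite subr_ge0 ler_nat geq_minl.
Qed.

Lemma sum_rank_corank : \sum_i (rank y i)%:R = \sum_i (corank y i)%:R :> R.
Proof.
under eq_bigr do rewrite /rank card_sum_bool.
by rewrite exchange_big /=; apply: eq_bigr => i _; rewrite /corank card_sum_bool.
Qed.

(** The numerator is the denominator with minima of ranks in place of some
    ranks; in particular it is nonpositive where T_n is undefined. *)
Lemma Tn_num_le_den N S j : Tn_num y N S j <= Tn_den y N S.
Proof.
rewrite /Tn_num /Tn_den; case: eqP => _; last first.
  by apply: ler_sum => i _; rewrite lerD2r ler_nat geq_minl.
apply: (@le_trans _ _ (\sum_i (n%:R * (rank y i)%:R - (corank y i)%:R ^+ 2))).
  by apply: ler_sum => i _; rewrite lerD2r ler_wpM2l// ler_nat geq_minl.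
rewrite sumrB -mulr_sumr sum_rank_corank mulr_sumr -sumrB.
apply: ler_sum => i _; rewrite expr2; nra.
Qed.

End rank_statistics.

Section selection.
Context (R : realType) (p K : nat) (delta : R).
Context (suff : {set 'I_p} -> Prop) (Q : {set 'I_p} -> R).
Context (num : {set 'I_p} -> 'I_p -> R) (den sc : {set 'I_p} -> R).
Implicit Types S : {set 'I_p}.
Hypothesis d0 : 0 < delta.
Hypothesis suffS : forall S S', S \subset S' -> suff S -> suff S'.
Hypothesis gap : forall S, ~ suff S ->
  exists2 j, j \notin S & Q S + delta <= Q (j |: S)%SET.
Hypothesis Q_le : forall S, Q S <= 1/4.
Hypothesis sizeK : forall m : nat, m%:R * (delta / 2) <= 1/4 -> (m < K)%N.
Hypothesis den_ge0 : forall S, 0 <= den S.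
Hypothesis num_le : forall S j, num S j <= den S.
Hypothesis sc_gt0 : forall S, 0 < sc S.
Hypothesis num_close : forall S j, j \notin S -> (#|S| < K)%N ->
  `|num S j - sc S * (Q (j |: S)%SET - Q S)| <= sc S * (delta / 4).

(** Each selected index increases Q by at least delta / 2 as long as the current
    set is insufficient; so the sets in play stay small, the estimates apply to
    them, and a nonpositive or undefined T_n at an insufficient set would
    contradict the estimate for the index provided by the gap. *)
Lemma foci_sufficient S Shat :
  foci (fun S j => if den S == 0 then None else Some (num S j / den S)) S Shat ->
  suff S \/ #|S|%:R * (delta / 2) <= Q S -> suff Shat.
Proof.
have suffT : suff [set: 'I_p]%SET.
  by apply: contrapT => /gap[j]; rewrite inE.
have better S0 : ~ suff S0 -> #|S0|%:R * (delta / 2) <= Q S0 -> exists2 j, j \notin S0 &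
    sc S0 * (3 / 4 * delta) <= num S0 j.
  move=> nS qS; have [j jS gj] := gap nS; exists j => //.
  have := num_close jS (sizeK (le_trans qS (Q_le S0))).
  rewrite ler_norml => /andP[h _].
  have : sc S0 * delta <= sc S0 * (Q (j |: S0)%SET - Q S0).
    by rewrite ler_pM2l// lerBrDl.
  have -> : sc S0 * (3 / 4 * delta) = sc S0 * delta - sc S0 * (delta / 4).
    by field.
  lra.
have pos S0 : 0 < sc S0 * (3 / 4 * delta) by rewrite mulr_gt0// mulr_gt0// divr_gt0.
elim=> {S Shat}.
- by [].
- move=> S j t [jS tj tmax] t0 [//|qS]; apply: contrapT => nS.
  have [j' j'S hj'] := better S nS qS.
  have [u] := tmax j' j'S; case: eqP => // /eqP den0 [<-] ut.
  have dp : 0 < den S by rewrite lt_def den0 den_ge0.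
  have : 0 < num S j' / den S by rewrite divr_gt0// (lt_le_trans (pos S)).
  by rewrite ltNge (le_trans ut).
- move=> S j t Shat [jS tj tmax] t0 _ IH inv; apply: IH.
  have [sS|nS] := pselect (suff S).
    by left; apply: suffS sS; exact: finset.subsetUr.
  case: inv => // qS; right.
  have [j' j'S hj'] := better S nS qS.
  have [u] := tmax j' j'S; move: tj; case: eqP => // /eqP den0 [<-] [<-].
  have dp : 0 < den S by rewrite lt_def den0 den_ge0.
  rewrite ler_pM2r ?invr_gt0// => nn.
  have := num_close jS (sizeK (le_trans qS (Q_le S))).
  rewrite ler_norml => /andP[_ h].
  have : sc S * (delta / 2) <= sc S * (Q (j |: S)%SET - Q S).
    have -> : sc S * (delta / 2) = sc S * (3 / 4 * delta) - sc S * (delta / 4).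
      by field.
    lra.
  rewrite ler_pM2l// cardsU1 jS natrD mulrDl mul1r; lra.
- move=> S Shat [j jS]; case: eqP => // dz _ SS inv.
  apply: (suffS SS); apply: contrapT => nS; case: inv => // qS.
  have [j' j'S hj'] := better S nS qS.
  have := lt_le_trans (pos S) (le_trans hj' (num_le S j')).
  by rewrite dz ltxx.
Qed.

End selection.

(** * From the concentration bounds to the selected set *)

(** Divided by this scale, the numerator of T_n is a difference of averages over
    the sample. *)
Definition Tn_scale (R : realType) (n p : nat) (S : {set 'I_p}) : R :=
  if S == finset.set0 then n%:R ^+ 3 else n%:R ^+ 2.

Section good_event.
Context (R : realType) (delta : R).
Context d (T : measurableType d) (P : probability T R).
Context (p : nat) (Y : {RV P >-> R}) (X : {RV P >-> p.-tuple R}).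
Context d' (T' : measurableType d') (P' : probability T' R) (n : nat).
Context (Ys : 'I_n -> {RV P' >-> R}) (Xs : 'I_n -> {RV P' >-> p.-tuple R}).
Context (N : {set 'I_p} -> 'I_n -> T' -> 'I_n).
Hypothesis n0 : (0 < n)%N.
Variable w : T'.

Let y i := Ys i w.
Let nu S i := N S i w.

(** On the event that all the averages are within delta / 8 of their limits, the
    numerator of T_n, divided by n ^ 2, or by n ^ 3 for the empty set, is within
    delta / 4 of the increment of Q. *)
Lemma Tn_num_close (K : nat) :
  (forall S : {set 'I_p}, S != finset.set0 -> (#|S| <= K)%N ->
    `|n%:R^-1 * \sum_k edge_surv y (nu S) (y k) - EE P (fun u => curve Y X S (Y u))|
      <= delta / 8) ->
  `|n%:R^-1 * \sum_k sqr_surv y (y k) - EE P (fun u => surv Y (Y u) ^+ 2)| <= delta / 8 ->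
  forall (S : {set 'I_p}) j, j \notin S -> (#|S| < K)%N ->
  `|Tn_num y nu S j - Tn_scale R n S * (Qval Y X (j |: S)%SET - Qval Y X S)| <=
  Tn_scale R n S * (delta / 4).
Proof.
move=> hS hB S j jS SK; set sc := Tn_scale R n S.
have nn : 0 < n%:R :> R by rewrite ltr0n.
have sc0 : 0 < sc by rewrite /sc /Tn_scale; case: ifP => _; rewrite exprn_gt0.
have jSn0 : (j |: S)%SET != finset.set0.
  by apply/set0Pn; exists j; rewrite finset.setU11.
have jSK : (#|(j |: S)%SET| <= K)%N by rewrite cardsU1 jS.
have h1 := hS _ jSn0 jSK.
have scale (x z : R) : `|x - z| <= delta / 4 -> `|sc * x - sc * z| <= sc * (delta / 4).
  by move=> h; rewrite -mulrBr normrM (gtr0_norm sc0) ler_pM2l.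
have tri (a b c e : R) : `|a - c| <= delta / 8 -> `|b - e| <= delta / 8 ->
    `|(a - b) - (c - e)| <= delta / 4.
  move=> u1 u2; have -> : (a - b) - (c - e) = (a - c) - (b - e) by ring.
  by rewrite (le_trans (ler_normB _ _))//; lra.
rewrite /Qval (negbTE jSn0); move: scale; rewrite /sc /Tn_scale /Tn_num; case: eqP => [S0|/eqP Sn0] scale.
  rewrite subr0 sumrB -mulr_sumr sum_minrank// sum_sqr_corank//.
  have -> : n%:R * (n%:R ^+ 2 * (n%:R^-1 * \sum_k edge_surv y (nu [set j]%SET) (y k))) =
    n%:R ^+ 3 * (n%:R^-1 * \sum_k edge_surv y (nu [set j]%SET) (y k)).
    by rewrite mulrA -exprS.
  rewrite -mulrBr; apply: scale; apply: tri => //.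
  by move: h1; rewrite S0 finset.setU0.
rewrite sumrB !sum_minrank// -mulrBr; apply: scale.
have cancel (c e f : R) : c - f - (e - f) = c - e by ring.
rewrite cancel; apply: tri; first exact: h1.
apply: hS; [exact: Sn0|exact: ltnW].
Qed.

End good_event.

(** The nonempty sets of size at most K are the images of K indices; this makes
    the union bound over them a sum of p ^ K terms. *)
Lemma imset_ord_surj p (K : nat) (S : {set 'I_p}) : S != finset.set0 -> (#|S| <= K)%N ->
  exists f : {ffun 'I_K -> 'I_p}, [set f i | i : 'I_K]%SET = S.
Proof.
move=> /set0Pn[s0 s0S] SK; exists [ffun i : 'I_K => nth s0 (enum S) i].
apply/setP => s; apply/imsetP/idP => [[i _ ->]|sS].
  rewrite ffunE; have [iS|iS] := ltnP i (size (enum S)).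
    by rewrite -mem_enum mem_nth.
  by rewrite nth_default.
have ss : (index s (enum S) < size (enum S))%N by rewrite index_mem mem_enum.
have sK : (index s (enum S) < K)%N by rewrite (leq_trans ss)// -cardE.
by exists (Ordinal sK) => //; rewrite ffunE nth_index ?mem_enum.
Qed.

Section finite_gap.
Context (R : realType) (beta C C1 C2 : R) (delta : R).
Hypotheses (hbeta : 0 <= beta) (hC : 0 <= C) (hC1 : 0 < C1) (hC2 : 0 < C2).
Hypothesis d0 : 0 < delta.

Let K := (Num.truncn (1 / (2 * delta))).+1.

Lemma size_lt_K (m : nat) : m%:R * (delta / 2) <= 1/4 -> (m < K)%N.
Proof.
move=> h; rewrite ltnS truncn_ge_nat; last by rewrite divr_ge0// mulr_ge0// ltW.
rewrite ler_pdivlMr ?mulr_gt0//; move: h; set x := m%:R * _.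
have -> : m%:R * (2 * delta) = 4 * x by rewrite /x; field.
lra.
Qed.

Lemma card_le_K_small p (S : {set 'I_p}) : (#|S| <= K)%N -> small_set delta%:E S.
Proof.
move=> SK; rewrite /small_set inver gt_eqF// -EFinD lee_fin.
apply: (@le_trans _ _ (1 / (2 * delta) + 1)).
  apply: (@le_trans _ _ K%:R); first by rewrite ler_nat.
  rewrite /K -natr1 lerD2r.
  have x0 : 0 <= 1 / (2 * delta) by rewrite divr_ge0// mulr_ge0// ltW.
  by have /andP[] := truncn_itv x0.
have -> : 1 / (2 * delta) = delta^-1 / 2 by field; rewrite gt_eqF.
have : 0 <= delta^-1 by rewrite invr_ge0 ltW.
lra.
Qed.

Lemma lipschitz_growth_clip m (g : m.-tuple R -> R) :
  lipschitz_growth beta C g -> lipschitz_growth beta C (clip (R := R) \o g).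
Proof. by move=> h x x'; exact: le_trans (clip_lip _ _) (h x x'). Qed.

(** The thresholds are k quantiles, with k and eps such that average_close gives
    the error delta / 8. *)
Lemma consistency_finite_gap : exists L1 L2 L3 : R, [/\ 0 < L1, 0 < L2, 0 < L3 &
  forall (d : measure_display) (T : measurableType d) (P : probability T R)
    (p : nat) (Y : {RV P >-> R}) (X : {RV P >-> p.-tuple R}),
  has_gap Y X delta%:E ->
  assumption_A1 Y X delta%:E beta C ->
  assumption_A2 X delta%:E C1 C2 ->
  forall (d' : measure_display) (T' : measurableType d')
    (P' : probability T' R) (n : nat)
    (Ys : 'I_n -> {RV P' >-> R}) (Xs : 'I_n -> {RV P' >-> p.-tuple R})
    (N : {set 'I_p} -> 'I_n -> T' -> 'I_n) (Shat : T' -> {set 'I_p}),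
  (2 <= n)%N ->
  iid_copies Y X Ys Xs ->
  uniform_tie_breaking Ys Xs N ->
  foci_output Ys N Shat ->
  ((1 - L1 * p%:R `^ L2 * expR (- L3 * n%:R))%:E <=
   P' [set w | sufficient Y X (Shat w)])%E].
Proof.
pose e := delta / 16.
have e0 : 0 < e by rewrite divr_gt0.
pose k := (Num.truncn e^-1).+1.
have k0 : (0 < k)%N by [].
have ke : k.+1%:R^-1 <= e.
  rewrite -[leRHS]invrK lef_pV2 ?posrE ?invr_gt0 ?ltr0n//.
  by rewrite (le_trans (ltW (truncnS_gt _)))// ler_nat.
pose q : R := 12 * (3 * k%:R + 1).
have q0 : 0 < q by rewrite mulr_gt0// addr_gt0// mulr_gt0// ltr0n.
pose eps := Num.min 1 (e / q).
have eps0 : 0 < eps by rewrite lt_min ltr01 divr_gt0.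
have eps1 : eps <= 1 by rewrite ge_min lexx.
have epsq : (3 * k%:R + 1) * (12 * eps) <= e.
  have -> : (3 * k%:R + 1) * (12 * eps) = q * eps by rewrite /q; ring.
  by rewrite mulrC -ler_pdivlMr// ge_min lexx orbT.
have [a [b [a0 b0 conc]]] :=
  threshold_concentration_upto hbeta hC hC1 hC2 K eps0 eps1.
pose b' := Num.min b (eps ^+ 2 / 8).
have b'0 : 0 < b' by rewrite lt_min b0 divr_gt0// exprn_gt0.
exists (k%:R * a + 4 * k%:R), K%:R, b'; split=> //; rewrite ?ltr0n//.
  by rewrite addr_gt0// mulr_gt0// ltr0n.
move=> d T P p Y X gap A1 A2 d' T' P' n Ys Xs N Shat n2 iid tie [mShat hShat].
have n0 : (0 < n)%N by exact: leq_trans n2.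
have nn : 0 < n%:R :> R by rewrite ltr0n.
have gapR (S : {set 'I_p}) : ~ sufficient Y X S ->
    exists2 j, j \notin S & Qval Y X S + delta <= Qval Y X (j |: S)%SET.
  by move=> /gap[j jS]; rewrite !QpopE -EFinD lee_fin => h; exists j.
set suffset := [set w | sufficient Y X (Shat w)].
have msuff : measurable suffset.
  rewrite (_ : suffset = [set w | [pred A | `[<sufficient Y X A>]] (Shat w)]).
    exact: (measurable_finite_valued mShat).
  by apply/seteqP; split => w /=; rewrite /suffset /= => /asboolP.
rewrite -prE// lee_fin.
have [p0|p0] := posnP p.
  have -> : suffset = setT.
    apply/seteqP; split => // w _; apply: contrapT => /gapR[j].
    by have := ltn_ord j; rewrite {2}p0.
  rewrite pr_setT gerBl mulr_ge0 ?expR_ge0// mulr_ge0 ?powR_ge0//.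
  by rewrite addr_ge0// mulr_ge0// ltW.
(* the exceptional events: the edge statistics at the quantiles, and the
   frequencies of the half-lines at the quantiles *)
pose im (f : {ffun 'I_K -> 'I_p}) : {set 'I_p} := [set f i | i : 'I_K]%SET.
have im0 f : im f != finset.set0.
  apply/set0Pn; exists (f ord0); apply/imsetP; by exists ord0.
have imK f : (#|im f| <= K)%N by rewrite -[leqRHS]card_ord leq_imset_card.
pose bad1 (f : {ffun 'I_K -> 'I_p}) (i : 'I_k) : set T' := [set w | 12 * eps * n%:R <
  `|\sum_j ((grid Y k i <= Ys j w)%R)%:R * ((grid Y k i <= Ys (N (im f) j w) w)%R)%:R -
    curve Y X (im f) (grid Y k i) * n%:R|].
have h1 f i : measurable (bad1 f i) /\ pr P' (bad1 f i) <= a * expR (- b * n%:R).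
  have [g [hg gL]] := A1 (im f) (card_le_K_small (imK f)) (grid Y k i).
  have mS := @measurable_subvecX _ _ _ P p X (im f).
  have mt := measurable_ge_rv Y (grid Y k i).
  have hc := is_cond_prob_clip mS mt hg.
  have mg : measurable_fun setT (clip (R := R) \o g) by have [] := hc.
  have cg01 z : 0 <= (clip (R := R) \o g) z <= 1 by exact: clip01.
  have := conc _ _ _ _ Y X _ _ P' n Ys Xs N (im f) (grid Y k i) (clip (R := R) \o g)
    iid tie n2 (im0 f) (imK f) mg cg01 hc (lipschitz_growth_clip gL)
    (A2 (im f) (card_le_K_small (imK f))).
  by rewrite (curveE mg cg01 hc).
pose D0 := pair0 Y X; pose D := pairs Ys Xs.
pose E2 (i : 'I_k) (u : R * p.-tuple R) := grid Y k i <= u.1.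
pose E3 (i : 'I_k) (u : R * p.-tuple R) := grid Y k i < u.1.
have mE2 i : measurable [set u | E2 i u].
  by apply: measurable_le_fun => //; exact: measurable_fst.
have mE3 i : measurable [set u | E3 i u].
  rewrite (_ : [set u | E3 i u] = ~` [set u : R * p.-tuple R | (u.1 <= grid Y k i)%R]).
    by apply: measurableC; apply: measurable_le_fun => //; exact: measurable_fst.
  by apply/seteqP; split => u /=; rewrite /E3 ltNge => /negP.
have h2 i := frequency_concentration (measurable_pair0 Y X) (measurable_pairs Ys Xs)
  (indep_pairs iid) (ident_pairs iid) (mE2 i) eps0 eps1.
have h3 i := frequency_concentration (measurable_pair0 Y X) (measurable_pairs Ys Xs)
  (indep_pairs iid) (ident_pairs iid) (mE3 i) eps0 eps1.
pose bad2 i := [set w | eps * n%:R <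
  `|\sum_j (E2 i (D j w))%:R - pr P (D0 @^-1` [set u | E2 i u]) * n%:R|].
pose bad3 i := [set w | eps * n%:R <
  `|\sum_j (E3 i (D j w))%:R - pr P (D0 @^-1` [set u | E3 i u]) * n%:R|].
pose J := ({ffun 'I_K -> 'I_p} * 'I_k + ('I_k + 'I_k))%type.
pose bad (x : J) := match x with
  | inl fi => bad1 fi.1 fi.2 | inr (inl i) => bad2 i | inr (inr i) => bad3 i end.
pose bnd (x : J) : R := match x with
  | inl fi => a * expR (- b * n%:R) | inr _ => 2 * expR (- (eps ^+ 2 / 8) * n%:R) end.
have mbad x : measurable (bad x).
  by case: x => [[f i]|[i|i]] /=; [have [] := h1 f i|have [] := h2 i|have [] := h3 i].
have bbad x : pr P' (bad x) <= bnd x.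
  by case: x => [[f i]|[i|i]] /=; [have [] := h1 f i|have [] := h2 i|have [] := h3 i].
have good w : (forall x, ~ bad x w) -> suffset w.
  move=> nb; pose y i := Ys i w; pose nu S i := N S i w.
  have divn (s c z : R) : `|s - c * n%:R| <= z * n%:R -> `|n%:R^-1 * s - c| <= z.
    move=> h; have -> : n%:R^-1 * s - c = n%:R^-1 * (s - c * n%:R).
      by field; rewrite gt_eqF.
    by rewrite normrM ger0_norm ?invr_ge0// ler_pdivrMl// [leRHS]mulrC.
  have g2 (i : nat) : (i < k)%N -> `|freq y (fun z => grid Y k i <= z) -
      pr P [set u | (grid Y k i <= Y u)%R]| <= eps.
    move=> ik; have := nb (inr (inl (Ordinal ik))) => /negP; rewrite -leNgt => h.
    exact: divn h.
  have g3 (i : nat) : (i < k)%N -> `|freq y (fun z => grid Y k i < z) -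
      pr P [set u | (grid Y k i < Y u)%R]| <= eps.
    move=> ik; have := nb (inr (inr (Ordinal ik))) => /negP; rewrite -leNgt => h.
    exact: divn h.
  have e12 : eps <= 12 * eps by lra.
  have avg A c : (forall z, 0 <= A z <= 1) -> (forall x z, x <= z -> A z <= A x) ->
      (forall z, 0 <= c z <= 1) -> (forall x z, x <= z -> c z <= c x) ->
      (forall i, (i < k)%N -> `|A (grid Y k i) - c (grid Y k i)| <= 12 * eps) ->
      `|n%:R^-1 * \sum_j A (y j) - EE P (fun u => c (Y u))| <= delta / 8.
    move=> A01 An c01 cn Ac.
    have ep : 0 <= 12 * eps by lra.
    have g2' (i : nat) (ik : (i < k)%N) := le_trans (g2 i ik) e12.
    have g3' (i : nat) (ik : (i < k)%N) := le_trans (g3 i ik) e12.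
    apply: (le_trans (average_close k0 n0 A01 An c01 cn ep Ac g2' g3')).
    have -> : delta / 8 = e + e by rewrite /e; field.
    exact: lerD.
  have cl := @Tn_num_close R delta _ _ P p Y X _ T' P' n Ys N n0 w K.
  have sc0 (S : {set 'I_p}) : 0 < Tn_scale R n S.
    by rewrite /Tn_scale; case: ifP => _; rewrite exprn_gt0.
  apply: (@foci_sufficient R p K delta (sufficient Y X) (Qval Y X)
    (Tn_num y nu) (Tn_den y nu) (@Tn_scale R n p)
    d0 _ gapR (Qval_le Y X) size_lt_K (Tn_den_ge0 y nu) (Tn_num_le_den y nu) sc0 _
    finset.set0 (Shat w)).
  - by move=> S S'; exact: sufficientS.
  - apply: cl.
      move=> S Sn0 SK; have [f fS] := imset_ord_surj Sn0 SK.
      apply: (avg (edge_surv y (nu S)) (curve Y X S)).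
      + exact: edge_surv01.
      + by move=> x z; exact: edge_surv_noninc.
      + exact: curve01.
      + by move=> x z; exact: curve_noninc.
      + move=> i ik; have := nb (inl (f, Ordinal ik)) => /negP; rewrite -leNgt => h.
        by rewrite -fS; exact: divn h.
    apply: (avg (sqr_surv y) (fun t => surv Y t ^+ 2)).
    + exact: sqr_surv01.
    + by move=> x z; exact: sqr_surv_noninc.
    + by move=> z; have /andP[s0 s1] := surv01 Y z; rewrite exprn_ge0//= exprn_ile1.
    + move=> x z xz; have /andP[s0 _] := surv01 Y z; have /andP[s2 _] := surv01 Y x.
      by rewrite ler_pXn2r ?nnegrE//; exact: surv_noninc.
    + move=> i ik; have := g2 i ik; rewrite /freq /sqr_surv /surv.
      have := freq_surv01 y (grid Y k i); have := surv01 Y (grid Y k i); rewrite /surv.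
      set x := n%:R^-1 * _; set z := pr P _ => /andP[z0 z1] /andP[x0 x1] xz.
      rewrite subr_sqr normrM.
      have h : `|x + z| <= 2 by rewrite ger0_norm ?addr_ge0//; lra.
      have := ler_pM (normr_ge0 _) (normr_ge0 _) xz h; lra.
  - exact: hShat.
  - right; rewrite finset.cards0 mul0r /Qval eqxx//.
have mC : measurable (~` suffset) by exact: measurableC.
have tot : pr P' (~` suffset) <= \sum_x bnd x.
  apply: (pr_bigcup_le (F := bad)) => //= w nsw.
  by apply: contrapT => /forallNP/good.
rewrite pr_setC// in tot.
have sumE : \sum_x bnd x = p%:R ^+ K * k%:R * (a * expR (- b * n%:R)) +
    2 * k%:R * (2 * expR (- (eps ^+ 2 / 8) * n%:R)).
  rewrite big_sumType /= big_sumType /= !sumr_const !card_prod card_ffun !card_ord.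
  have scale (x z : R) m : (x * z) *+ m = m%:R * (x * z) by rewrite mulr_natl.
  by rewrite !scale natrM natrX; ring.
rewrite sumE in tot.
have x1 : expR (- b * n%:R) <= expR (- b' * n%:R).
  by rewrite ler_expR !mulNr lerN2 ler_wpM2r ?(ltW nn)// /b' ge_min lexx.
have x2 : expR (- (eps ^+ 2 / 8) * n%:R) <= expR (- b' * n%:R).
  by rewrite ler_expR !mulNr lerN2 ler_wpM2r ?(ltW nn)// /b' ge_min lexx orbT.
rewrite powR_mulrn//.
have pK : 1 <= p%:R ^+ K :> R by rewrite exprn_ege1// ler1n.
rewrite lerBlDr -lerBlDl; apply: (le_trans tot).
set X0 := expR (- b' * _) in x1 x2 *; set X1 := expR (- b * _) in x1 *.
set X2 := expR _ in x2 *; set pk := p%:R ^+ K in pK *.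
have X00 : 0 <= X0 by exact: expR_ge0.
have kk0 : 0 <= k%:R :> R by [].
have t1 : pk * k%:R * (a * X1) <= pk * k%:R * (a * X0).
  by rewrite ler_wpM2l ?ler_wpM2l// ?(ltW a0)// mulr_ge0// (le_trans _ pK).
have t2 : 2 * k%:R * (2 * X2) <= pk * (4 * k%:R * X0).
  apply: (@le_trans _ _ (4 * k%:R * X0)); last first.
    by rewrite ler_peMl// mulr_ge0// mulr_ge0.
  have -> : 2 * k%:R * (2 * X2) = 4 * k%:R * X2 by ring.
  by rewrite ler_wpM2l// mulr_ge0.
apply: (le_trans (lerD t1 t2)); rewrite le_eqVlt; apply/orP; left; apply/eqP; ring.
Qed.

End finite_gap.

Theorem theorem6p1 (R : realType) (beta C C1 C2 : R) (delta : \bar R)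
    (hbeta : 0 <= beta) (hC : 0 <= C) (hC1 : 0 < C1) (hC2 : 0 < C2)
    (hdelta : (0 < delta)%E) :
  exists L1 L2 L3 : R, [/\ 0 < L1, 0 < L2, 0 < L3 &
    forall (d : measure_display) (T : measurableType d) (P : probability T R)
      (p : nat) (Y : {RV P >-> R}) (X : {RV P >-> p.-tuple R}),
    largest_gap Y X delta ->
    assumption_A1 Y X delta beta C ->
    assumption_A2 X delta C1 C2 ->
    forall (d' : measure_display) (T' : measurableType d')
      (P' : probability T' R) (n : nat)
      (Ys : 'I_n -> {RV P' >-> R}) (Xs : 'I_n -> {RV P' >-> p.-tuple R})
      (N : {set 'I_p} -> 'I_n -> T' -> 'I_n) (Shat : T' -> {set 'I_p}),
    (2 <= n)%N ->
    iid_copies Y X Ys Xs ->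
    uniform_tie_breaking Ys Xs N ->
    foci_output Ys N Shat ->
    ((1 - L1 * p%:R `^ L2 * expR (- L3 * n%:R))%:E <=
     P' [set w | sufficient Y X (Shat w)])%E].
Proof.
case: delta hdelta => [delta hdelta|_|//].
  rewrite lte_fin in hdelta.
  have [L1 [L2 [L3 [L1_gt0 L2_gt0 L3_gt0 consistent]]]] :=
    consistency_finite_gap hbeta hC hC1 hC2 hdelta.
  exists L1, L2, L3; split=> // d T P p Y X [gap _].
  exact: consistent.
(* the gap is infinite exactly when every set is sufficient *)
exists 1, 1, 1; split=> // d T P p Y X [gap _] _ _ d' T' P' n Ys Xs N Shat _ _ _ _.
rewrite (_ : [set w | _] = setT) ?probability_setT; last first.
  apply/seteqP; split=> // w _ /=; apply: contrapT => /gap[j _].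
  by rewrite !QpopE.
by rewrite lee_fin gerBl !mulr_ge0 ?powR_ge0 ?expR_ge0.
Qed.
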